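(* The set of multiplicative linear functionals consisting of evaluations at points of the open unit disc $\mathbb{D}$ is dense (in the weak* / Gelfand topology) in the maximal ideal space of $M(D(\mu_k))$.
   Context: Let $\mathbb{D}=\{z\in\mathbb{C}:|z|<1\}$ and $\mathbb{T}$ its boundary. For a nonnegative Borel measure $\mu$ on $\mathbb{T}$, let $\varphi_\mu(z)=\int_{\mathbb{T}}\frac{1-|z|^2}{|\zeta-z|^2}\,d\mu(\zeta)$, and let the Dirichlet-type space $D(\mu)$ be the space of analytic functions $f$ on $\mathbb{D}$ with $\int_{\mathbb{D}}|f'(z)|^2\varphi_\mu(z)\,dA(z)<\infty$, normed by $\|f\|_{D(\mu)}^2=\|f\|_{H^2(\mathbb{D})}^2+\int_{\mathbb{D}}|f'|^2\varphi_\mu\,dA$. Here $\mu_k=\sum_{i=1}^k a_i\delta_{\zeta_i}$ with $a_i>0$ and $\zeta_i\in\mathbb{T}$, and $M(D(\mu_k))=\{\phi\in D(\mu_k):\phi f\in D(\mu_k)\ \forall f\in D(\mu_k)\}$ is the multiplier algebra, which equals $D(\mu_k)\cap H^\infty(\mathbb{D})$ with norm $\|f\|_{D(\mu_k)}+\|f\|_\infty$. *)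

(* Defs.v *)
From HB Require Import structures.
From mathcomp Require Import all_boot all_order all_algebra.
From mathcomp Require Import all_classical all_reals all_analysis.
From mathcomp Require Import complex.
Set Implicit Arguments. Unset Strict Implicit. Unset Printing Implicit Defensive.
Import Order.TTheory GRing.Theory Num.Theory.
Import numFieldNormedType.Exports.
Local Open Scope classical_set_scope.
Local Open Scope ring_scope.

Section Defs.
Variable R : realType.
Local Notation C := R[i].

Definition cmod (z : C) : R := Num.sqrt (complex.Re z ^+ 2 + complex.Im z ^+ 2).

Definition in_disc (z : C) : Prop := cmod z < 1.

Definition is_cderive (f : C -> C) (z L : C) : Prop :=
  forall eps : R, 0 < eps -> exists2 delta : R, 0 < delta &
    forall h : C, h != 0 -> cmod h < delta ->
      cmod ((f (z + h) - f z) / h - L) < eps.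

Definition derivative_on_disc (f fp : C -> C) : Prop :=
  forall z, in_disc z -> is_cderive f z (fp z).

Definition analytic_on_disc (f : C -> C) : Prop :=
  exists fp, derivative_on_disc f fp.

Definition polar (r t : R) : C := Complex (r * cos t) (r * sin t).

Definition in_H2 (f : C -> C) : Prop :=
  exists M : R, forall r : R, 0 <= r -> r < 1 ->
    (\int[lebesgue_measure]_(t in `[0%R, (2 * pi)%R])
        ((cmod (f (polar r t))) ^+ 2)%:E <= M%:E)%E.

(* Poisson integral of mu_k = sum_i a_i delta_{zeta_i} *)
Definition phi_mu (k : nat) (a : 'I_k -> R) (zeta : 'I_k -> C) (z : C) : R :=
  \sum_(i < k) a i * (1 - cmod z ^+ 2) / (cmod (zeta i - z)) ^+ 2.

Definition area := (@lebesgue_measure R \x @lebesgue_measure R)%E.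

Definition dirichlet_integral (k : nat) (a : 'I_k -> R) (zeta : 'I_k -> C)
    (fp : C -> C) : \bar R :=
  (\int[area]_(p in [set p : R * R | in_disc (Complex p.1 p.2)])
     ((cmod (fp (Complex p.1 p.2))) ^+ 2 * phi_mu a zeta (Complex p.1 p.2))%:E)%E.

Definition in_Dmu (k : nat) (a : 'I_k -> R) (zeta : 'I_k -> C) (f : C -> C) : Prop :=
  in_H2 f /\ exists fp, derivative_on_disc f fp /\
    (dirichlet_integral a zeta fp < +oo)%E.

Definition multiplier (k : nat) (a : 'I_k -> R) (zeta : 'I_k -> C) (g : C -> C) : Prop :=
  in_Dmu a zeta g /\ forall f, in_Dmu a zeta f -> in_Dmu a zeta (fun z => g z * f z).

(* A point of the maximal ideal space of M(D(mu_k)): a nonzero multiplicative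
   linear functional on M(D(mu_k)).  Elements of M(D(mu_k)) are functions on D,
   represented by functions C -> C; the functional must therefore only depend
   on the values on D. *)
Definition character (k : nat) (a : 'I_k -> R) (zeta : 'I_k -> C)
    (psi : (C -> C) -> C) : Prop :=
  [/\ forall f g, (forall z, in_disc z -> f z = g z) -> psi f = psi g,
      forall f g, multiplier a zeta f -> multiplier a zeta g ->
        psi (fun z => f z + g z) = psi f + psi g,
      forall (c : C) f, multiplier a zeta f -> psi (fun z => c * f z) = c * psi f,
      forall f g, multiplier a zeta f -> multiplier a zeta g ->
        psi (fun z => f z * g z) = psi f * psi g
    & exists2 f, multiplier a zeta f & psi f != 0].

End Defs.

(* Main.v *)
Require Import Defs.
From HB Require Import structures.
From mathcomp Require Import all_boot all_order all_algebra.
From mathcomp Require Import all_classical all_reals all_analysis.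
From mathcomp Require Import complex spectral measurable_realfun ring lra zify.
Import Order.TTheory GRing.Theory Num.Theory.
Import numFieldNormedType.Exports.
Import Normc.
Local Open Scope ring_scope.

(* A function [g] lies in [D(mu_k)] iff at each [zeta_i] it can be written [c + (z - zeta_i) u] with
   [u] in the Hardy space: writing [w = g' / (zeta - z)], the local Dirichlet integral is a weighted
   l^2 norm of the Taylor coefficients of [w], and the inequalities of Hardy and Copson turn its
   finiteness into that decomposition.  Hence the multipliers are the bounded elements of [D(mu_k)].

   If some basic neighbourhood of a character [psi] contained no evaluation, the multipliers
   [g_j = f_j - psi(f_j)] would satisfy [sum |g_j|^2 >= eps^2] on the disc, and Carleson's corona
   theorem would give bounded analytic [h_j] with [sum g_j h_j = 1].  The [h_j] need not be
   multipliers, but suitable combinations [e_i] of the [g_j] have value 1 at [zeta_i], so that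
   [E = prod (1 - e_i)] makes every [E h_j] a multiplier; applying [psi] to [E = sum g_j (E h_j)]
   gives [1 = 0].

   The corona theorem is obtained by duality.  A maximum principle, applied to an auxiliary function
   built from the smooth solution [conj g_j / |g|^2], bounds from below the adjoint of the
   row of Toeplitz operators of polynomials; on lower triangular truncations a lurking isometry turns
   that bound into a contractive solution, and an ultrafilter limit of its coefficients remains. *)

Set Implicit Arguments.
Unset Strict Implicit.
Unset Printing Implicit Defensive.
Local Open Scope classical_set_scope.
Local Open Scope ring_scope.

(** * Moduli and finite sums *)

(** The obstruction to using the corona solutions as they are is local. A bounded analytic function
    may have no limit at [zeta i], whereas a multiplier must be [c + (z - zeta i) u] there. A factor
    that vanishes at [zeta i] in this sense repairs the defect, because a bounded function times a
    Hardy function is a Hardy function. The ideal provides such factors because the values of the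
    [g_j] at [zeta i] cannot all be zero: otherwise [sum g_j h_j = 1] would tend to 0 along the
    radius. Multipliers carry no norm in their definition, so their boundedness comes from a gliding
    hump and not from the closed graph theorem. For the corona theorem the data are polynomials,
    smooth up to the circle. There [|X|^2] is the real part of a polynomial whose value at 0 is the
    sum of the squared coefficients of [X]; evaluation at 0 thus replaces integration over the
    circle, and the maximum principle replaces Green's formula. The auxiliary function contains the
    squares of [F_l (F_j q_i - F_i q_j)]: their Laplacian absorbs that of the nonanalytic term, and
    they are small on the circle, where [q] is nearly proportional to [F]. *)

Section Modulus.
Variable R : realType.
Local Notation C := R[i].
Implicit Types z w : C.

Lemma cmodE z : cmod z = normc z. Proof. by case: z. Qed.

Lemma sqr_cmod z : cmod z ^+ 2 = complex.Re z ^+ 2 + complex.Im z ^+ 2.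
Proof. by rewrite sqr_sqrtr// addr_ge0 ?sqr_ge0. Qed.

Lemma cmod_ge0 z : 0 <= cmod z. Proof. exact: sqrtr_ge0. Qed.

Lemma cmodM z w : cmod (z * w) = cmod z * cmod w.
Proof. by rewrite !cmodE normcM. Qed.

Lemma cmod0 : cmod (0 : C) = 0. Proof. by rewrite cmodE normc0. Qed.

Lemma cmod1 : cmod (1 : C) = 1. Proof. by rewrite cmodE normc1. Qed.

Lemma cmodN z : cmod (- z) = cmod z.
Proof. by rewrite !cmodE normcN. Qed.

Lemma cmodD z w : cmod (z + w) <= cmod z + cmod w.
Proof. by rewrite !cmodE le_normcD. Qed.

Lemma cmodB z w : cmod (z - w) <= cmod z + cmod w.
Proof. by rewrite (le_trans (cmodD _ _)) // cmodN. Qed.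

Lemma cmodC z w : cmod (z - w) = cmod (w - z).
Proof. by rewrite -cmodN opprB. Qed.

Lemma cmod_triangle v z w : cmod (z - w) <= cmod (z - v) + cmod (v - w).
Proof. by rewrite (le_trans _ (cmodD _ _)) // addrA subrK. Qed.

Lemma ler_cmodB z w : cmod z - cmod w <= cmod (z - w).
Proof. by rewrite lerBlDr (le_trans _ (cmodD _ _)) // subrK. Qed.

Lemma ler_dist_cmod z w : `|cmod z - cmod w| <= cmod (z - w).
Proof.
by rewrite ler_norml ler_cmodB andbT lerNl opprB cmodC ler_cmodB.
Qed.

Lemma cmod_eq0 z : (cmod z == 0) = (z == 0).
Proof.
apply/eqP/eqP => [|->]; last exact: cmod0.
by rewrite cmodE => /eq0_normc.
Qed.

Lemma cmod_gt0 z : (0 < cmod z) = (z != 0).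
Proof. by rewrite lt_neqAle cmod_ge0 andbT eq_sym cmod_eq0. Qed.

Lemma cmodV z : cmod z^-1 = (cmod z)^-1.
Proof. by rewrite !cmodE normcV. Qed.

Lemma cmod_div z w : cmod (z / w) = cmod z / cmod w.
Proof. by rewrite cmodM cmodV. Qed.

Lemma cmodX z n : cmod (z ^+ n) = cmod z ^+ n.
Proof. by elim: n => [|n IH]; rewrite ?cmod1 // !exprS cmodM IH. Qed.

Lemma cmod_conj z : cmod (conjc z) = cmod z.
Proof. by case: z => a b; rewrite /cmod /= sqrrN. Qed.

Lemma cmod_real (x : R) : cmod (real_complex R x) = `|x|.
Proof. by rewrite /cmod /= expr0n /= addr0 sqrtr_sqr. Qed.

Lemma cmod_nat n : cmod (n%:R : C) = n%:R.
Proof. by rewrite -(rmorph_nat (real_complex R)) cmod_real normr_nat. Qed.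

Lemma cmod_Re z : `|complex.Re z| <= cmod z.
Proof. by rewrite -sqrtr_sqr ler_wsqrtr // lerDl sqr_ge0. Qed.

Lemma cmod_Im z : `|complex.Im z| <= cmod z.
Proof. by rewrite -sqrtr_sqr ler_wsqrtr // lerDr sqr_ge0. Qed.

Lemma cmod_le_ReIm z : cmod z <= `|complex.Re z| + `|complex.Im z|.
Proof.
rewrite -(ler_pXn2r (n := 2)) ?nnegrE ?addr_ge0 ?cmod_ge0 //.
rewrite sqr_cmod -(real_normK (num_real (complex.Re z))).
rewrite -(real_normK (num_real (complex.Im z))).
have := mulr_ge0 (normr_ge0 (complex.Re z)) (normr_ge0 (complex.Im z)).
by nra.
Qed.

Lemma Re_add z w : complex.Re (z + w) = complex.Re z + complex.Re w.
Proof. by case: z w => [a b] [c d]. Qed.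

Lemma Im_add z w : complex.Im (z + w) = complex.Im z + complex.Im w.
Proof. by case: z w => [a b] [c d]. Qed.

Lemma Re_opp z : complex.Re (- z) = - complex.Re z.
Proof. by case: z. Qed.

Lemma Im_opp z : complex.Im (- z) = - complex.Im z.
Proof. by case: z. Qed.

Lemma Re_mul z w : complex.Re (z * w) =
  complex.Re z * complex.Re w - complex.Im z * complex.Im w.
Proof. by case: z w => [a b] [c d]. Qed.

Lemma Im_mul z w : complex.Im (z * w) =
  complex.Re z * complex.Im w + complex.Im z * complex.Re w.
Proof. by case: z w => [a b] [c d]. Qed.

Lemma Re_sum I (r : seq I) (P : pred I) (F : I -> C) :
  complex.Re (\sum_(i <- r | P i) F i) = \sum_(i <- r | P i) complex.Re (F i).
Proof. exact: (big_morph _ Re_add). Qed.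

Lemma Im_sum I (r : seq I) (P : pred I) (F : I -> C) :
  complex.Im (\sum_(i <- r | P i) F i) = \sum_(i <- r | P i) complex.Im (F i).
Proof. exact: (big_morph _ Im_add). Qed.

Lemma Re_conjc z : complex.Re (conjc z) = complex.Re z.
Proof. by case: z. Qed.

Lemma Im_conjc z : complex.Im (conjc z) = - complex.Im z.
Proof. by case: z. Qed.

Lemma mul_conjc z : z * conjc z = real_complex R (cmod z ^+ 2).
Proof.
rewrite sqr_cmod; case: z => a b /=.
by apply/eqP; rewrite eq_complex /=; apply/andP; split; apply/eqP; ring.
Qed.

Lemma cmod_sum I (r : seq I) (P : pred I) (F : I -> C) :
  cmod (\sum_(i <- r | P i) F i) <= \sum_(i <- r | P i) cmod (F i).
Proof.
apply: (big_ind2 (fun x y => cmod x <= y)); first by rewrite cmod0.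
- by move=> a b c d ab cd; rewrite (le_trans (cmodD _ _)) // lerD.
- by [].
Qed.

Lemma complex_ext z w :
  complex.Re z = complex.Re w -> complex.Im z = complex.Im w -> z = w.
Proof. by case: z w => [a b] [c d] /= -> ->. Qed.

Lemma sqr_cmodD_le z w : cmod (z + w) ^+ 2 <= 2 * cmod z ^+ 2 + 2 * cmod w ^+ 2.
Proof.
rewrite !sqr_cmod Re_add Im_add.
set a := complex.Re z; set b := complex.Im z.
set c := complex.Re w; set d := complex.Im w.
have := sqr_ge0 (a - c); have := sqr_ge0 (b - d).
by nra.
Qed.

End Modulus.

(** * The Cauchy-Schwarz inequality for finite sums *)

Section CauchySchwarz.
Variable R : realType.
Local Notation C := R[i].

Lemma cauchy_schwarz_sum I (r : seq I) (P : pred I) (x y : I -> R) :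
  (\sum_(i <- r | P i) x i * y i) ^+ 2 <=
  (\sum_(i <- r | P i) x i ^+ 2) * (\sum_(i <- r | P i) y i ^+ 2).
Proof.
set A := \sum_(i <- r | P i) x i ^+ 2; set B := \sum_(i <- r | P i) y i ^+ 2.
set S := \sum_(i <- r | P i) x i * y i.
have A0 : 0 <= A by apply: sumr_ge0 => i _; exact: sqr_ge0.
have B0 : 0 <= B by apply: sumr_ge0 => i _; exact: sqr_ge0.
have key (s t : R) : 0 <= s ^+ 2 * A - 2 * s * t * S + t ^+ 2 * B.
  have -> : s ^+ 2 * A - 2 * s * t * S + t ^+ 2 * B =
      \sum_(i <- r | P i) (s * x i - t * y i) ^+ 2.
    rewrite /A /B /S !mulr_sumr -sumrB -big_split /=.
    by apply: eq_bigr => i _; ring.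
  by apply: sumr_ge0 => i _; exact: sqr_ge0.
have [B00|Bn0] := eqVneq B 0.
  (* When [B = 0] this choice turns [key] into [- (A + 2) * S ^+ 2 >= 0], which forces [S = 0]. *)
  have := key S (A + 1); rewrite B00.
  have := sqr_ge0 S; nra.
have Bp : 0 < B by rewrite lt_neqAle eq_sym Bn0.
have := key B S.
have -> : B ^+ 2 * A - 2 * B * S * S + S ^+ 2 * B = B * (A * B - S ^+ 2) by ring.
by rewrite pmulr_rge0 // subr_ge0.
Qed.

Lemma cauchy_schwarz_cmod I (r : seq I) (P : pred I) (x y : I -> C) :
  cmod (\sum_(i <- r | P i) x i * y i) ^+ 2 <=
  (\sum_(i <- r | P i) cmod (x i) ^+ 2) * (\sum_(i <- r | P i) cmod (y i) ^+ 2).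
Proof.
apply: le_trans (cauchy_schwarz_sum _ _ _ _).
rewrite ler_pXn2r ?nnegrE ?cmod_ge0 ?sumr_ge0 //; last first.
  by move=> i _; rewrite mulr_ge0 ?cmod_ge0.
by apply: le_trans (cmod_sum _ _ _) _; apply: ler_sum => i _; rewrite cmodM.
Qed.

End CauchySchwarz.

(** * Complex sequences and power series on the unit disc *)

Section ComplexSequences.
Variable R : realType.
Local Notation C := R[i].
Implicit Types (u v : nat -> C) (l m : C).

Definition ccvg u l : Prop :=
  forall e : R, 0 < e -> exists N, forall n, (N <= n)%N -> cmod (u n - l) < e.

Lemma ccvg_cst l : ccvg (fun=> l) l.
Proof. by move=> e e0; exists 0%N => n _; rewrite subrr cmod0. Qed.

Lemma ccvg_ext u v l : (forall n, u n = v n) -> ccvg u l -> ccvg v l.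
Proof. by move=> uv /[swap] e /[apply] -[N uN]; exists N => n /uN; rewrite uv. Qed.

Lemma ccvgD u v l m : ccvg u l -> ccvg v m -> ccvg (fun n => u n + v n) (l + m).
Proof.
move=> ul vm e e0; have e20 : 0 < e / 2 by rewrite divr_gt0.
have [N uN] := ul _ e20; have [N' vN] := vm _ e20.
exists (maxn N N') => n; rewrite geq_max => /andP[/uN un /vN vn].
rewrite opprD addrACA (le_lt_trans (cmodD _ _)) //.
by rewrite [e]splitr ltrD.
Qed.

Lemma ccvg_bounded u l : ccvg u l -> exists K, 0 < K /\ forall n, cmod (u n) <= K.
Proof.
move=> /(_ 1 ltr01) [N uN].
exists (1 + cmod l + \sum_(i < N) cmod (u i)).
have S0 : 0 <= \sum_(i < N) cmod (u i) by apply: sumr_ge0 => i _; exact: cmod_ge0.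
split; first by have := cmod_ge0 l; lra.
move=> n; have [/uN un|nN] := leqP N n.
  have := cmod_triangle l (u n) 0; rewrite !subr0; lra.
rewrite (bigD1 (Ordinal nN)) //=.
have : 0 <= \sum_(i < N | i != Ordinal nN) cmod (u i).
  by apply: sumr_ge0 => i _; exact: cmod_ge0.
have := cmod_ge0 l; lra.
Qed.

Lemma ccvgZ c u l : ccvg u l -> ccvg (fun n => c * u n) (c * l).
Proof.
move=> ul e e0; have c0 : 0 < cmod c + 1 by rewrite ltr_wpDl ?cmod_ge0.
have [N uN] := ul _ (divr_gt0 e0 c0); exists N => n /uN un.
rewrite -mulrBr cmodM.
rewrite (le_lt_trans (y := (cmod c + 1) * cmod (u n - l))) //.
  by rewrite ler_wpM2r ?cmod_ge0 // lerDl.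
by rewrite mulrC -ltr_pdivlMr.
Qed.

Lemma ccvgN u l : ccvg u l -> ccvg (fun n => - u n) (- l).
Proof. by move=> /(ccvgZ (-1)); rewrite mulN1r; apply: ccvg_ext => n; rewrite mulN1r. Qed.

Lemma ccvgM u v l m : ccvg u l -> ccvg v m -> ccvg (fun n => u n * v n) (l * m).
Proof.
move=> ul vm; have [K [K0 vK]] := ccvg_bounded vm.
have H : ccvg (fun n => (u n - l) * v n) 0.
  move=> e e0; have [N uN] := ul _ (divr_gt0 e0 K0).
  exists N => n /uN un; rewrite subr0 cmodM.
  rewrite (le_lt_trans (y := cmod (u n - l) * K)) ?ler_wpM2l ?cmod_ge0 //.
  by rewrite -ltr_pdivlMr.
have := ccvgD H (ccvgZ l vm); rewrite add0r; apply: ccvg_ext => n.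
by rewrite mulrBl subrK.
Qed.

Lemma ccvg_unique u l m : ccvg u l -> ccvg u m -> l = m.
Proof.
move=> ul um; apply/eqP; rewrite -subr_eq0 -cmod_eq0; apply/eqP.
apply/le_anti; rewrite cmod_ge0 andbT; apply/ler_addgt0Pl => e e0; rewrite addr0.
have e20 : 0 < e / 2 by rewrite divr_gt0.
have [N uN] := ul _ e20; have [N' vN] := um _ e20.
have := uN (maxn N N') (leq_maxl _ _); have := vN (maxn N N') (leq_maxr _ _).
have := cmod_triangle (u (maxn N N')) l m; rewrite (cmodC l (u _)); lra.
Qed.

Lemma ccvg_shift k u l : ccvg u l -> ccvg (fun n => u (n + k)%N) l.
Proof.
move=> ul e /ul[N uN]; exists N => n Nn; apply: uN.
exact: leq_trans Nn (leq_addr _ _).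
Qed.

Lemma ccvg_unshift k u l : ccvg (fun n => u (n + k)%N) l -> ccvg u l.
Proof.
move=> ul e /ul[N uN]; exists (N + k)%N => n Nn.
by rewrite -(subnK (leq_trans (leq_addl _ _) Nn)); apply: uN; lia.
Qed.

Lemma ccvg_dist_le u l m K N :
  (forall n, (N <= n)%N -> cmod (u n - m) <= K) -> ccvg u l -> cmod (l - m) <= K.
Proof.
move=> uK ul; apply/ler_addgt0Pl => e /ul[N' uN].
have := uN (maxn N N') (leq_maxr _ _); have := uK (maxn N N') (leq_maxl _ _).
have := cmod_triangle (u (maxn N N')) l m; rewrite (cmodC l (u _)); lra.
Qed.

Lemma ccvg_cmod_le u l K N :
  (forall n, (N <= n)%N -> cmod (u n) <= K) -> ccvg u l -> cmod l <= K.
Proof.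
move=> uK ul; rewrite -[l]subr0; apply: (ccvg_dist_le (N := N)) ul => n /uK.
by rewrite subr0.
Qed.

Lemma ccvg_cmod u l : ccvg u l -> (fun n => cmod (u n)) @ \oo --> cmod l.
Proof.
move=> ul; apply/cvgrPdist_lt => e /ul[N uN]; near=> n.
rewrite distrC (le_lt_trans (ler_dist_cmod _ _)) // uN //.
by near: n; exists N.
Unshelve. all: by end_near. Qed.

Lemma ccvg_ReIm u (a b : R) :
  (fun n => complex.Re (u n)) @ \oo --> a ->
  (fun n => complex.Im (u n)) @ \oo --> b -> ccvg u (Complex a b).
Proof.
move=> ua ub e e0; have e20 : 0 < e / 2 by rewrite divr_gt0.
move/cvgrPdist_lt: ua => /(_ _ e20)[N _ uN].
move/cvgrPdist_lt: ub => /(_ _ e20)[N' _ uN'].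
exists (maxn N N') => n; rewrite geq_max => /andP[/uN /= un /uN' /= un'].
rewrite (le_lt_trans (cmod_le_ReIm _)) // Re_add Im_add Re_opp Im_opp /=.
by rewrite [e]splitr ltrD // distrC.
Qed.

Lemma abs_summable_ccvg (a : nat -> C) (M : R) :
  (forall n, \sum_(i < n) cmod (a i) <= M) ->
  exists s, ccvg (fun n => \sum_(i < n) a i) s.
Proof.
move=> aM.
have key (b : nat -> R) : (forall i, `|b i| <= cmod (a i)) ->
    cvgn (fun n => \sum_(i < n) b i).
  move=> ba; have /normed_cvg : cvgn [normed series b].
    apply: nondecreasing_is_cvgn.
      by apply: nondecreasing_series => i _ _; exact: normr_ge0.
    exists M => _ [n _ <-]. rewrite [leLHS](_ : _ = \sum_(i < n) `|b i|); last by rewrite -(big_mkord xpredT (fun i => `|b i|)).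
    by apply: le_trans (aM n); apply: ler_sum => i _.
  by rewrite seriesEord.
have [s ss] : exists s : R, (fun n => \sum_(i < n) complex.Re (a i)) @ \oo --> s.
  by apply/cvg_ex; exact: (key _ (fun i => cmod_Re (a i))).
have [t tt] : exists t : R, (fun n => \sum_(i < n) complex.Im (a i)) @ \oo --> t.
  by apply/cvg_ex; exact: (key _ (fun i => cmod_Im (a i))).
exists (Complex s t); apply: ccvg_ReIm.
  by under eq_fun do rewrite Re_sum.
by under eq_fun do rewrite Im_sum.
Qed.

End ComplexSequences.

(** * Power series: differentiation, uniqueness of coefficients, products *)

Section PowerSeries.
Variable R : realType.
Local Notation C := R[i].
Implicit Types (a b : nat -> C) (z h : C) (f g : C -> C) (r : R).

Definition psum a z n : C := \sum_(i < n) a i * z ^+ i.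

Definition expands a f : Prop := forall z, in_disc z -> ccvg (psum a z) (f z).

(** Radius of convergence at least 1, in a form free of limits. Passing from [r] to a radius [s]
    between [r] and 1 gains the ratio [r / s], which upgrades boundedness to summability and absorbs
    polynomial factors. *)
Definition subgeom a : Prop :=
  forall r, 0 <= r -> r < 1 -> exists K, forall i, cmod (a i) * r ^+ i <= K.

Lemma psumS a z n : psum a z n.+1 = psum a z n + a n * z ^+ n.
Proof. by rewrite /psum big_ord_recr. Qed.

Lemma psum_shift a z n : psum a z n.+1 = a 0%N + z * psum (fun i => a i.+1) z n.
Proof.
rewrite /psum big_ord_recl expr0 mulr1; congr (_ + _).
by rewrite mulr_sumr; apply: eq_bigr => i _; rewrite exprS mulrCA.
Qed.

Lemma in_disc0 : in_disc (0 : C).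
Proof. by rewrite /in_disc cmod0 ltr01. Qed.

Lemma in_disc_real r : 0 <= r -> r < 1 -> in_disc (real_complex R r).
Proof. by move=> r0 r1; rewrite /in_disc cmod_real ger0_norm. Qed.

Lemma disc_radius z : in_disc z -> exists r, [/\ cmod z < r, 0 < r & r < 1].
Proof.
move=> zD; exists ((cmod z + 1) / 2); have := cmod_ge0 z.
by move: zD; rewrite /in_disc => zD z0; split; lra.
Qed.

Lemma expands_subgeom a f : expands a f -> subgeom a.
Proof.
move=> af r r0 r1; have [K [_ aK]] := ccvg_bounded (af _ (in_disc_real r0 r1)).
exists (K + K) => i.
have -> : cmod (a i) * r ^+ i = cmod (a i * real_complex R r ^+ i).
  by rewrite cmodM cmodX cmod_real ger0_norm.
have -> : a i * real_complex R r ^+ i =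
  psum a (real_complex R r) i.+1 - psum a (real_complex R r) i.
  by rewrite psumS addrAC subrr add0r.
by rewrite (le_trans (cmodB _ _)) // lerD.
Qed.

Lemma geometric_sum_le r n : 0 <= r -> r < 1 -> \sum_(i < n) r ^+ i <= (1 - r)^-1.
Proof.
move=> r0 r1; rewrite -(ler_pM2l (x := 1 - r)) ?subr_gt0 //.
rewrite divff ?lt0r_neq0 ?subr_gt0 // -opprB mulNr -subrX1 opprB lerBlDr lerDl.
exact: exprn_ge0.
Qed.

(** Each of the [n.+1] powers [r ^+ i] with [i <= n] is at least [r ^+ n]. *)
Lemma natmul_geom_le r n : 0 <= r -> r < 1 -> n.+1%:R * r ^+ n <= (1 - r)^-1.
Proof.
move=> r0 r1; apply: le_trans (geometric_sum_le n.+1 r0 r1).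
rewrite mulrC mulr_natr -[X in _ *+ X]card_ord -sumr_const; apply: ler_sum => i _.
have := ltn_ord i; rewrite ltnS => im.
by rewrite ler_wiXn2l // ltW.
Qed.

Lemma subgeom_summable a r : subgeom a -> 0 <= r -> r < 1 ->
  exists B, forall n, \sum_(i < n) cmod (a i) * r ^+ i <= B.
Proof.
move=> asub r0 r1; set s := (r + 1) / 2.
have s0 : 0 < s by rewrite /s; lra.
have rs : r < s by rewrite /s; lra.
have s1 : s < 1 by rewrite /s; lra.
have [K aK] := asub s (ltW s0) s1.
have K0 : 0 <= K by apply: le_trans (aK 0%N); rewrite expr0 mulr1 cmod_ge0.
exists (K * (1 - r / s)^-1) => n.
have q0 : 0 <= r / s by rewrite divr_ge0 // ltW.
have q1 : r / s < 1 by rewrite ltr_pdivrMr // mul1r.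
apply: le_trans (ler_wpM2l K0 (geometric_sum_le n q0 q1)).
rewrite mulr_sumr; apply: ler_sum => i _.
have -> : r ^+ i = s ^+ i * (r / s) ^+ i.
  by rewrite -exprMn mulrCA divff ?mulr1 // lt0r_neq0.
by rewrite mulrA ler_wpM2r ?exprn_ge0.
Qed.

Lemma subgeom_succ a : subgeom a -> subgeom (fun i => a i.+1).
Proof.
move=> asub r r0 r1; set s := (r + 1) / 2.
have s0 : 0 < s by rewrite /s; lra.
have rs : r <= s by rewrite /s; lra.
have s1 : s < 1 by rewrite /s; lra.
have [K aK] := asub s (ltW s0) s1; exists (K / s) => i.
rewrite ler_pdivlMr //; apply: le_trans (aK i.+1).
rewrite -mulrA ler_wpM2l ?cmod_ge0 // exprSr ler_wpM2r ?(ltW s0) //.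
by apply: lerXn2r; rewrite ?nnegrE ?(ltW s0).
Qed.

Lemma subgeom_natmul a : subgeom a -> subgeom (fun i => i.+1%:R * a i).
Proof.
move=> asub r r0 r1; set s := (r + 1) / 2.
have s0 : 0 < s by rewrite /s; lra.
have rs : r < s by rewrite /s; lra.
have s1 : s < 1 by rewrite /s; lra.
have [K aK] := asub s (ltW s0) s1.
have q0 : 0 <= r / s by rewrite divr_ge0 // ltW.
have q1 : r / s < 1 by rewrite ltr_pdivrMr // mul1r.
exists (K * (1 - r / s)^-1) => i.
have -> : r ^+ i = s ^+ i * (r / s) ^+ i.
  by rewrite -exprMn mulrCA divff ?mulr1 // lt0r_neq0.
rewrite cmodM cmod_nat mulrC mulrACA mulrC.
rewrite [X in X <= _](_ : _ = cmod (a i) * s ^+ i * (i.+1%:R * (r / s) ^+ i)); last by ring.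
apply: ler_pM => //; rewrite ?mulr_ge0 ?cmod_ge0 ?exprn_ge0 ?ler0n ?(ltW s0) //.
exact: natmul_geom_le.
Qed.

Lemma bounded_subgeom a K : (forall i, cmod (a i) <= K) -> subgeom a.
Proof.
move=> aK r r0 r1; exists K => i; apply: le_trans (aK i).
by rewrite ler_piMr ?cmod_ge0 // exprn_ile1 // ltW.
Qed.

Lemma subgeom_le a b : (forall i, cmod (b i) <= cmod (a i)) -> subgeom a -> subgeom b.
Proof.
move=> ba asub r r0 r1; have [K aK] := asub r r0 r1; exists K => i.
by apply: le_trans (aK i); rewrite ler_wpM2r ?exprn_ge0.
Qed.

Lemma subgeom_expands a : subgeom a -> exists f, expands a f.
Proof.
move=> asub.
have H z : exists s, in_disc z -> ccvg (psum a z) s.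
  have [zD|] := pselect (in_disc z); last by exists 0.
  have [B aB] := subgeom_summable asub (cmod_ge0 z) zD.
  have [s ss] : exists s, ccvg (psum a z) s.
    apply: (@abs_summable_ccvg _ (fun i => a i * z ^+ i) B) => n.
    by under eq_bigr do rewrite cmodM cmodX.
  by exists s.
by have [f fP] := choice H; exists f.
Qed.

Lemma expands_ext a f g :
  (forall z, in_disc z -> f z = g z) -> expands a f -> expands a g.
Proof. by move=> fg af z zD; rewrite -fg //; exact: af. Qed.

Lemma expandsD a b f g : expands a f -> expands b g ->
  expands (fun i => a i + b i) (fun z => f z + g z).
Proof.
move=> af bg z zD; apply: ccvg_ext (ccvgD (af _ zD) (bg _ zD)) => n.
by rewrite /psum -big_split /=; apply: eq_bigr => i _; rewrite mulrDl.
Qed.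

Lemma expandsZ c a f : expands a f -> expands (fun i => c * a i) (fun z => c * f z).
Proof.
move=> af z zD; apply: ccvg_ext (ccvgZ c (af _ zD)) => n.
by rewrite /psum mulr_sumr; apply: eq_bigr => i _; rewrite mulrA.
Qed.

Lemma expandsN a f : expands a f -> expands (fun i => - a i) (fun z => - f z).
Proof.
move=> af z zD; apply: ccvg_ext (ccvgN (af _ zD)) => n.
by rewrite /psum -sumrN; apply: eq_bigr => i _; rewrite mulNr.
Qed.

Lemma expandsB a b f g : expands a f -> expands b g ->
  expands (fun i => a i - b i) (fun z => f z - g z).
Proof. by move=> af bg; exact: expandsD af (expandsN bg). Qed.

Lemma expands_cst c : expands (fun i => if i is 0%N then c else 0) (fun=> c).
Proof.
move=> z zD; apply: (@ccvg_unshift _ 1); apply: ccvg_ext (ccvg_cst c) => n.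
rewrite addn1 psum_shift /psum big1 ?mulr0 ?addr0 // => i _.
by rewrite mul0r.
Qed.

Definition mulX a i : C := if i is j.+1 then a j else 0.

Lemma expandsX a f : expands a f -> expands (mulX a) (fun z => z * f z).
Proof.
move=> af z zD; apply: (@ccvg_unshift _ 1).
apply: ccvg_ext (ccvgZ z (af _ zD)) => n.
by rewrite addn1 psum_shift /= add0r.
Qed.

Lemma expands_psum_le a f z r B : 0 <= r -> r < 1 -> cmod z <= r ->
  expands a f -> (forall n, \sum_(i < n) cmod (a i) * r ^+ i <= B) -> cmod (f z) <= B.
Proof.
move=> r0 r1 zr af aB; apply: (ccvg_cmod_le (N := 0%N)) (af z (le_lt_trans zr r1)).
move=> n _; apply: le_trans (aB n); apply: le_trans (cmod_sum _ _ _) _.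
apply: ler_sum => i _; rewrite cmodM cmodX ler_wpM2l ?cmod_ge0 //.
by rewrite lerXn2r ?nnegrE ?cmod_ge0.
Qed.

Definition dcoef a i : C := i.+1%:R * a i.+1.

Lemma subgeom_dcoef a : subgeom a -> subgeom (dcoef a).
Proof.
move=> asub; apply: subgeom_le (subgeom_succ (subgeom_natmul asub)) => i.
rewrite /dcoef !cmodM ler_wpM2r ?cmod_ge0 // !cmod_nat ler_nat.
exact: leqnSn.
Qed.

(** The factor [r] on the left stands for the exponent [i - 1] of the usual bound, so that [i = 0]
    is no exception. *)
Lemma expr_taylor2 z h r i : 0 < r -> cmod z <= r -> cmod (z + h) <= r ->
  cmod ((z + h) ^+ i.+1 - z ^+ i.+1 - h * (i.+1%:R * z ^+ i)) * r <=
  cmod h ^+ 2 * (i.+1%:R ^+ 2 * r ^+ i).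
Proof.
move=> r0 zr zhr; elim: i => [|i IH].
  rewrite (_ : _ - _ = 0); last by ring.
  by rewrite cmod0 mul0r expr0 expr1n !mulr1 sqr_ge0.
set E := (z + h) ^+ i.+1 - z ^+ i.+1 - h * (i.+1%:R * z ^+ i) in IH *.
have -> : (z + h) ^+ i.+2 - z ^+ i.+2 - h * (i.+2%:R * z ^+ i.+1) =
    (z + h) * E + h ^+ 2 * (i.+1%:R * z ^+ i).
  rewrite /E (exprS _ i.+1) [z ^+ i.+2]exprS [i.+2%:R]mulrS.
  set p := (z + h) ^+ i.+1; rewrite !exprS; ring.
apply: le_trans (_ : (r * cmod E + cmod h ^+ 2 * (i.+1%:R * r ^+ i)) * r <= _).
  rewrite ler_wpM2r ?(ltW r0) // (le_trans (cmodD _ _)) // !cmodM cmodX cmod_nat.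
  rewrite lerD ?ler_wpM2r ?cmod_ge0 // ler_wpM2l ?sqr_ge0 //.
  by rewrite ler_wpM2l ?ler0n // lerXn2r ?nnegrE ?cmod_ge0 ?(ltW r0).
rewrite mulrDl -mulrA.
apply: le_trans (lerD (ler_wpM2l (ltW r0) IH) (lexx _)) _.
have -> : r * (cmod h ^+ 2 * (i.+1%:R ^+ 2 * r ^+ i)) +
    cmod h ^+ 2 * (i.+1%:R * r ^+ i) * r =
    cmod h ^+ 2 * ((i.+1%:R ^+ 2 + i.+1%:R) * r ^+ i.+1).
  by rewrite (exprS r); ring.
rewrite ler_wpM2l ?sqr_ge0 // ler_wpM2r ?exprn_ge0 ?(ltW r0) //.
have := ler0n R i.+1; rewrite [i.+2%:R]mulrS; nra.
Qed.

(** The remainder is estimated term by term; the majorant converges because multiplying the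
    coefficients twice by [i.+1] keeps the radius of convergence. *)
Lemma expands_taylor2 a f g z : expands a f -> expands (dcoef a) g -> in_disc z ->
  exists d B, [/\ 0 < d, forall h, cmod h < d -> in_disc (z + h) &
    forall h, cmod h < d -> cmod (f (z + h) - f z - h * g z) <= B * cmod h ^+ 2].
Proof.
move=> af ag zD; have [r [zr r0 r1]] := disc_radius zD.
have asub := expands_subgeom af.
have [B aB] := subgeom_summable
  (subgeom_succ (subgeom_natmul (subgeom_natmul asub))) (ltW r0) r1.
exists (r - cmod z), (B / r).
have hr h : cmod h < r - cmod z -> cmod (z + h) <= r.
  by move=> hd; rewrite (le_trans (cmodD _ _)) //; lra.
split; first by rewrite subr_gt0.
  by move=> h /hr hr'; rewrite /in_disc (le_lt_trans hr').
move=> h /hr hr'; have zhD : in_disc (z + h) by rewrite /in_disc (le_lt_trans hr').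
have := ccvgD (ccvgD (af _ zhD) (ccvgN (af _ zD))) (ccvgN (ccvgZ h (ag _ zD))).
move=> /(_); rewrite -/(_ - _).
have cv : ccvg (fun n => psum a (z + h) n.+1 - psum a z n.+1 - h * psum (dcoef a) z n)
    (f (z + h) - f z - h * g z).
  apply: ccvgD; last exact/ccvgN/ccvgZ/ag.
  apply: (@ccvgD _ (fun n => psum a (z + h) n.+1) (fun n => - psum a z n.+1)).
    by apply: ccvg_ext (ccvg_shift 1 (af _ zhD)) => n; rewrite addn1.
  by apply: ccvgN; apply: ccvg_ext (ccvg_shift 1 (af _ zD)) => n; rewrite addn1.
move=> _; apply: (ccvg_cmod_le (N := 0%N)) cv => n _.
rewrite /psum -sumrB big_ord_recl /= !expr0 subrr add0r mulr_sumr -sumrB.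
rewrite -(ler_pM2r r0) mulrAC divfK ?lt0r_neq0 // mulrC.
apply: le_trans (ler_wpM2l (ltW r0) (cmod_sum _ _ _)) _.
rewrite mulr_sumr mulrC; apply: le_trans (ler_wpM2l (sqr_ge0 _) (aB n)).
rewrite mulr_sumr; apply: ler_sum => i _.
rewrite /bump /= add1n /dcoef.
have -> : a i.+1 * (z + h) ^+ i.+1 - a i.+1 * z ^+ i.+1 -
    h * (i.+1%:R * a i.+1 * z ^+ i) =
    a i.+1 * ((z + h) ^+ i.+1 - z ^+ i.+1 - h * (i.+1%:R * z ^+ i)) by ring.
rewrite cmodM mulrCA [r * _]mulrC.
apply: le_trans (ler_wpM2l (cmod_ge0 _) (expr_taylor2 i r0 (ltW zr) hr')) _.
rewrite !cmodM !cmod_nat.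
have := exprn_ge0 i (ltW r0); have := cmod_ge0 (a i.+1).
have := sqr_ge0 (cmod h); set X := cmod h ^+ 2; set Y := cmod (a i.+1).
set W := r ^+ i => X0 Y0 W0.
rewrite [leLHS](_ : _ = X * (Y * W) * i.+1%:R ^+ 2); last by ring.
rewrite [leRHS](_ : _ = X * (Y * W) * i.+2%:R ^+ 2); last by ring.
apply: ler_wpM2l; first exact: mulr_ge0 X0 (mulr_ge0 Y0 W0).
by rewrite lerXn2r ?nnegrE ?ler0n // ler_nat.
Qed.

Lemma taylor2_is_cderive f z L d B : 0 < d ->
  (forall h, cmod h < d -> cmod (f (z + h) - f z - h * L) <= B * cmod h ^+ 2) ->
  is_cderive f z L.
Proof.
move=> d0 H e e0.
have B0 : 0 < `|B| + 1 by rewrite ltr_wpDl.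
exists (Num.min d (e / (`|B| + 1))); first by rewrite lt_min d0 divr_gt0.
move=> h hn0; rewrite lt_min => /andP[hd he].
have h0 : 0 < cmod h by rewrite cmod_gt0.
have -> : (f (z + h) - f z) / h - L = (f (z + h) - f z - h * L) / h.
  by rewrite [RHS]mulrBl [h * L]mulrC mulfK.
rewrite cmod_div ltr_pdivrMr // (le_lt_trans (H _ hd)) //.
rewrite expr2 mulrA ltr_pM2r //.
rewrite (le_lt_trans (y := (`|B| + 1) * cmod h)) //.
  by rewrite ler_wpM2r ?cmod_ge0 // (le_trans (ler_norm _)) // lerDl.
by rewrite mulrC -ltr_pdivlMr.
Qed.

Lemma expands_derivative a f g : expands a f -> expands (dcoef a) g ->
  derivative_on_disc f g.
Proof.
move=> af ag z zD; have [d [B [d0 _ H]]] := expands_taylor2 af ag zD.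
exact: taylor2_is_cderive d0 H.
Qed.

Lemma expands_analytic a f : expands a f ->
  exists2 g, expands (dcoef a) g & derivative_on_disc f g.
Proof.
move=> af; have [g ag] := subgeom_expands (subgeom_dcoef (expands_subgeom af)).
by exists g => //; exact: expands_derivative af ag.
Qed.

Lemma is_cderive_unique f z L M : is_cderive f z L -> is_cderive f z M -> L = M.
Proof.
move=> fL fM; apply/eqP; rewrite -subr_eq0 -cmod_eq0; apply/eqP.
apply/le_anti; rewrite cmod_ge0 andbT; apply/ler_addgt0Pl => e e0; rewrite addr0.
have e20 : 0 < e / 2 by rewrite divr_gt0.
have [d d0 H] := fL _ e20; have [d' d'0 H'] := fM _ e20.
pose h : C := real_complex R (Num.min d d' / 2).
have m0 : 0 < Num.min d d' by rewrite lt_min d0.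
have m20 : 0 < Num.min d d' / 2 by rewrite divr_gt0.
have mh : cmod h = Num.min d d' / 2 by rewrite cmod_real gtr0_norm.
have hn0 : h != 0 by rewrite -cmod_gt0 mh.
have hm : cmod h < Num.min d d' by rewrite mh; lra.
move: (hm); rewrite lt_min => /andP[hd hd'].
have := H _ hn0 hd; have := H' _ hn0 hd'.
have := cmod_triangle ((f (z + h) - f z) / h) L M; rewrite (cmodC L (_ / _)); lra.
Qed.

Lemma is_cderive_continuous f z L : is_cderive f z L ->
  forall e, 0 < e -> exists2 d, 0 < d &
    forall w, cmod (w - z) < d -> cmod (f w - f z) < e.
Proof.
move=> /(_ 1 ltr01)[d d0 H] e e0.
have L0 : 0 < cmod L + 1 by rewrite ltr_wpDl ?cmod_ge0.
exists (Num.min d (e / (cmod L + 1))); first by rewrite lt_min d0 divr_gt0.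
move=> w; rewrite lt_min => /andP[wd we].
have [->|wz] := eqVneq w z; first by rewrite subrr cmod0.
have wz0 : w - z != 0 by rewrite subr_eq0.
have := H _ wz0 wd; rewrite subrKC => H1.
have -> : f w - f z = ((f w - f z) / (w - z)) * (w - z) by rewrite divfK.
rewrite cmodM (le_lt_trans (y := (cmod L + 1) * cmod (w - z))) //.
  rewrite ler_wpM2r ?cmod_ge0 //.
  have := ler_cmodB ((f w - f z) / (w - z)) L; lra.
by rewrite mulrC -ltr_pdivlMr.
Qed.

(** One step of the identity theorem: [a 0] is the value at 0, and the remaining series [g]
    satisfies [z * g z = 0], so it vanishes off 0 and, by continuity, at 0. *)
Lemma expands0_shift a : expands a (fun=> 0) ->
  a 0%N = 0 /\ expands (fun i => a i.+1) (fun=> 0).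
Proof.
move=> a0.
have a00 : a 0%N = 0.
  apply: ccvg_unique (a0 _ in_disc0); apply: (@ccvg_unshift _ 1).
  apply: ccvg_ext (ccvg_cst _) => n.
  by rewrite addn1 psum_shift mul0r addr0.
split=> //.
have [g ag] := subgeom_expands (subgeom_succ (expands_subgeom a0)).
have gn0 z : in_disc z -> z != 0 -> g z = 0.
  move=> zD zn0; apply: (mulfI zn0); rewrite mulr0.
  have := expandsX ag zD => cv; apply: ccvg_unique cv _.
  apply: ccvg_ext (a0 _ zD) => n.
  by apply: eq_bigr => -[[|i] ?] _ //=; rewrite a00.
apply: (expands_ext _ ag) => z zD; have [->|] := eqVneq z 0; last exact: gn0.
have [g' _ /(_ _ in_disc0)] := expands_analytic ag.
move=> /is_cderive_continuous gc.
apply/eqP; rewrite -cmod_eq0; apply/eqP/le_anti; rewrite cmod_ge0 andbT.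
apply/ler_addgt0Pl => e /gc[d d0 H]; rewrite addr0.
pose x := Num.min (d / 2) (2^-1 : R).
have x0 : 0 < x by rewrite lt_min; apply/andP; split; lra.
have xd : x < d by rewrite gt_min; apply/orP; left; lra.
have x1 : x < 1 by rewrite gt_min; apply/orP; right; lra.
have := H (real_complex R x); rewrite subr0 cmod_real gtr0_norm // => /(_ xd).
rewrite gn0 ?sub0r ?cmodN; first exact: ltW.
  exact: in_disc_real (ltW x0) x1.
by rewrite -cmod_gt0 cmod_real gtr0_norm.
Qed.

Lemma expands_unique a b f : expands a f -> expands b f -> forall i, a i = b i.
Proof.
move=> af bf i; apply/eqP; rewrite -subr_eq0; apply/eqP.
have: expands (fun i => a i - b i) (fun=> 0).
  by apply: expands_ext (expandsB af bf) => z _; rewrite subrr.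
rewrite -[a i - b i]/((fun i => a i - b i) i).
move: (fun i => a i - b i) => c; clear; elim: i c => [|i IH] c /expands0_shift[c0 //].
exact: IH.
Qed.

Definition cauchy_prod a b m : C := \sum_(i < m.+1) a i * b (m - i)%N.

(** The difference consists of the terms of degree [n] to [2n - 1] in a product of two polynomials
    of size [n]: there are [n] of them, each a sum of at most [2n] products bounded by
    [K ^+ 2 * r ^+ n]. *)
Lemma psum_cauchy_prod_le a b z K r n : 0 <= r -> r < 1 ->
  (forall i, cmod (a i * z ^+ i) <= K * r ^+ i) ->
  (forall i, cmod (b i * z ^+ i) <= K * r ^+ i) ->
  cmod (psum a z n * psum b z n - psum (cauchy_prod a b) z n) <=
  n%:R * ((n + n)%:R * (K ^+ 2 * r ^+ n)).
Proof.
move=> r0 r1 aK bK.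
have K0 : 0 <= K by have := aK 0%N; rewrite !expr0 !mulr1; apply: le_trans (cmod_ge0 _).
pose A : {poly C} := \poly_(i < n) a i; pose B : {poly C} := \poly_(i < n) b i.
have sAB : (size (A * B)%R <= n + n)%N.
  apply: leq_trans (size_polyMleq _ _) _; apply: leq_trans (leq_pred _) _.
  by rewrite leq_add ?size_poly.
have -> : psum a z n * psum b z n = \sum_(m < n + n) (A * B)`_m * z ^+ m.
  by rewrite -(horner_coef_wide _ sAB) hornerM !horner_poly.
have -> : psum (cauchy_prod a b) z n = \sum_(m < n) (A * B)`_m * z ^+ m.
  apply: eq_bigr => m _; congr (_ * _); rewrite coefM; apply: eq_bigr => i _.
  have im : (i <= m)%N by rewrite -ltnS.
  rewrite !coef_poly (leq_ltn_trans im (ltn_ord m)).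
  by rewrite (leq_ltn_trans (leq_subr _ _) (ltn_ord m)).
rewrite big_split_ord /= addrAC subrr add0r.
apply: le_trans (cmod_sum _ _ _) _.
rewrite -[n in n%:R]card_ord mulr_natl -sumr_const; apply: ler_sum => m _.
rewrite coefM mulr_suml; apply: le_trans (cmod_sum _ _ _) _.
apply: (@le_trans _ _ (\sum_(i < (n + m).+1) (K ^+ 2 * r ^+ n))); last first.
  rewrite sumr_const card_ord -[leLHS]mulr_natl; apply: ler_wpM2r.
    exact: mulr_ge0 (sqr_ge0 _) (exprn_ge0 _ r0).
  by rewrite ler_nat ltn_add2l.
apply: ler_sum => i _; have im : (i <= n + m)%N by rewrite -ltnS.
have -> : A`_i * B`_(n + m - i) * z ^+ (n + m) =
    (A`_i * z ^+ i) * (B`_(n + m - i) * z ^+ (n + m - i)).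
  by rewrite mulrACA -exprD subnKC.
rewrite cmodM; apply: (@le_trans _ _ ((K * r ^+ i) * (K * r ^+ (n + m - i)))).
  apply: ler_pM; rewrite ?cmod_ge0 // !coef_poly; case: ifP => _ //;
  by rewrite mul0r cmod0 mulr_ge0 ?exprn_ge0.
rewrite mulrACA -expr2 -exprD subnKC // ler_wpM2l ?sqr_ge0 //.
by rewrite ler_wiXn2l ?leq_addr // ltW.
Qed.

End PowerSeries.

(** * Goursat's lemma on rectangles *)

Section ComplexIntegral.
Variable R : realType.
Local Notation C := R[i].
Local Notation mu := (@lebesgue_measure R).
Implicit Types (g : R -> C) (a b : R).

Definition ccont g : Prop := forall x (e : R), 0 < e ->
  exists2 d : R, 0 < d & forall y, `|y - x| < d -> cmod (g y - g x) < e.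

Definition cint a b g : C :=
  Complex (\int[mu]_(x in `[a, b]) complex.Re (g x))
          (\int[mu]_(x in `[a, b]) complex.Im (g x)).

Lemma ccont_Re g : ccont g -> continuous (fun x => complex.Re (g x) : R).
Proof.
move=> gc x; apply/cvgrPdist_lt => e e0; have [d d0 H] := gc x _ e0.
exists d => //= y yd.
by rewrite distrC -Re_opp -Re_add (le_lt_trans (cmod_Re _)) // H // distrC.
Qed.

Lemma ccont_Im g : ccont g -> continuous (fun x => complex.Im (g x) : R).
Proof.
move=> gc x; apply/cvgrPdist_lt => e e0; have [d d0 H] := gc x _ e0.
exists d => //= y yd.
by rewrite distrC -Im_opp -Im_add (le_lt_trans (cmod_Im _)) // H // distrC.
Qed.

Lemma continuous_integrable (f : R -> R) a b :
  continuous f -> mu.-integrable `[a, b] (EFin \o f).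
Proof.
move=> fc; apply: continuous_compact_integrable; first exact: segment_compact.
exact: continuous_subspaceT.
Qed.

Lemma ccont_cst (k : C) : ccont (fun=> k).
Proof. by move=> x e e0; exists 1 => // y _; rewrite subrr cmod0. Qed.

Lemma ccontD g1 g2 : ccont g1 -> ccont g2 -> ccont (fun x => g1 x + g2 x).
Proof.
move=> c1 c2 x e e0; have e20 : 0 < e / 2 by rewrite divr_gt0.
have [d d0 H] := c1 x _ e20; have [d' d'0 H'] := c2 x _ e20.
exists (Num.min d d'); first by rewrite lt_min d0.
move=> y; rewrite lt_min => /andP[/H h /H' h'].
by rewrite opprD addrACA (le_lt_trans (cmodD _ _)) // [e]splitr ltrD.
Qed.

Lemma ccontZ (k : C) g : ccont g -> ccont (fun x => k * g x).
Proof.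
move=> gc x e e0; have k0 : 0 < cmod k + 1 by rewrite ltr_wpDl ?cmod_ge0.
have [d d0 H] := gc x _ (divr_gt0 e0 k0); exists d => // y /H h.
rewrite -mulrBr cmodM (le_lt_trans (y := (cmod k + 1) * cmod (g y - g x))) //.
  by rewrite ler_wpM2r ?cmod_ge0 // lerDl.
by rewrite mulrC -ltr_pdivlMr.
Qed.

Lemma ccontB g1 g2 : ccont g1 -> ccont g2 -> ccont (fun x => g1 x - g2 x).
Proof.
move=> c1 c2; have := ccontD c1 (ccontZ (-1) c2).
by under [X in ccont X -> _]eq_fun do rewrite mulN1r.
Qed.

Lemma cintD a b g1 g2 : ccont g1 -> ccont g2 ->
  cint a b (fun x => g1 x + g2 x) = cint a b g1 + cint a b g2.
Proof.
move=> c1 c2; apply: complex_ext; rewrite ?Re_add ?Im_add /=.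
  rewrite -RintegralD //; try exact/continuous_integrable/ccont_Re.
  by apply: eq_Rintegral => x _; rewrite Re_add.
rewrite -RintegralD //; try exact/continuous_integrable/ccont_Im.
by apply: eq_Rintegral => x _; rewrite Im_add.
Qed.

Lemma cintZ a b (k : C) g : ccont g ->
  cint a b (fun x => k * g x) = k * cint a b g.
Proof.
move=> gc; have iR := continuous_integrable a b (ccont_Re gc).
have iI := continuous_integrable a b (ccont_Im gc).
apply: complex_ext; rewrite ?Re_mul ?Im_mul /= -!RintegralZl //.
  rewrite -RintegralB //; first by apply: eq_Rintegral => x _; rewrite Re_mul.
    exact: (integrableZl _ _ iR).
  exact: (integrableZl _ _ iI).
rewrite -RintegralD //; first by apply: eq_Rintegral => x _; rewrite Im_mul.
  exact: (integrableZl _ _ iI).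
exact: (integrableZl _ _ iR).
Qed.

Lemma cintB a b g1 g2 : ccont g1 -> ccont g2 ->
  cint a b (fun x => g1 x - g2 x) = cint a b g1 - cint a b g2.
Proof.
move=> c1 c2; rewrite -mulN1r -cintZ // -cintD //; last exact: ccontZ.
by congr cint; apply/funext => x; rewrite mulN1r.
Qed.

Lemma cint_cst a b (k : C) : a <= b ->
  cint a b (fun=> k) = real_complex R (b - a) * k.
Proof.
move=> ab; apply: complex_ext; rewrite /= Rintegral_cst //= lebesgue_measure_itv /=.
  case: k => s t /=; rewrite lte_fin; case: ltgtP ab => //= [_|->] _; by rewrite ?subrr; ring.
case: k => s t /=; rewrite lte_fin; case: ltgtP ab => //= [_|->] _; by rewrite ?subrr; ring.
Qed.

Lemma cint_cat a m b g : a <= m -> m <= b -> ccont g ->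
  cint a b g = cint a m g + cint m b g.
Proof.
move=> am mb gc.
have key (f : R -> R) : continuous f -> \int[mu]_(x in `[a, b]) f x =
    \int[mu]_(x in `[a, m]) f x + \int[mu]_(x in `[m, b]) f x.
  move=> fc; rewrite [RHS]addrC; apply/eqP; rewrite -subr_eq; apply/eqP.
  rewrite (@Rintegral_itvB _ _ _ _ m) ?bnd_simp //; last first.
    exact: continuous_integrable.
  rewrite Rintegral_itv_obnd_cbnd //.
  apply: integrableS (continuous_integrable m b fc) => //.
  by apply: subset_itvr; rewrite bnd_simp.
by apply: complex_ext; rewrite ?Re_add ?Im_add /= -key //; [exact: ccont_Re|exact: ccont_Im].
Qed.

(** The factor 2 pays for treating the real and imaginary parts separately; every later use
    tolerates a constant. *)
Lemma cint_bound a b g (M : R) : a <= b -> ccont g ->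
  (forall x, a <= x -> x <= b -> cmod (g x) <= M) ->
  cmod (cint a b g) <= 2 * ((b - a) * M).
Proof.
move=> ab gc gM.
have key (f : R -> R) : continuous f ->
    (forall x, `|f x| <= cmod (g x)) -> `|\int[mu]_(x in `[a, b]) f x| <= (b - a) * M.
  move=> fc fg; apply: (le_trans (le_normr_Rintegral _ _)) => //.
    exact: continuous_integrable.
  apply: (@le_trans _ _ (\int[mu]_(x in `[a, b]) M)).
    apply: le_Rintegral => //.
    - by apply: continuous_integrable => x; apply: continuous_comp; [exact: fc|exact: norm_continuous].
    - by apply: continuous_integrable => x; exact: cvg_cst.
    - move=> x; rewrite /= in_itv /= => /andP[ax xb].
      by rewrite (le_trans (fg x)) // gM.
  rewrite Rintegral_cst //= lebesgue_measure_itv /= lte_fin.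
  by case: ltgtP ab => //= [_|->] _; rewrite ?subrr mulrC.
apply: (le_trans (cmod_le_ReIm _)); rewrite /= mulr2n mulrDl !mul1r lerD //.
  by apply: key; [exact: ccont_Re|move=> x; exact: cmod_Re].
by apply: key; [exact: ccont_Im|move=> x; exact: cmod_Im].
Qed.

End ComplexIntegral.

(** * Contour integrals over rectangles *)

Section Goursat.
Variable R : realType.
Local Notation C := R[i].
Implicit Types (G : R -> R -> C) (a b c d x y : R).

Local Notation I := (Complex (0 : R) 1).

(** The counterclockwise contour integral with opposite sides paired, so that the horizontal sides
    visibly cancel when [G] is periodic in its second variable. *)
Definition boundary_int G a b c d : C :=
  cint a b (fun x => G x c - G x d) + I * cint c d (fun y => G b y - G a y).

Variable G : R -> R -> C.
Hypothesis Gx : forall y, ccont (fun x => G x y).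
Hypothesis Gy : forall x, ccont (G x).

Lemma boundary_int_quarter a m b c n d : a <= m -> m <= b -> c <= n -> n <= d ->
  boundary_int G a b c d =
  (boundary_int G a m c n + boundary_int G m b c n) +
  (boundary_int G a m n d + boundary_int G m b n d).
Proof.
move=> am mb cn nd; rewrite /boundary_int.
have X y y' : ccont (fun x => G x y - G x y') by exact: ccontB.
have Y x x' : ccont (fun y => G x y - G x' y) by exact: ccontB.
rewrite (cint_cat am mb (X _ _)) (cint_cat cn nd (Y _ _)).
have H u v : cint u v (fun x => G x c - G x d) =
    cint u v (fun x => G x c - G x n) + cint u v (fun x => G x n - G x d).
  rewrite -cintD //; congr cint; apply/funext => x.
  by rewrite addrA subrK.
have V u v : cint u v (fun y => G b y - G a y) =
    cint u v (fun y => G b y - G m y) + cint u v (fun y => G m y - G a y).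
  rewrite -cintD //; congr cint; apply/funext => x.
  by rewrite addrA subrK.
by rewrite !H !V; ring.
Qed.

Lemma boundary_int_affine_bound a b c d (x0 y0 e : R) (L : C) : a <= b -> c <= d ->
  (forall x y, a <= x -> x <= b -> c <= y -> y <= d ->
    cmod (G x y - G x0 y0 - L * Complex (x - x0) (y - y0)) <= e) ->
  cmod (boundary_int G a b c d) <= 4 * e * ((b - a) + (d - c)).
Proof.
move=> ab cd He.
(* An affine function has zero boundary integral: [k1] and [k2] are the constant differences of its
   values on opposite sides, and subtracting them does not change the integral. *)
pose k1 : C := L * Complex 0 (c - d); pose k2 : C := L * Complex (b - a) 0.
have X y y' : ccont (fun x => G x y - G x y') by exact: ccontB.
have Y x x' : ccont (fun y => G x y - G x' y) by exact: ccontB.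
have -> : boundary_int G a b c d = cint a b (fun x => G x c - G x d - k1) +
    I * cint c d (fun y => G b y - G a y - k2).
  rewrite /boundary_int (cintB _ _ (X _ _) (ccont_cst _)).
  rewrite (cintB _ _ (Y _ _) (ccont_cst _)) !cint_cst //.
  suff -> : real_complex R (b - a) * k1 = - (I * (real_complex R (d - c) * k2)) by ring.
  rewrite /k1 /k2; case: (L) => s t; apply: complex_ext;
  by rewrite !(Re_opp, Im_opp, Re_mul, Im_mul) /=; ring.
have b1 : cmod (cint a b (fun x => G x c - G x d - k1)) <= 2 * ((b - a) * (e + e)).
  apply: cint_bound => //; first by apply: ccontB => //; exact: ccont_cst.
  move=> x ax xb.
  have -> : G x c - G x d - k1 = (G x c - G x0 y0 - L * Complex (x - x0) (c - y0)) -
     (G x d - G x0 y0 - L * Complex (x - x0) (d - y0)).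
    have -> : k1 = L * Complex (x - x0) (c - y0) - L * Complex (x - x0) (d - y0).
      rewrite -mulrBr; congr (_ * _); apply: complex_ext => /=; ring.
    by ring.
  by rewrite (le_trans (cmodB _ _)) // lerD // He.
have b2 : cmod (cint c d (fun y => G b y - G a y - k2)) <= 2 * ((d - c) * (e + e)).
  apply: cint_bound => //; first by apply: ccontB => //; exact: ccont_cst.
  move=> y cy yd.
  have -> : G b y - G a y - k2 = (G b y - G x0 y0 - L * Complex (b - x0) (y - y0)) -
     (G a y - G x0 y0 - L * Complex (a - x0) (y - y0)).
    have -> : k2 = L * Complex (b - x0) (y - y0) - L * Complex (a - x0) (y - y0).
      rewrite -mulrBr; congr (_ * _); apply: complex_ext => /=; ring.
    by ring.
  by rewrite (le_trans (cmodB _ _)) // lerD // He.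
have cI : cmod I = 1 by rewrite /cmod /= expr0n expr1n add0r sqrtr1.
by rewrite (le_trans (cmodD _ _)) // cmodM cI mul1r; lra.
Qed.

(** Differentiability is asked relative to the closed rectangle only, so that [G] may be altered
    outside it, as the clamped function in [circle_int_const] is. *)
Lemma goursat a b c d : a <= b -> c <= d ->
  (forall x y, a <= x -> x <= b -> c <= y -> y <= d -> exists L : C,
    forall e, 0 < e -> exists2 r, 0 < r & forall x' y',
      a <= x' -> x' <= b -> c <= y' -> y' <= d -> `|x' - x| < r -> `|y' - y| < r ->
      cmod (G x' y' - G x y - L * Complex (x' - x) (y' - y)) <=
      e * (`|x' - x| + `|y' - y|)) ->
  boundary_int G a b c d = 0.
Proof.
move=> ab cd Gd.
pose rect := (R * R * R * R)%type.
pose Lam (q : rect) := let: (a, b, c, d) := q in cmod (boundary_int G a b c d).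
pose ok (q : rect) := let: (a, b, c, d) := q in a <= b /\ c <= d.
pose half (q q' : rect) := let: (a, b, c, d) := q in let: (a', b', c', d') := q' in
  [/\ a <= a', b' <= b, c <= c', d' <= d & b' - a' = (b - a) / 2 /\ d' - c' = (d - c) / 2].
have step q : exists q', ok q -> [/\ ok q', half q q' & Lam q <= 4 * Lam q'].
  have [okq|] := pselect (ok q); last by exists q.
  case: q okq => [[[u v] s] t] [uv st].
  pose m := (u + v) / 2; pose n := (s + t) / 2.
  have um : u <= m by rewrite /m; lra.
  have mv : m <= v by rewrite /m; lra.
  have sn : s <= n by rewrite /n; lra.
  have nt : n <= t by rewrite /n; lra.
  apply: contrapT => /forallNP H.
  have h1 : Lam (u, v, s, t) > 4 * Lam (u, m, s, n).
    rewrite ltNge; apply/negP => h; apply: (H (u, m, s, n)) => _; split => //.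
    by split => //; split; rewrite /m /n; field.
  have h2 : Lam (u, v, s, t) > 4 * Lam (m, v, s, n).
    rewrite ltNge; apply/negP => h; apply: (H (m, v, s, n)) => _; split => //.
    by split => //; split; rewrite /m /n; field.
  have h3 : Lam (u, v, s, t) > 4 * Lam (u, m, n, t).
    rewrite ltNge; apply/negP => h; apply: (H (u, m, n, t)) => _; split => //.
    by split => //; split; rewrite /m /n; field.
  have h4 : Lam (u, v, s, t) > 4 * Lam (m, v, n, t).
    rewrite ltNge; apply/negP => h; apply: (H (m, v, n, t)) => _; split => //.
    by split => //; split; rewrite /m /n; field.
  move: h1 h2 h3 h4; rewrite /Lam (boundary_int_quarter um mv sn nt).
  set A := boundary_int G u m s n; set B := boundary_int G m v s n.
  set D := boundary_int G u m n t; set E := boundary_int G m v n t.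
  have := cmodD (A + B) (D + E); have := cmodD A B; have := cmodD D E.
  move: (cmod (_ + _)) (cmod (D + E)) (cmod (A + B)) (cmod A) (cmod B) (cmod D) (cmod E); clear.
  by move=> *; lra.
have [nxt nxtP] := choice step.
pose q n := iter n nxt (a, b, c, d).
pose qa n := (q n).1.1.1; pose qb n := (q n).1.1.2.
pose qc n := (q n).1.2; pose qd n := (q n).2.
have qE n : q n = (qa n, qb n, qc n, qd n).
  by rewrite /qa /qb /qc /qd; case: (q n) => [[[? ?] ?] ?].
have okq n : ok (q n) by elim: n => [|n /nxtP[]].
have halfq n : half (q n) (q n.+1) by have [] := nxtP _ (okq n).
have Lamq n : Lam (q n) <= 4 * Lam (q n.+1) by have [] := nxtP _ (okq n).
have q_step n : [/\ qa n <= qa n.+1, qb n.+1 <= qb n, qc n <= qc n.+1,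
    qd n.+1 <= qd n & qb n.+1 - qa n.+1 = (qb n - qa n) / 2 /\
    qd n.+1 - qc n.+1 = (qd n - qc n) / 2].
  by have := halfq n; rewrite !qE.
have q_ab n : qa n <= qb n /\ qc n <= qd n by have := okq n; rewrite qE.
have mono (u : nat -> R) : (forall n, u n <= u n.+1) -> forall m n, (m <= n)%N -> u m <= u n.
  move=> us m n /subnK <-; elim: (n - m)%N => [|k IH]; first by rewrite add0n.
  by rewrite addSn (le_trans IH).
have nested (u v : nat -> R) : (forall n, u n <= u n.+1) -> (forall n, v n.+1 <= v n) ->
    (forall n, u n <= v n) -> exists x, forall n, u n <= x /\ x <= v n.
  move=> us vs uv; have uvmn m n : u m <= v n.
    have vm : - v n <= - v (maxn m n).
      by apply: (mono (fun k => - v k)); [move=> k; rewrite lerN2|exact: leq_maxr].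
    have := mono _ us _ _ (leq_maxl m n); have := uv (maxn m n); lra.
  have ub0 : ubound (range u) (v 0%N) by move=> _ [m _ <-].
  exists (sup (range u)) => n; split.
    by apply: ub_le_sup; [exists (v 0%N)|exists n].
  by apply: ge_sup; [exists (u 0%N), 0%N|move=> _ [m _ <-]].
have [xs xsP] : exists x, forall n, qa n <= x /\ x <= qb n.
  by apply: nested => n; [have [] := q_step n|have [] := q_step n|have [] := q_ab n].
have [ys ysP] : exists y, forall n, qc n <= y /\ y <= qd n.
  by apply: nested => n; [have [] := q_step n|have [] := q_step n|have [] := q_ab n].
have wq n : qb n - qa n = (b - a) / 2 ^+ n.
  elim: n => [|n IH]; first by rewrite expr0 divr1.
  by have [_ _ _ _ [-> _]] := q_step n; rewrite IH exprSr invfM mulrA.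
have hq n : qd n - qc n = (d - c) / 2 ^+ n.
  elim: n => [|n IH]; first by rewrite expr0 divr1.
  by have [_ _ _ _ [_ ->]] := q_step n; rewrite IH exprSr invfM mulrA.
have Lam0 n : Lam (q 0%N) <= 4 ^+ n * Lam (q n).
  elim: n => [|n IH]; first by rewrite expr0 mul1r.
  by rewrite (le_trans IH) // exprSr -mulrA ler_wpM2l ?exprn_ge0.
have mono_a m : a <= qa m.
  by apply: (mono qa _ 0%N m) => // k; have [] := q_step k.
have mono_b m : qb m <= b.
  have : - qb 0%N <= - qb m by apply: (mono (fun k => - qb k)) => // k; have [] := q_step k; rewrite lerN2.
  by rewrite lerN2.
have mono_c m : c <= qc m.
  by apply: (mono qc _ 0%N m) => // k; have [] := q_step k.
have mono_d m : qd m <= d.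
  have : - qd 0%N <= - qd m by apply: (mono (fun k => - qd k)) => // k; have [] := q_step k; rewrite lerN2.
  by rewrite lerN2.
have [[axs xsb] [cys ysd]] := (xsP 0%N, ysP 0%N).
have [L LP] := Gd xs ys axs xsb cys ysd.
pose w := (b - a) + (d - c).
have w0 : 0 <= w by rewrite /w; lra.
apply/eqP; rewrite -cmod_eq0; apply/eqP/le_anti; rewrite cmod_ge0 andbT.
apply/ler_addgt0Pl => e0 e00; rewrite addr0.
have K0 : 0 < 4 * (w + 1) ^+ 2 by rewrite mulr_gt0 // exprn_gt0 // ltr_wpDl.
(* The powers of 4 and 2 cancel in the final bound [4 * e * w ^+ 2]; [w + 1] in place of [w] allows
   a degenerate rectangle. *)
have e1 : 0 < e0 / (4 * (w + 1) ^+ 2) by rewrite divr_gt0.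
set e := e0 / _ in e1; have [r r0 rP] := LP _ e1.
have [n nP] : exists n, w / 2 ^+ n < r.
  exists (Num.bound (w / r)).
  rewrite ltr_pdivrMr ?exprn_gt0 // mulrC -ltr_pdivrMr //.
  apply: lt_le_trans (archi_boundP (divr_ge0 w0 (ltW r0))) _.
  by rewrite -natrX ler_nat ltnW // ltn_expl.
have p0 : 0 < 2 ^+ n :> R by rewrite exprn_gt0.
have wn : (qb n - qa n) + (qd n - qc n) = w / 2 ^+ n by rewrite /w mulrDl -wq -hq.
have [qab qcd] := q_ab n.
have [xsn1 xsn2] := xsP n; have [ysn1 ysn2] := ysP n.
have bnd : Lam (q n) <= 4 * (e * (w / 2 ^+ n)) * (w / 2 ^+ n).
  rewrite qE /Lam -{2}wn; apply: (boundary_int_affine_bound (x0 := xs) (y0 := ys) (L := L)) => //.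
  move=> x y x1 x2 y1 y2.
  have dx : `|x - xs| <= qb n - qa n by clear - x1 x2 xsn1 xsn2; rewrite ler_norml; apply/andP; split; lra.
  have dy : `|y - ys| <= qd n - qc n by clear - y1 y2 ysn1 ysn2; rewrite ler_norml; apply/andP; split; lra.
  have [rx ry] : qb n - qa n < r /\ qd n - qc n < r.
    by clear - wn nP qab qcd; split; lra.
  apply: (le_trans (rP x y (le_trans (mono_a n) x1) (le_trans x2 (mono_b n))
    (le_trans (mono_c n) y1) (le_trans y2 (mono_d n))
    (le_lt_trans dx rx) (le_lt_trans dy ry))).
  by rewrite ler_wpM2l ?(ltW e1) // -wn lerD.
have := Lam0 n; rewrite {1}/q /= => /le_trans; apply.
apply: (@le_trans _ _ (4 * e * w ^+ 2)).
  apply: (le_trans (ler_wpM2l (exprn_ge0 n (ler0n R 4)) bnd)).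
  have four : (2 : R) ^+ 2 = 4 by ring.
  have -> : (4 : R) ^+ n = (2 ^+ n) ^+ 2 by rewrite -four -!exprM mulnC.
  by rewrite le_eqVlt; apply/orP; left; apply/eqP; field; exact: lt0r_neq0.
rewrite mulrAC /e mulrA ler_pdivrMr //.
have ww : w ^+ 2 <= (w + 1) ^+ 2 by clear - w0; nra.
by rewrite [leLHS]mulrC ler_wpM2l ?(ltW e00) // ler_wpM2l.
Qed.

End Goursat.

(** * Circle integrals, Cauchy's formula and Taylor series *)

Section Polar.
Variable R : realType.
Local Notation C := R[i].
Implicit Types (r s t : R).

Lemma sin_le_norm t : `|sin t| <= `|t|.
Proof.
wlog t0 : t / 0 <= t.
  move=> H; have [/H//|t0] := leP 0 t.
  by rewrite -normrN -sinN -(normrN t) H // oppr_ge0 ltW.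
have [c _] := @MVT_segment R sin cos 0 t t0 (fun x _ => is_derive_sin x)
  (continuous_subspaceT (@continuous_sin R)).
rewrite sin0 !subr0 => ->; rewrite normrM.
by rewrite ler_piMl // cos_max.
Qed.

Lemma cos_ge_quad t : 1 - t ^+ 2 / 2 <= cos t.
Proof.
have -> : t = (t / 2) *+ 2 by rewrite -mulr_natr divfK.
rewrite cos_mulr2n cos2sin2; set u := t / 2.
have : sin u ^+ 2 <= u ^+ 2.
  by rewrite -(real_normK (num_real (sin u))) -(real_normK (num_real u)) lerXn2r ?nnegrE // sin_le_norm.
by lra.
Qed.

Lemma sinB_le_quad t : `|t| <= 1 -> `|sin t - t| <= t ^+ 2.
Proof.
wlog t0 : t / 0 <= t.
  move=> H; have [/H//|t0] := leP 0 t.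
  rewrite -(normrN t) -(normrN (sin t - t)) -(sqrrN t) opprB => t1.
  by have := H (- t); rewrite oppr_ge0 sinN opprK [- sin t + t]addrC; apply => //; exact: ltW.
move=> t1; have [c] := @MVT_segment R sin cos 0 t t0 (fun x _ => is_derive_sin x)
  (continuous_subspaceT (@continuous_sin R)).
rewrite in_itv /= sin0 !subr0 => /andP[c0 ct] ->.
rewrite -{2}[t]mul1r -mulrBl normrM expr2 (ger0_norm t0) ler_wpM2r //.
have := cos_ge_quad c; have := cos_le1 c.
rewrite ger0_norm // in t1; move=> h1 h2.
by rewrite ler_norml; apply/andP; split; nra.
Qed.

Lemma expRB1_le_quad s : `|s| <= 1 / 2 -> `|expR s - 1 - s| <= 2 * s ^+ 2.
Proof.
rewrite ler_norml => /andP[s1 s2].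
have h1 := expR_ge1Dx s; have h2 := expR_ge1Dx (- s).
have h3 := expRxMexpNx_1 s; have h4 := expR_gt0 s.
rewrite ler_norml; apply/andP; split; first by have := sqr_ge0 s; lra.
have h5 := ler_wpM2l (ltW h4) h2; rewrite h3 in h5.
suff : expR s <= 1 + s + 2 * s ^+ 2 by lra.
rewrite -(ler_pM2r (x := 1 - s)); last by lra.
apply: (le_trans h5); have := sqr_ge0 s; nra.
Qed.

Lemma polarM r s r' s' : polar r s * polar r' s' = polar (r * r') (s + s').
Proof. by apply: complex_ext; rewrite ?Re_mul ?Im_mul /= ?cosD ?sinD; ring. Qed.

Lemma cmod_polar r t : cmod (polar r t) = `|r|.
Proof.
rewrite /cmod /= !exprMn -mulrDr cos2Dsin2 mulr1.
exact: sqrtr_sqr.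
Qed.

Lemma polarX r t n : polar r t ^+ n = polar (r ^+ n) (t *+ n).
Proof.
elim: n => [|n IH]; first by rewrite !expr0 mulr0n; apply: complex_ext; rewrite /= ?cos0 ?sin0; ring.
by rewrite !exprS IH polarM mulrS.
Qed.

Lemma polar_periodic r t : polar r (t + 2 * pi) = polar r t.
Proof. by rewrite /polar mulr_natl cosD2pi sinD2pi. Qed.

Lemma polar_lip r s t : cmod (polar r s - polar r t) <= `|r| * `|s - t|.
Proof.
have -> : polar r s - polar r t = polar r t * (polar 1 (s - t) - 1).
  by rewrite mulrBr polarM mulr1 mulr1 subrKC.
rewrite cmodM cmod_polar ler_wpM2l // -(ler_pXn2r (n := 2)) ?nnegrE ?cmod_ge0 //.
rewrite sqr_cmod /= !mul1r subr0 real_normK ?num_real //.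
have := cos_ge_quad (s - t); have := cos2Dsin2 (s - t); nra.
Qed.

(** [polar (expR s) t] is the exponential of [s + i t]; this is its first order expansion at 0. *)
Lemma polar_expand s t : `|s| <= 1 / 2 -> `|t| <= 1 / 2 ->
  cmod (polar (expR s) t - 1 - Complex s t) <= 8 * (`|s| + `|t|) ^+ 2.
Proof.
move=> s1 t1; apply: (le_trans (cmod_le_ReIm _)); rewrite /= subr0.
have h1 := expRB1_le_quad s1.
have h2 : `|sin t - t| <= t ^+ 2 by apply: sinB_le_quad; lra.
have h3 := cos_ge_quad t; have h4 := cos_le1 t.
rewrite -(real_normK (num_real s)) in h1; rewrite -(real_normK (num_real t)) in h2 h3.
have e0 := expR_gt0 s.
have e2 : expR s <= 2.
  have s4 : `|s| ^+ 2 <= 1 / 4 by have := normr_ge0 s; clear - s1; nra.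
  by move: h1; rewrite ler_norml => /andP[_ h]; have := ler_norm s; clear - h s1 s4; lra.
have e1 : `|expR s - 1| <= 2 * `|s|.
  have -> : expR s - 1 = (expR s - 1 - s) + s by ring.
  apply: (le_trans (ler_normD _ _)); have := normr_ge0 s; nra.
have a1 : `|expR s * cos t - 1 - s| <= 2 * `|s| ^+ 2 + 2 * `|t| ^+ 2.
  have -> : expR s * cos t - 1 - s = (expR s - 1 - s) + expR s * (cos t - 1) by ring.
  apply: (le_trans (ler_normD _ _)); apply: lerD => //.
  rewrite normrM gtr0_norm //; apply: ler_pM; rewrite ?expR_ge0 //.
  by rewrite ler_norml; have := sqr_ge0 `|t|; move=> ?; apply/andP; split; lra.
have a2 : `|expR s * sin t - t| <= 2 * `|t| ^+ 2 + 2 * `|s| * `|t|.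
  have -> : expR s * sin t - t = expR s * (sin t - t) + (expR s - 1) * t by ring.
  apply: (le_trans (ler_normD _ _)); apply: lerD; rewrite normrM ?(gtr0_norm e0) //.
    by apply: ler_pM; rewrite ?expR_ge0.
  by rewrite ler_wpM2r.
have := normr_ge0 s; have := normr_ge0 t; clear - a1 a2; nra.
Qed.

Lemma ccont_polar (H : C -> C) r : (forall z, cmod z = `|r| -> forall e : R, 0 < e ->
    exists2 d : R, 0 < d & forall w, cmod (w - z) < d -> cmod (H w - H z) < e) ->
  ccont (fun t => H (polar r t)).
Proof.
move=> Hc t e e0; have [d d0 Hd] := Hc _ (cmod_polar r t) _ e0.
have r0 : 0 < `|r| + 1 by rewrite ltr_wpDl.
exists (d / (`|r| + 1)); first by rewrite divr_gt0.
move=> y yt; apply: Hd; apply: le_lt_trans (polar_lip _ _ _) _.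
rewrite (@le_lt_trans _ _ ((`|r| + 1) * `|y - t|)) ?ler_wpM2r ?lerDl //.
by rewrite mulrC -ltr_pdivlMr.
Qed.

(** Integration is against [dt] and not [dz = i z dt], which explains the extra factor [z] in the
    Cauchy kernel below. *)
Definition circle_int (H : C -> C) r : C := cint 0 (2 * pi) (fun t => H (polar r t)).

(** In the coordinates [z = exp (x + i y)] the annulus is a rectangle: periodicity cancels its
    horizontal sides in Goursat's lemma, and its vertical sides are the two circle integrals. *)
Lemma circle_int_const (H : C -> C) r1 r2 : 0 < r1 -> r1 <= r2 ->
  (forall z, r1 <= cmod z -> cmod z <= r2 -> exists L, is_cderive H z L) ->
  circle_int H r1 = circle_int H r2.
Proof.
move=> r10 r12 Hd; have r20 := lt_le_trans r10 r12.
pose a := ln r1; pose b := ln r2.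
have Ea : expR a = r1 by rewrite /a lnK // posrE.
have Eb : expR b = r2 by rewrite /b lnK // posrE.
have ab : a <= b by rewrite -ler_expR Ea Eb.
(* Clamping [x] to the segment from [a] to [b] makes [G] continuous in each variable on the whole
   line and leaves it unchanged on the rectangle. *)
pose cl x := Num.max a (Num.min b x).
have cl_ab x : a <= cl x <= b.
  by rewrite /cl le_max lexx /= ge_max ab ge_min lexx.
have clE x : a <= x -> x <= b -> cl x = x.
  by move=> ax xb; rewrite /cl min_r // max_r.
have cl_lip x y : `|cl x - cl y| <= `|x - y|.
  wlog xy : x y / x <= y.
    move=> W; have [/W//|/ltW/W] := leP x y.
    by rewrite distrC (distrC y).
  have cxy : cl x <= cl y.
    have mm : Num.min b x <= Num.min b y by rewrite le_min !ge_min lexx xy orbT.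
    by rewrite /cl ge_max !le_max lexx mm orbT.
  rewrite distrC (distrC x) !ger0_norm ?subr_ge0 //.
  rewrite /cl; case: (leP b x) => bx; case: (leP b y) => by_; try lra.
  - by case: (leP a x) => ax; case: (leP a b) => ab'; lra.
  - by case: (leP a x) => ax; case: (leP a y) => ay; lra.
pose G x y := H (polar (expR (cl x)) y).
have rad x y : r1 <= cmod (polar (expR (cl x)) y) <= r2.
  rewrite cmod_polar gtr0_norm ?expR_gt0 // -Ea -Eb !ler_expR.
  exact: cl_ab.
have Hcont z : r1 <= cmod z -> cmod z <= r2 -> forall e : R, 0 < e ->
    exists2 d : R, 0 < d & forall w, cmod (w - z) < d -> cmod (H w - H z) < e.
  move=> z1 z2; have [L HL] := Hd z z1 z2; exact: is_cderive_continuous HL.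
have Gy x : ccont (G x).
  apply: ccont_polar => z zE; apply: Hcont; have := rad x 0; rewrite cmod_polar -zE => /andP[] //.
have Gx y : ccont (fun x => G x y).
  move=> x e e0; have /andP[z1 z2] := rad x y.
  have [d d0 Hz] := Hcont _ z1 z2 _ e0.
  have /cvgrPdist_lt /(_ _ d0) [d' d'0 Hd'] := @continuous_expR R (cl x).
  exists d' => // x' xx'; apply: Hz.
  have -> : polar (expR (cl x')) y - polar (expR (cl x)) y =
     real_complex R (expR (cl x') - expR (cl x)) * polar 1 y.
    by apply: complex_ext; rewrite ?Re_mul ?Im_mul /=; ring.
  rewrite cmodM cmod_polar normr1 mulr1 cmod_real distrC; apply: Hd'.
  by rewrite /ball_ /=; apply: le_lt_trans (cl_lip _ _) _; rewrite distrC.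
have pi0 : 0 <= 2 * pi :> R by rewrite mulr_ge0 ?pi_ge0.
have : boundary_int G a b 0 (2 * pi) = 0.
  apply: goursat => // x y ax xb y1 y2; have /andP[z1 z2] := rad x y.
  set z := polar _ _ in z1 z2; have [L HL] := Hd z z1 z2.
  (* The chain rule for [H] composed with the exponential. *)
  exists (L * z) => e e0.
  have z0 : 0 < cmod z by apply: lt_le_trans z1.
  have L0 : 0 < cmod L + 1 by rewrite ltr_wpDl ?cmod_ge0.
  have e1 : 0 < e / (6 * cmod z) by rewrite divr_gt0 // mulr_gt0.
  have [d d0 HLd] := HL _ e1.
  pose q := e / (16 * (cmod L + 1) * cmod z).
  have q0 : 0 < q by rewrite divr_gt0 // !mulr_gt0.
  pose r := Num.min (1 / 8) (Num.min (d / (8 * cmod z)) (q / 2)).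
  have r0 : 0 < r by rewrite !lt_min !divr_gt0 ?mulr_gt0.
  exists r => // x' y' ax' xb' _ _ xx yy.
  set s := x' - x in xx *; set t := y' - y in yy *.
  set m := `|s| + `|t|.
  have m0 : 0 <= m by rewrite addr_ge0.
  have [m8 [md mq]] : m < 1 / 4 /\ m < d / (4 * cmod z) /\ m < q.
    move: xx yy; rewrite !lt_min => /andP[x1 /andP[x2 x3]] /andP[y1' /andP[y2' y3]].
    split; first by rewrite /m; lra.
    split; last by rewrite /m; lra.
    have -> : d / (4 * cmod z) = 2 * (d / (8 * cmod z)) by field; exact: lt0r_neq0.
    by rewrite /m; lra.
  set w := polar (expR (cl x')) y'.
  have wE : w = z * polar (expR s) t.
    by rewrite /w /z polarM -expRD !clE // /s /t !subrKC.
  have key : cmod (w - z - z * Complex s t) <= 8 * cmod z * m ^+ 2.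
    have -> : w - z - z * Complex s t = z * (polar (expR s) t - 1 - Complex s t).
      by rewrite wE; ring.
    rewrite cmodM -[leRHS]mulrA mulrCA ler_wpM2l ?cmod_ge0 //.
    by apply: polar_expand; clear - m8; rewrite /m in m8; have := normr_ge0 s; have := normr_ge0 t; lra.
  have cst : cmod (Complex s t) <= m by rewrite (le_trans (cmod_le_ReIm _)).
  have wz : cmod (w - z) <= 3 * cmod z * m.
    have := cmodD (w - z - z * Complex s t) (z * Complex s t); rewrite subrK cmodM => h.
    have h2 := ler_wpM2l (cmod_ge0 z) cst.
    have h3 : cmod z * m ^+ 2 <= cmod z * m * (1 / 4).
      by rewrite -mulrA ler_wpM2l ?cmod_ge0 // expr2 ler_wpM2l // ltW.
    by clear - key h h2 h3; lra.
  have part2 : cmod (L * (w - z - z * Complex s t)) <= e / 2 * m.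
    rewrite cmodM; apply: (@le_trans _ _ ((cmod L + 1) * (8 * cmod z * (m * q)))).
      apply: ler_pM; rewrite ?cmod_ge0 ?lerDl //.
      apply: (le_trans key); rewrite ler_wpM2l ?mulr_ge0 ?cmod_ge0 // expr2.
      by rewrite ler_wpM2l // ltW.
    rewrite /q le_eqVlt; apply/orP; left; apply/eqP; field.
    by rewrite !lt0r_neq0.
  rewrite /G -/z -/w.
  have -> : H w - H z - L * z * Complex s t =
    (H w - H z - L * (w - z)) + L * (w - z - z * Complex s t) by ring.
  apply: (le_trans (cmodD _ _)).
  suff part1 : cmod (H w - H z - L * (w - z)) <= e / 2 * m by clear - part1 part2; lra.
  have [->|wnz] := eqVneq w z.
    by rewrite !subrr mulr0 subrr cmod0 !mulr_ge0 ?invr_ge0 // ltW.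
  have wz0 : w - z != 0 by rewrite subr_eq0.
  have wzd : cmod (w - z) < d.
    apply: (le_lt_trans wz); move: md; rewrite ltr_pdivlMr ?mulr_gt0 // => h.
    by have := mulr_ge0 m0 (ltW z0); clear - h; lra.
  have := HLd _ wz0 wzd; rewrite subrKC => h.
  have -> : H w - H z - L * (w - z) = ((H w - H z) / (w - z) - L) * (w - z).
    by rewrite mulrBl divfK.
  rewrite cmodM; apply: (@le_trans _ _ (e / (6 * cmod z) * (3 * cmod z * m))).
    by apply: ler_pM; rewrite ?cmod_ge0 // ltW.
  rewrite le_eqVlt; apply/orP; left; apply/eqP; field.
  exact: lt0r_neq0.
move=> /eqP; rewrite /boundary_int.
have -> : cint a b (fun x => G x 0 - G x (2 * pi)) = 0.
  rewrite (_ : (fun x => _) = (fun=> 0)) ?cint_cst ?mulr0 //.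
  by apply/funext => x; rewrite /G -[2 * pi]add0r polar_periodic subrr.
rewrite add0r mulf_eq0 cintB // subr_eq0 => /orP[/eqP[] /eqP|/eqP].
  by rewrite oner_eq0.
rewrite /circle_int -Ea -Eb => /esym.
by rewrite /G !clE.
Qed.

End Polar.

(** * Rules for complex derivatives *)

Section DerivativeRules.
Variable R : realType.
Local Notation C := R[i].
Implicit Types (f g : C -> C) (z w h L : C).

Lemma is_cderiveP f z L : is_cderive f z L <->
  forall e : R, 0 < e -> exists2 d : R, 0 < d &
    forall h, cmod h < d -> cmod (f (z + h) - f z - h * L) <= e * cmod h.
Proof.
split=> H e e0.
  have [d d0 Hd] := H _ e0; exists d => // h hd.
  have [->|hn0] := eqVneq h 0.
    by rewrite addr0 subrr mul0r subrr cmod0 mulr0.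
  have -> : f (z + h) - f z - h * L = ((f (z + h) - f z) / h - L) * h.
    by rewrite mulrBl divfK // [L * h]mulrC.
  by rewrite cmodM ler_wpM2r ?cmod_ge0 // ltW // Hd.
have [d d0 Hd] := H _ (divr_gt0 e0 (ltr0Sn _ 1)); exists d => // h hn0 /Hd h1.
have h0 : 0 < cmod h by rewrite cmod_gt0.
have -> : (f (z + h) - f z) / h - L = (f (z + h) - f z - h * L) / h.
  by rewrite [RHS]mulrBl [h * L]mulrC mulfK.
rewrite cmod_div ltr_pdivrMr // (le_lt_trans h1) // ltr_pM2r //; lra.
Qed.

Lemma is_cderive_local f g z L (r : R) : 0 < r ->
  (forall h, cmod h < r -> f (z + h) = g (z + h)) -> is_cderive f z L -> is_cderive g z L.
Proof.
move=> r0 fg H e /H[d d0 Hd]; exists (Num.min r d); first by rewrite lt_min r0.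
have fz : f z = g z by rewrite -[z]addr0 fg // cmod0.
by move=> h hn0; rewrite lt_min => /andP[hr hd]; rewrite -fg // -fz; exact: Hd.
Qed.

Lemma is_cderive_cst (k : C) z : is_cderive (fun=> k) z 0.
Proof.
by apply/is_cderiveP => e e0; exists 1 => // h _; rewrite subrr mulr0 subrr cmod0 mulr_ge0 ?cmod_ge0 // ltW.
Qed.

Lemma is_cderive_id z : is_cderive (fun x => x) z 1.
Proof.
apply/is_cderiveP => e e0; exists 1 => // h _.
rewrite (_ : _ - _ = 0); last by ring.
by rewrite cmod0 mulr_ge0 ?cmod_ge0 // ltW.
Qed.

Lemma is_cderiveD f g z L M : is_cderive f z L -> is_cderive g z M ->
  is_cderive (fun x => f x + g x) z (L + M).
Proof.
move=> /is_cderiveP fL /is_cderiveP gM; apply/is_cderiveP => e e0.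
have e20 : 0 < e / 2 by rewrite divr_gt0.
have [d d0 H] := fL _ e20; have [d' d'0 H'] := gM _ e20.
exists (Num.min d d'); first by rewrite lt_min d0.
move=> h; rewrite lt_min => /andP[/H h1 /H' h2].
have -> : f (z + h) + g (z + h) - (f z + g z) - h * (L + M) =
  (f (z + h) - f z - h * L) + (g (z + h) - g z - h * M) by ring.
by apply: (le_trans (cmodD _ _)); lra.
Qed.

Lemma is_cderiveM f g z L M : is_cderive f z L -> is_cderive g z M ->
  is_cderive (fun x => f x * g x) z (L * g z + f z * M).
Proof.
move=> fL gM; apply/is_cderiveP => e e0.
have [d1 d10 H1] := is_cderive_continuous gM ltr01.
have B0 : 0 < cmod (g z) + 1 by rewrite ltr_wpDl ?cmod_ge0.
have A0 : 0 < cmod (f z) + 1 by rewrite ltr_wpDl ?cmod_ge0.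
have L0 : 0 < cmod L + 1 by rewrite ltr_wpDl ?cmod_ge0.
have e1 : 0 < e / 3 by rewrite divr_gt0.
have /is_cderiveP /(_ _ (divr_gt0 e1 B0))[d2 d20 H2] := fL.
have /is_cderiveP /(_ _ (divr_gt0 e1 A0))[d3 d30 H3] := gM.
have [d4 d40 H4] := is_cderive_continuous gM (divr_gt0 e1 L0).
exists (Num.min (Num.min d1 d2) (Num.min d3 d4)); first by rewrite !lt_min d10 d20 d30.
move=> h; rewrite !lt_min => /andP[/andP[h1 h2] /andP[h3 h4]].
have -> : f (z + h) * g (z + h) - f z * g z - h * (L * g z + f z * M) =
  (f (z + h) - f z - h * L) * g (z + h) + f z * (g (z + h) - g z - h * M) +
  h * L * (g (z + h) - g z) by ring.
have zh : cmod ((z + h) - z) = cmod h by rewrite addrAC subrr add0r.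
have gb : cmod (g (z + h)) <= cmod (g z) + 1.
  have := H1 (z + h); rewrite zh => /(_ h1).
  have := ler_cmodB (g (z + h)) (g z); lra.
have p1 : cmod ((f (z + h) - f z - h * L) * g (z + h)) <= e / 3 * cmod h.
  rewrite cmodM; apply: (@le_trans _ _ (e / 3 / (cmod (g z) + 1) * cmod h * (cmod (g z) + 1))).
    by apply: ler_pM; rewrite ?cmod_ge0 // H2.
  by rewrite mulrAC divfK ?lt0r_neq0.
have p2 : cmod (f z * (g (z + h) - g z - h * M)) <= e / 3 * cmod h.
  rewrite cmodM; apply: (@le_trans _ _ ((cmod (f z) + 1) * (e / 3 / (cmod (f z) + 1) * cmod h))).
    by apply: ler_pM; rewrite ?cmod_ge0 ?lerDl // H3.
  by rewrite le_eqVlt; apply/orP; left; apply/eqP; field; exact: lt0r_neq0.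
have p3 : cmod (h * L * (g (z + h) - g z)) <= e / 3 * cmod h.
  rewrite !cmodM; apply: (@le_trans _ _ (cmod h * (cmod L + 1) * (e / 3 / (cmod L + 1)))).
    apply: ler_pM; rewrite ?mulr_ge0 ?cmod_ge0 ?ler_wpM2l ?cmod_ge0 ?lerDl //.
    by rewrite ltW // H4 // zh.
  by rewrite -mulrA [X in _ * X]mulrC divfK ?lt0r_neq0 // mulrC.
apply: (le_trans (cmodD _ _)); have := cmodD ((f (z + h) - f z - h * L) * g (z + h))
 (f z * (g (z + h) - g z - h * M)); clear - p1 p2 p3; lra.
Qed.

Lemma is_cderiveV z : z != 0 -> is_cderive (fun x => x^-1) z (- (z ^+ 2)^-1).
Proof.
move=> zn0; have z0 : 0 < cmod z by rewrite cmod_gt0.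
apply: (@taylor2_is_cderive _ _ _ _ (cmod z / 2) (2 / cmod z ^+ 3)); first by rewrite divr_gt0.
move=> h hz.
have zh : cmod z / 2 <= cmod (z + h).
  have := ler_cmodB z (- h); rewrite opprK cmodN; lra.
have zh0 : z + h != 0 by rewrite -cmod_gt0; lra.
have -> : (z + h)^-1 - z^-1 - h * - (z ^+ 2)^-1 = h ^+ 2 / (z ^+ 2 * (z + h)).
  by field; rewrite zn0 zh0.
rewrite cmod_div cmodM !cmodX mulrC ler_wpM2r ?sqr_ge0 //.
have zh1 : 0 < cmod (z + h) by rewrite cmod_gt0.
have -> : 2 / cmod z ^+ 3 = (cmod z ^+ 2 * (cmod z / 2))^-1.
  by field; exact: lt0r_neq0.
rewrite lef_pV2 ?posrE ?mulr_gt0 ?exprn_gt0 ?divr_gt0 //.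
by rewrite ler_wpM2l ?sqr_ge0.
Qed.

Lemma is_cderive_comp_subl f z0 z L : is_cderive f (z - z0) L ->
  is_cderive (fun x => f (x - z0)) z L.
Proof.
by move=> H e /H[d d0 Hd]; exists d => // h hn0 /Hd; rewrite addrAC; apply.
Qed.

Lemma is_cderive_inv_sub z0 z : z != z0 ->
  is_cderive (fun x => (x - z0)^-1) z (- ((z - z0) ^+ 2)^-1).
Proof.
by move=> zz; apply: (@is_cderive_comp_subl (fun x => x^-1)); apply: is_cderiveV; rewrite subr_eq0.
Qed.

End DerivativeRules.

(** * Vanishing circle integrals and the Cauchy kernel *)

Section Cauchy.
Variable R : realType.
Local Notation C := R[i].
Implicit Types (f g H : C -> C) (z w : C) (r s t : R).

Definition cont_at H z := forall e : R, 0 < e ->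
  exists2 d : R, 0 < d & forall w, cmod (w - z) < d -> cmod (H w - H z) < e.

Lemma circle_uniform H r : (forall z, cmod z = `|r| -> cont_at H z) ->
  forall e : R, 0 < e -> exists2 d : R, 0 < d & forall s, `|s - r| < d ->
    forall t, 0 <= t -> t <= 2 * pi -> cmod (H (polar s t) - H (polar r t)) < e.
Proof.
move=> Hc e e0.
have /compact_near_coveringP := @segment_compact R 0 (2 * pi).
move=> /(_ R (nbhs r) (fun s t => cmod (H (polar s t) - H (polar r t)) < e) _).
case.
  move=> t _; have e20 : 0 < e / 2 by rewrite divr_gt0.
  have [d d0 Hd] := Hc _ (cmod_polar r t) _ e20.
  have r0 : 0 < 2 * (`|r| + 1) by rewrite mulr_gt0 // ltr_wpDl.
  exists (ball t (d / (2 * (`|r| + 1))), ball r (d / 2)).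
    by split; apply: nbhsx_ballx; rewrite divr_gt0.
  move=> [t' s'] [/= tt ss].
  have tt' : `|t' - t| < d / (2 * (`|r| + 1)) by rewrite distrC; exact: tt.
  have ss' : `|s' - r| < d / 2 by rewrite distrC; exact: ss.
  have b1 : cmod (polar r t' - polar r t) < d / 2.
    apply: le_lt_trans (polar_lip _ _ _) _.
    apply: (@le_lt_trans _ _ ((`|r| + 1) * `|t' - t|)); first by rewrite ler_wpM2r // lerDl.
    by move: tt'; rewrite ltr_pdivlMr // => h; lra.
  have b2 : cmod (polar s' t' - polar r t') < d / 2.
    have -> : polar s' t' - polar r t' = polar (s' - r) t'.
      by apply: complex_ext; rewrite ?(Re_add, Im_add, Re_opp, Im_opp) /=; ring.
    by rewrite cmod_polar.
  have := Hd (polar r t'); have := Hd (polar s' t').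
  have := cmod_triangle (polar r t') (polar s' t') (polar r t).
  have := cmod_triangle (H (polar r t)) (H (polar s' t')) (H (polar r t')).
  rewrite (cmodC (H (polar r t)) (H (polar r t'))) => h1 h2 h3 h4.
  have h5 : cmod (polar s' t' - polar r t) < d by lra.
  have h6 : cmod (polar r t' - polar r t) < d by lra.
  by have := h3 h5; have := h4 h6; clear - h1; lra.
move=> d /= d0 Hd; exists d => // s sr t t0 t1.
apply: (Hd s); first by rewrite /ball_ /= distrC.
by rewrite /= in_itv /= t0 t1.
Qed.

Definition disc_cont H := forall z, in_disc z -> cont_at H z.

Lemma disc_cont_circle H r : disc_cont H -> 0 <= r -> r < 1 ->
  forall z, cmod z = `|r| -> cont_at H z.
Proof. by move=> Hc r0 r1 z zr; apply: Hc; rewrite /in_disc zr ger0_norm. Qed.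

Lemma circle_int_cont H r : disc_cont H -> 0 <= r -> r < 1 ->
  forall e : R, 0 < e -> exists2 d : R, 0 < d & forall s, 0 <= s -> s < 1 -> `|s - r| < d ->
    cmod (circle_int H s - circle_int H r) < e.
Proof.
move=> Hc r0 r1 e e0.
have pi0 : 0 < 2 * pi :> R by rewrite mulr_gt0 ?pi_gt0.
have e1 : 0 < e / (4 * (2 * pi)) by rewrite divr_gt0 // mulr_gt0.
have Hr := disc_cont_circle Hc r0 r1.
have [d d0 Hd] := circle_uniform Hr e1; exists d => // s s0 s1 sr.
have Hs := disc_cont_circle Hc s0 s1.
rewrite /circle_int -cintB; try exact: ccont_polar.
apply: (@le_lt_trans _ _ (2 * ((2 * pi - 0) * (e / (4 * (2 * pi)))))).
  apply: cint_bound; [exact: ltW|by apply: ccontB; exact: ccont_polar|].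
  by move=> t t0 t1; exact/ltW/Hd.
rewrite subr0; have -> : 2 * (2 * pi * (e / (4 * (2 * pi)))) = e / 2.
  by move: pi0; set p := 2 * pi => p0; field; exact: lt0r_neq0.
lra.
Qed.

Lemma circle_int_eq0_right H r s : disc_cont H -> 0 <= r -> r < s -> s < 1 ->
  (forall z, r < cmod z -> cmod z <= s -> exists L, is_cderive H z L) ->
  circle_int H r = 0 -> circle_int H s = 0.
Proof.
move=> Hc r0 rs s1 Hd Hr0; have r1 := lt_trans rs s1.
apply/eqP; rewrite -cmod_eq0; apply/eqP/le_anti; rewrite cmod_ge0 andbT.
apply/ler_addgt0Pl => e e0; rewrite addr0.
have [d d0 H1] := circle_int_cont Hc r0 r1 e0.
pose u := Num.min s (r + d / 2).
have ru : r < u by rewrite lt_min rs /=; lra.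
have us : u <= s by rewrite ge_min lexx.
have ud : u <= r + d / 2 by rewrite ge_min lexx orbT.
rewrite -(@circle_int_const _ H u s) //; last first.
- by move=> z z1 z2; apply: Hd => //; exact: lt_le_trans z1.
- exact: le_lt_trans ru.
have := H1 u (ltW (le_lt_trans r0 ru)) (le_lt_trans us s1).
rewrite Hr0 subr0 => h; apply/ltW/h; rewrite gtr0_norm ?subr_gt0 //; lra.
Qed.

Lemma circle_int_eq0_left H r : disc_cont H -> 0 < r -> r < 1 ->
  (forall s, 0 < s -> s < r -> circle_int H s = 0) -> circle_int H r = 0.
Proof.
move=> Hc r0 r1 Hs.
apply/eqP; rewrite -cmod_eq0; apply/eqP/le_anti; rewrite cmod_ge0 andbT.
apply/ler_addgt0Pl => e e0; rewrite addr0.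
have [d d0 H1] := circle_int_cont Hc (ltW r0) r1 e0.
pose u := Num.max (r / 2) (r - d / 2).
have u1 : r / 2 <= u by rewrite le_max lexx.
have u2 : r - d / 2 <= u by rewrite le_max lexx orbT.
have ur : u < r by rewrite gt_max; apply/andP; split; lra.
have u0 : 0 < u by lra.
have := H1 u (ltW u0) (lt_trans ur r1); rewrite Hs // sub0r cmodN => h.
apply/ltW/h; rewrite distrC gtr0_norm ?subr_gt0 //; lra.
Qed.

Lemma circle_int0 H : circle_int H 0 = real_complex R (2 * pi) * H 0.
Proof.
rewrite /circle_int (_ : (fun t => _) = (fun=> H 0)).
  by rewrite cint_cst ?subr0 // mulr_ge0 ?pi_ge0.
by apply/funext => t; congr H; apply: complex_ext; rewrite /= mul0r.
Qed.

Lemma disc_cont_derivative f fp : derivative_on_disc f fp -> disc_cont f.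
Proof. by move=> fd z /fd /is_cderive_continuous. Qed.

(** The integral vanishes at radius 0 because [H 0 = 0], is constant on either side of the radius
    [cmod z0], and is continuous in the radius, which carries it across the exceptional circle. This
    takes the place of a removable singularity theorem. *)
Lemma circle_int_eq0 H (z0 : C) s : disc_cont H -> H 0 = 0 -> in_disc z0 -> 0 < s -> s < 1 ->
  (forall z, in_disc z -> z != z0 -> exists L, is_cderive H z L) -> circle_int H s = 0.
Proof.
move=> Hc H0 z0D s0 s1 Hd.
have H00 : circle_int H 0 = 0 by rewrite circle_int0 H0 mulr0.
have [z00|z0n0] := eqVneq z0 0.
  apply: (circle_int_eq0_right Hc (lexx 0) s0 s1) => // z zp zs.
  apply: Hd; first exact: le_lt_trans s1.
  by rewrite z00 -cmod_gt0.
have r0 : 0 < cmod z0 by rewrite cmod_gt0.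
have left u : 0 < u -> u < cmod z0 -> circle_int H u = 0.
  move=> u0 uz; apply: (circle_int_eq0_right Hc (lexx 0) u0 (lt_trans uz z0D)) => //.
  move=> z zp zu; apply: Hd; first exact: le_lt_trans (lt_trans uz z0D).
  by apply/eqP => zz; move: (le_lt_trans zu uz); rewrite zz ltxx.
have mid : circle_int H (cmod z0) = 0 by exact: circle_int_eq0_left left.
case: (ltgtP s (cmod z0)) => [|sz|->//]; first exact: left.
apply: (circle_int_eq0_right Hc (ltW r0) sz s1) => // z zp zs.
apply: Hd; first exact: le_lt_trans s1.
by apply/eqP => zz; move: zp; rewrite zz ltxx.
Qed.

(** The factor [z] turns [dt] into [dz] up to a constant and makes the integrand vanish at 0; with
    the value [fp z0 * z0] at [z0] the integrand is continuous on the disc. *)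
Lemma cauchy_kernel f fp z0 r : derivative_on_disc f fp -> in_disc z0 -> 0 < r -> r < 1 ->
  cmod z0 < r -> circle_int (fun z => (f z - f z0) * (z / (z - z0))) r = 0.
Proof.
move=> fd z0D r0 r1 zr.
pose H z := if z == z0 then fp z0 * z0 else (f z - f z0) * (z / (z - z0)).
have -> : circle_int (fun z => (f z - f z0) * (z / (z - z0))) r = circle_int H r.
  congr cint; apply/funext => t; rewrite /H; case: eqP => // E.
  by move: zr; rewrite -E cmod_polar gtr0_norm // ltxx.
have Hd z : in_disc z -> z != z0 -> exists L, is_cderive H z L.
  move=> zD zz.
  have zz0 : 0 < cmod (z - z0) by rewrite cmod_gt0 subr_eq0.
  eexists; apply: (@is_cderive_local _ (fun z => (f z - f z0) * (z / (z - z0))) _ _ _ _ zz0).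
    move=> h hz; rewrite /H; case: eqP => // E.
    by move: hz; rewrite -E opprD addrA subrr add0r cmodN ltxx.
  apply: is_cderiveM; last exact: is_cderiveM (is_cderive_id z) (is_cderive_inv_sub zz).
  exact: is_cderiveD (fd _ zD) (is_cderive_cst _ _).
apply: (@circle_int_eq0 H z0) => //.
- move=> z zD; have [->|zz] := eqVneq z z0; last first.
    by have [L HL] := Hd _ zD zz; exact: is_cderive_continuous HL.
  move=> e e0.
  have q0 : 0 < cmod (fp z0) + 1 by rewrite ltr_wpDl ?cmod_ge0.
  pose e1 := Num.min 1 (e / 4).
  have e10 : 0 < e1 by rewrite lt_min divr_gt0 // ltr01.
  have [d d0 Hf] := fd _ z0D _ e10.
  exists (Num.min d (e / (4 * (cmod (fp z0) + 1)))).
    by rewrite lt_min d0 divr_gt0 // mulr_gt0.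
  move=> w; rewrite lt_min => /andP[wd we]; rewrite /H eqxx.
  case: eqP => [_|/eqP wz]; first by rewrite subrr cmod0.
  have wz0 : w - z0 != 0 by rewrite subr_eq0.
  have := Hf _ wz0 wd; rewrite subrKC lt_min => /andP[_ h].
  have w1 : cmod z0 <= 1 by exact: ltW.
  have -> : (f w - f z0) * (w / (w - z0)) - fp z0 * z0 =
    ((f w - f z0) / (w - z0) - fp z0) * z0 + ((f w - f z0) / (w - z0) - fp z0) * (w - z0) +
     fp z0 * (w - z0).
    by field.
  have p1 : cmod (((f w - f z0) / (w - z0) - fp z0) * z0) <= e / 4.
    rewrite cmodM -[leRHS]mulr1; apply: ler_pM; rewrite ?cmod_ge0 // ltW //.
  have qe : cmod (w - z0) * (cmod (fp z0) + 1) <= e / 4.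
    move/ltW: we; rewrite -(ler_pM2r q0); set q := _ + 1 in q0 *.
    suff -> : e / (4 * q) * q = e / 4 by [].
    by field; exact: lt0r_neq0.
  have p2 : cmod (((f w - f z0) / (w - z0) - fp z0) * (w - z0)) <= e / 4.
    rewrite cmodM; apply: le_trans qe; rewrite mulrC ler_wpM2l ?cmod_ge0 //.
    have := Hf _ wz0 wd; rewrite subrKC lt_min => /andP[h' _].
    by have := cmod_ge0 (fp z0); lra.
  have p3 : cmod (fp z0 * (w - z0)) <= e / 4.
    by rewrite cmodM; apply: le_trans qe; rewrite mulrC ler_wpM2l ?cmod_ge0 // lerDl.
  apply: le_lt_trans (cmodD _ _) _.
  have := cmodD (((f w - f z0) / (w - z0) - fp z0) * z0) (((f w - f z0) / (w - z0) - fp z0) * (w - z0)).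
  clear - p1 p2 p3 e0; lra.
- rewrite /H; case: eqP => [<-|_]; first by rewrite mulr0.
  by rewrite mul0r mulr0.
Qed.

Lemma cint_conj a b (g : R -> C) : ccont g ->
  cint a b (fun t => conjc (g t)) = conjc (cint a b g).
Proof.
move=> gc; apply: complex_ext; rewrite ?Re_conjc ?Im_conjc /=.
  by apply: eq_Rintegral => t _; rewrite Re_conjc.
rewrite -mulN1r -RintegralZl //; last exact/continuous_integrable/ccont_Im.
by apply: eq_Rintegral => t _; rewrite Im_conjc mulN1r.
Qed.

Lemma circle_int_pow r i : 0 < r -> r < 1 -> circle_int (fun z => z ^+ i.+1) r = 0.
Proof.
move=> r0 r1.
have Hd z : in_disc z -> exists L, is_cderive (fun z => z ^+ i.+1) z L.
  move=> _; elim: i => [|i [L IH]].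
    by exists 1; exact: is_cderive_id.
  eexists; under [X in is_cderive X]funext => x do rewrite exprS.
  exact: is_cderiveM (is_cderive_id z) IH.
apply: (@circle_int_eq0 _ 0) => //.
- by move=> z /Hd[L]; exact: is_cderive_continuous.
- by rewrite exprS mul0r.
- exact: in_disc0.
- by move=> z /Hd.
Qed.

Lemma continuous_pow i (z : C) : cont_at (fun z => z ^+ i) z.
Proof.
elim: i => [|i IH].
  by move=> e e0; exists 1 => // w _; rewrite !expr0 subrr cmod0.
have [L HL] : exists L, is_cderive (fun z => z ^+ i.+1) z L.
  elim: i {IH} => [|i [L IH]]; first by exists 1; exact: is_cderive_id.
  eexists; under [X in is_cderive X]funext => x do rewrite exprS.
  exact: is_cderiveM (is_cderive_id z) IH.
exact: is_cderive_continuous HL.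
Qed.

(** On the circle [z^-1] is [conjc z / r ^+ 2], so negative powers are multiples of conjugates of
    positive ones. *)
Lemma circle_int_inv_pow r i : 0 < r -> r < 1 ->
  circle_int (fun z => (z ^+ i)^-1) r = real_complex R (if i is 0%N then 2 * pi else 0).
Proof.
move=> r0 r1; case: i => [|i].
  rewrite /circle_int; under [X in cint _ _ X]funext do rewrite expr0 invr1.
  by rewrite cint_cst ?subr0 ?mulr1 // mulr_ge0 ?pi_ge0.
have cp : ccont (fun t => polar r t ^+ i.+1).
  by apply: (@ccont_polar _ (fun z => z ^+ i.+1)) => z _; exact: continuous_pow.
rewrite /circle_int.
have -> : (fun t => (polar r t ^+ i.+1)^-1) =
    (fun t => real_complex R ((r ^+ i.+1) ^+ 2)^-1 * conjc (polar r t ^+ i.+1)).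
  apply/funext => t; set w := polar r t ^+ i.+1.
  have cw : cmod w = r ^+ i.+1 by rewrite cmodX cmod_polar gtr0_norm.
  have wn0 : w != 0 by rewrite -cmod_gt0 cw exprn_gt0.
  apply: (mulfI wn0); rewrite divff // mulrCA mul_conjc cw -rmorphM /= mulVf ?rmorph1 //.
  by rewrite expf_neq0 // expf_neq0 // lt0r_neq0.
rewrite cintZ; last first.
  move=> x e e0; have [d d0 Hd] := cp x _ e0; exists d => // y /Hd.
  by rewrite -rmorphB cmod_conj.
rewrite cint_conj // -/(circle_int (fun z => z ^+ i.+1) r) circle_int_pow //.
by rewrite conjc0 mulr0.
Qed.

End Cauchy.

(** * Taylor expansion of analytic functions on the disc *)

Section Taylor.
Variable R : realType.
Local Notation C := R[i].
Implicit Types (f g : C -> C) (z w : C) (r s t : R).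

Lemma geom_small (q M e : R) : 0 <= q -> q < 1 -> 0 < e ->
  exists N, forall n, (N <= n)%N -> M * q ^+ n < e.
Proof.
move=> q0 q1 e0.
have B0 : 0 <= `|M| / (1 - q) / e.
  by rewrite !divr_ge0 // ?subr_ge0 ltW.
exists (Num.bound (`|M| / (1 - q) / e)) => n Nn.
apply: (@le_lt_trans _ _ (`|M| * q ^+ n)).
  by rewrite ler_wpM2r ?exprn_ge0 ?ler_norm.
have h1 := natmul_geom_le n q0 q1.
have h2 : `|M| / (1 - q) / e < n.+1%:R.
  apply: lt_le_trans (archi_boundP B0) _.
  by rewrite ler_nat ltnW.
have n0 : 0 < n.+1%:R :> R by rewrite ltr0n.
rewrite ltr_pdivrMr // in h2; rewrite -(ltr_pM2l n0) mulrCA.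
apply: le_lt_trans h2; exact: ler_wpM2l.
Qed.

Lemma ccont_bounded (g : R -> C) a b : a <= b -> ccont g ->
  exists2 M, 0 <= M & forall t, a <= t -> t <= b -> cmod (g t) <= M.
Proof.
move=> ab gc.
have cc : continuous (fun t => cmod (g t) : R).
  move=> t; apply/cvgrPdist_lt => e e0; have [d d0 Hd] := gc t _ e0.
  exists d => // y yd; rewrite distrC (le_lt_trans (ler_dist_cmod _ _)) // Hd //.
  by rewrite distrC.
have [c _ cM] := @EVT_max R (fun t => cmod (g t)) a b ab (continuous_subspaceT cc).
exists (cmod (g c)); first exact: cmod_ge0.
by move=> t at_ tb; apply: cM; rewrite in_itv /= at_ tb.
Qed.

Lemma ccont_sum n (g : nat -> R -> C) : (forall i, ccont (g i)) ->
  ccont (fun t => \sum_(i < n) g i t).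
Proof.
move=> gc; elim: n => [|n IH].
  by under [X in ccont X]funext do rewrite big_ord0; exact: ccont_cst.
under [X in ccont X]funext do rewrite big_ord_recr /=; exact: ccontD.
Qed.

Lemma cint_sum a b n (g : nat -> R -> C) : a <= b -> (forall i, ccont (g i)) ->
  cint a b (fun t => \sum_(i < n) g i t) = \sum_(i < n) cint a b (g i).
Proof.
move=> ab gc; elim: n => [|n IH].
  under [X in cint _ _ X]funext do rewrite big_ord0.
  by rewrite big_ord0 cint_cst // mulr0.
under [X in cint _ _ X]funext do rewrite big_ord_recr /=.
by rewrite cintD ?big_ord_recr ?IH //; exact: ccont_sum.
Qed.

Definition taylor_coef f r i : C :=
  (real_complex R (2 * pi))^-1 * circle_int (fun z => f z * (z ^+ i)^-1) r.

(** Subtracting [n] terms of the geometric series from the kernel [K] leaves [(z0 / z) ^+ n] times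
    [K] itself, whose maximum on the circle decays geometrically. *)
Lemma taylor_circle f fp z0 r : derivative_on_disc f fp -> 0 < r -> r < 1 ->
  cmod z0 < r -> ccvg (psum (taylor_coef f r) z0) (f z0).
Proof.
move=> fd r0 r1 zr.
have z0D : in_disc z0 := lt_trans zr r1.
have pi0 : 0 < 2 * pi :> R by rewrite mulr_gt0 ?pi_gt0.
have rad t : cmod (polar r t) = r by rewrite cmod_polar gtr0_norm.
have zn0 t : polar r t != 0 by rewrite -cmod_gt0 rad.
have zz0 t : polar r t - z0 != 0.
  by rewrite subr_eq0; apply/eqP => E; move: zr; rewrite -E rad ltxx.
have Dz (z : C) : cmod z = `|r| -> in_disc z /\ z != 0.
  by rewrite gtr0_norm // => zE; rewrite /in_disc zE -cmod_gt0 zE.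
have fc i : ccont (fun t => f (polar r t) * (polar r t ^+ i)^-1).
  apply: (@ccont_polar _ (fun z => f z * (z ^+ i)^-1)) => z /Dz[zD z_neq0].
  have : exists L, is_cderive (fun z => (z ^+ i)^-1) z L.
    elim: i => [|i [L IH]].
      by exists 0; under [X in is_cderive X]funext do rewrite expr0 invr1; exact: is_cderive_cst.
    eexists; under [X in is_cderive X]funext do rewrite exprS invfM.
    exact: is_cderiveM (is_cderiveV z_neq0) IH.
  by move=> [L HL]; exact: is_cderive_continuous (is_cderiveM (fd _ zD) HL).
have pc i : ccont (fun t => (polar r t ^+ i)^-1).
  apply: (@ccont_polar _ (fun z => (z ^+ i)^-1)) => z /Dz[zD z_neq0].
  have : exists L, is_cderive (fun z => (z ^+ i)^-1) z L.
    elim: i => [|i [L IH]].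
      by exists 0; under [X in is_cderive X]funext do rewrite expr0 invr1; exact: is_cderive_cst.
    eexists; under [X in is_cderive X]funext do rewrite exprS invfM.
    exact: is_cderiveM (is_cderiveV z_neq0) IH.
  by move=> [L HL]; exact: is_cderive_continuous HL.
pose K t := (f (polar r t) - f z0) * (polar r t / (polar r t - z0)).
have Kc : ccont K.
  apply: (@ccont_polar _ (fun z => (f z - f z0) * (z / (z - z0)))) => z zE.
  have [zD _] := Dz z zE; have z_z0 : z != z0.
    by apply/eqP => E; move: zr; rewrite -E zE gtr0_norm // ltxx.
  apply: is_cderive_continuous; apply: is_cderiveM.
    exact: is_cderiveD (fd _ zD) (is_cderive_cst _ _).
  exact: is_cderiveM (is_cderive_id z) (is_cderive_inv_sub z_z0).
have [M M0 KM] := ccont_bounded (ltW pi0) Kc.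
have K0 : cint 0 (2 * pi) K = 0 := cauchy_kernel fd z0D r0 r1 zr.
pose q := cmod z0 / r.
have q0 : 0 <= q by rewrite divr_ge0 ?cmod_ge0 // ltW.
have q1 : q < 1 by rewrite ltr_pdivrMr // mul1r.
pose S i t := z0 ^+ i * (f (polar r t) * (polar r t ^+ i)^-1 - f z0 * (polar r t ^+ i)^-1).
have Sc i : ccont (S i) by apply: ccontZ; apply: ccontB => //; exact: ccontZ.
have SK n t : K t - \sum_(i < n) S i t = (z0 / polar r t) ^+ n * K t.
  elim: n => [|n IH]; first by rewrite big_ord0 subr0 expr0 mul1r.
  rewrite big_ord_recr /= opprD addrA IH /S /K !expr_div_n !exprS.
  have := zn0 t; have := zz0 t; set z := polar r t => h1 h2.
  have h3 : z ^+ n != 0 by rewrite expf_neq0.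
  by field; rewrite h1 h2 h3.
have Sint n : \sum_(i < n) cint 0 (2 * pi) (S i) =
    \sum_(i < n) z0 ^+ i * (real_complex R (2 * pi) * taylor_coef f r i -
      f z0 * real_complex R (if i == 0%N :> nat then 2 * pi else 0)).
  apply: eq_bigr => i _; rewrite cintZ; last by apply: ccontB => //; exact: ccontZ.
  rewrite cintB //; last exact: ccontZ.
  rewrite cintZ // -/(circle_int (fun z => (z ^+ i)^-1) r) circle_int_inv_pow //.
  rewrite /taylor_coef mulrA divff ?mul1r.
    by congr (_ * (_ - _ * real_complex R _)); case: (nat_of_ord i).
  by rewrite -cmod_gt0 cmod_real gtr0_norm.
have key n : cmod (psum (taylor_coef f r) z0 n.+1 - f z0) <= 2 * M * q ^+ n.+1.
  have E : real_complex R (2 * pi) * (psum (taylor_coef f r) z0 n.+1 - f z0) =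
      - cint 0 (2 * pi) (fun t => (z0 / polar r t) ^+ n.+1 * K t).
    under [X in - cint _ _ X]funext do rewrite -SK.
    rewrite cintB //; last exact: ccont_sum.
    rewrite K0 sub0r opprK cint_sum ?(ltW pi0) // Sint.
    rewrite big_ord_recl /= expr0 mul1r /psum big_ord_recl /= expr0 mulr1.
    under [X in _ = _ + X]eq_bigr do rewrite /= mulr0 subr0 mulrCA.
    rewrite -mulr_sumr; under [X in _ = _ + _ * X]eq_bigr do rewrite mulrC.
    ring.
  have : cmod (real_complex R (2 * pi) * (psum (taylor_coef f r) z0 n.+1 - f z0)) <=
      2 * ((2 * pi - 0) * (q ^+ n.+1 * M)).
    rewrite E cmodN; apply: cint_bound; first exact: ltW.
      under [X in ccont X]funext do rewrite -SK.
      by apply: ccontB => //; exact: ccont_sum.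
    move=> t t0 t1; rewrite cmodM cmodX cmod_div rad.
    by rewrite ler_wpM2l ?exprn_ge0 // KM.
  rewrite cmodM cmod_real gtr0_norm // subr0 => h.
  by rewrite -(ler_pM2l pi0); apply: le_trans h _; rewrite le_eqVlt; apply/orP; left; apply/eqP; ring.
move=> e e0; have [N HN] := geom_small (2 * M) q0 q1 e0.
exists N.+1 => -[//|n] Nn; apply: le_lt_trans (key n) _; apply: HN.
by rewrite ltnW.
Qed.

Theorem taylor f : analytic_on_disc f -> exists a, expands a f.
Proof.
move=> [fp fd].
have half : (0 < 1 / 2 :> R) /\ (1 / 2 < 1 :> R) by split; lra.
(* The coefficients depend a priori on the radius. The function [f (h * z)] with [h = 1 / 2] expands
   on the whole disc through either set of coefficients, so uniqueness identifies them. *)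
have same r : 1 / 2 <= r -> r < 1 -> forall i, taylor_coef f r i = taylor_coef f (1 / 2) i.
  move=> r2 r1 i; have [h0 h1] := half; pose h := real_complex R (1 / 2).
  have hn0 : h != 0 by rewrite -cmod_gt0 cmod_real gtr0_norm.
  have scaled s : 1 / 2 <= s -> s < 1 ->
      expands (fun i => taylor_coef f s i * h ^+ i) (fun z => f (h * z)).
    move=> s2 s1 z zD.
    have hz : cmod (h * z) < s.
      rewrite cmodM cmod_real gtr0_norm //; apply: lt_le_trans s2.
      by rewrite -[ltRHS]mulr1 ltr_pM2l.
    apply: ccvg_ext (taylor_circle fd (lt_le_trans h0 s2) s1 hz) => n.
    by apply: eq_bigr => j _; rewrite exprMn mulrA.
  have := expands_unique (scaled _ r2 r1) (scaled _ (lexx _) h1) i.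
  by apply: mulIf; rewrite expf_neq0.
exists (taylor_coef f (1 / 2)) => z zD.
pose r := Num.max (1 / 2) ((1 + cmod z) / 2).
have [h0 h1] := half.
have r2 : 1 / 2 <= r by rewrite le_max lexx.
have zr : cmod z < r by rewrite lt_max; apply/orP; right; move: zD; rewrite /in_disc; lra.
have r1 : r < 1 by rewrite gt_max h1 /=; move: zD; rewrite /in_disc; lra.
apply: ccvg_ext (taylor_circle fd (lt_le_trans h0 r2) r1 zr) => n.
by apply: eq_bigr => i _; rewrite same.
Qed.

Lemma expands_cauchy_prod (a b : nat -> C) f g : expands a f -> expands b g ->
  expands (cauchy_prod a b) (fun z => f z * g z).
Proof.
move=> af bg z zD; have [r [zr r0 r1]] := disc_radius zD.
(* A fourth root of the ratio: the error [n * (2 n) * s ^+ (4 n)] becomes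
   [2 * (n * s ^+ n) ^+ 2 * s ^+ (2 n)], where the square is bounded and the last factor tends to
   0. *)
pose s := Num.sqrt (Num.sqrt (cmod z / r)).
have q0 : 0 <= cmod z / r by rewrite divr_ge0 ?cmod_ge0 // ltW.
have q1 : cmod z / r < 1 by rewrite ltr_pdivrMr // mul1r.
have s0 : 0 <= s by exact: sqrtr_ge0.
have s1 : s < 1 by rewrite -sqrtr1 ltr_sqrt // -sqrtr1 ltr_sqrt.
have s4 : cmod z / r = s ^+ 4.
  by rewrite -[4%N]/(2 * 2)%N exprM !sqr_sqrtr ?sqrtr_ge0.
have [K aK] := expands_subgeom af (ltW r0) r1.
have [K' bK] := expands_subgeom bg (ltW r0) r1.
pose B := Num.max K K'.
have bnd (c : nat -> C) Kc : Kc <= B -> (forall i, cmod (c i) * r ^+ i <= Kc) ->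
    forall i, cmod (c i * z ^+ i) <= B * (s ^+ 4) ^+ i.
  move=> KB cK i; rewrite cmodM cmodX -s4 expr_div_n.
  rewrite mulrA ler_pdivlMr ?exprn_gt0 // mulrAC ler_wpM2r ?exprn_ge0 ?cmod_ge0 //.
  exact: le_trans (cK i) KB.
have s40 : 0 <= s ^+ 4 by exact: exprn_ge0.
have s41 : s ^+ 4 < 1 by rewrite -s4.
have key n := @psum_cauchy_prod_le R a b z B (s ^+ 4) n s40 s41
  (bnd a K (ltac:(by rewrite le_max lexx)) aK) (bnd b K' (ltac:(by rewrite le_max lexx orbT)) bK).
have lim0 : ccvg (fun n => psum (cauchy_prod a b) z n - psum a z n * psum b z n) 0.
  move=> e e0.
  have s20 : 0 <= s ^+ 2 by exact: exprn_ge0.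
  have s21 : s ^+ 2 < 1 by rewrite expr_lt1.
  have [N HN] := geom_small (2 * B ^+ 2 * ((1 - s)^-1) ^+ 2) s20 s21 e0.
  exists N => n Nn; rewrite subr0 cmodC; apply: le_lt_trans (key n) _.
  apply: le_lt_trans (HN n Nn).
  have h := natmul_geom_le n s0 s1.
  have h' : n%:R * s ^+ n <= (1 - s)^-1.
    by apply: le_trans h; rewrite ler_wpM2r ?exprn_ge0 // ler_nat.
  have h0 : 0 <= n%:R * s ^+ n by rewrite mulr_ge0 ?exprn_ge0.
  have h2 : (n%:R * s ^+ n) ^+ 2 <= ((1 - s)^-1) ^+ 2.
    by rewrite lerXn2r ?nnegrE // invr_ge0 subr_ge0 ltW.
  rewrite [leLHS](_ : _ = 2 * B ^+ 2 * (n%:R * s ^+ n) ^+ 2 * (s ^+ 2) ^+ n).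
    by rewrite ler_wpM2r ?exprn_ge0 // ler_wpM2l // mulr_ge0 ?sqr_ge0.
  rewrite natrD -!exprM !exprMn -!exprM [(2 * n)%N]mulnC [(4 * n)%N]mulnC.
  rewrite -[4%N]/(2 + 2)%N mulnDr exprD; ring.
have := ccvgD lim0 (ccvgM (af _ zD) (bg _ zD)); rewrite add0r.
by apply: ccvg_ext => n; rewrite subrK.
Qed.

End Taylor.

(** * A maximum principle and second order jets *)

Section MaximumPrinciple.
Variable R : realType.
Local Notation C := R[i].
Implicit Types (z w h : C) (t : R).

Local Notation I := (Complex (0 : R) 1).

Lemma cmod_cts (z : C) (e : R) : 0 < e -> exists2 d : R, 0 < d &
  forall p : R * R, ball (complex.Re z, complex.Im z) d p -> cmod (Complex p.1 p.2 - z) < e.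
Proof.
move=> e0; exists (e / 2); first by rewrite divr_gt0.
move=> [x y] [/= bx by_]; apply: le_lt_trans (cmod_le_ReIm _) _.
rewrite Re_add Im_add Re_opp Im_opp /= [e]splitr.
by apply: ltrD; rewrite distrC; [exact: bx|exact: by_].
Qed.

Lemma closed_disc_compact : compact [set p : R * R | cmod (Complex p.1 p.2) <= 1].
Proof.
have cK : compact ((`[-1, 1]%classic : set R) `*` (`[-1, 1]%classic : set R)).
  by apply: compact_setX; exact: segment_compact.
apply: (subclosed_compact _ cK).
- rewrite (_ : [set p | _] = (fun p : R * R => cmod (Complex p.1 p.2)) @^-1` [set x | x <= 1]) //.
  apply: preimage_closed; last exact: closed_le.
  move=> p _; apply/cvgrPdist_lt => e e0.
  have [d d0 Hd] := @cmod_cts (Complex p.1 p.2) e e0.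
  apply: filterS (nbhsx_ballx p d d0) => q pq.
  rewrite distrC; apply: le_lt_trans (ler_dist_cmod _ _) _; apply: Hd.
  by move: pq; case: (p).
- move=> [x y] /= h; rewrite /= !in_itv /= -!ler_norml; split.
    exact: le_trans (cmod_Re (Complex x y)) h.
  exact: le_trans (cmod_Im (Complex x y)) h.
Qed.

Definition cont_closed_disc (Phi : C -> R) : Prop :=
  forall z, cmod z <= 1 -> forall e : R, 0 < e -> exists2 d : R, 0 < d &
    forall w, cmod w <= 1 -> cmod (w - z) < d -> `|Phi w - Phi z| < e.

Definition four_sum (V : zmodType) (f : C -> V) z t : V :=
  (f (z + real_complex R t) + f (z - real_complex R t)) +
  (f (z + I * real_complex R t) + f (z - I * real_complex R t)).

(** Subharmonicity in discrete form: the four-point sum is [4 * Phi z] plus [t ^+ 2] times the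
    Laplacian plus a cubic error, so a nonnegative Laplacian yields this inequality. *)
Definition sub_mean (Phi : C -> R) z : Prop := exists K d : R, 0 < d /\
  forall t, 0 < t -> t < d -> 4 * Phi z - K * t ^+ 3 <= four_sum Phi z t.

Lemma sqr_cmodD_four z t : four_sum (fun w => cmod w ^+ 2) z t = 4 * cmod z ^+ 2 + 4 * t ^+ 2.
Proof.
rewrite /four_sum !sqr_cmod !(Re_add, Im_add, Re_opp, Im_opp, Re_mul, Im_mul) /=.
by ring.
Qed.

(** If [Phi z1 = eta > 0], adding [eta / 2 * cmod z ^+ 2] keeps the boundary values below [eta], so
    the maximum is interior; it also adds [2 * eta * t ^+ 2] to the four-point sum there, which
    beats the cubic error. *)
Lemma maximum_principle (Phi : C -> R) : cont_closed_disc Phi ->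
  (forall z, cmod z < 1 -> sub_mean Phi z) -> (forall z, cmod z = 1 -> Phi z <= 0) ->
  forall z, cmod z < 1 -> Phi z <= 0.
Proof.
move=> Pc Ps Pb z1 z1D; rewrite leNgt; apply/negP => eta0.
set eta := Phi z1 in eta0.
pose A := [set p : R * R | cmod (Complex p.1 p.2) <= 1].
pose Psi (p : R * R) : R := Phi (Complex p.1 p.2) + eta / 2 * cmod (Complex p.1 p.2) ^+ 2.
have A0 : A !=set0 by exists (complex.Re z1, complex.Im z1); rewrite /A /=; case: (z1) z1D => x y /= /ltW.
have Psc : {within A, continuous Psi}.
  apply/subspace_continuousP => p pA; apply/cvgrPdist_lt => e e0.
  have e20 : 0 < e / 2 by rewrite divr_gt0.
  have e3 : 0 < e / (2 * eta) by rewrite divr_gt0 // mulr_gt0.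
  have [d d0 Hd] := Pc _ pA _ e20.
  have m0 : 0 < Num.min d (e / (2 * eta)) by rewrite lt_min d0.
  have [d' d'0 Hd'] := @cmod_cts (Complex p.1 p.2) _ m0.
  rewrite /within /=; apply: filterS (nbhsx_ballx p d' d'0) => q pq qA.
  have : cmod (Complex q.1 q.2 - Complex p.1 p.2) < Num.min d (e / (2 * eta)).
    by apply: Hd'; move: pq; case: (p).
  rewrite lt_min => /andP[qd qe]; rewrite distrC.
  have := Hd _ qA qd; rewrite /Psi /from_subspace /=; set P1 := Phi _; set P2 := Phi _.
  set c1 := cmod _ in qA *; set c2 := cmod _ in pA * => h.
  have -> : P1 + eta / 2 * c1 ^+ 2 - (P2 + eta / 2 * c2 ^+ 2) =
    (P1 - P2) + eta / 2 * ((c1 - c2) * (c1 + c2)) by ring.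
  apply: le_lt_trans (ler_normD _ _) _; rewrite [e]splitr; apply: ltr_leD => //.
  rewrite normrM gtr0_norm ?divr_gt0 // normrM (@ger0_norm _ (c1 + c2)) ?addr_ge0 ?cmod_ge0 //.
  have dc : `|c1 - c2| <= e / (2 * eta) by exact: le_trans (ler_dist_cmod _ _) (ltW qe).
  have c2b : c1 + c2 <= 2 by exact: lerD qA pA.
  apply: (@le_trans _ _ (eta / 2 * (e / (2 * eta) * 2))).
    rewrite ler_wpM2l ?divr_ge0 ?(ltW eta0) //.
    by apply: ler_pM; rewrite ?addr_ge0 ?cmod_ge0.
  by rewrite le_eqVlt; apply/orP; left; apply/eqP; field; exact: lt0r_neq0.
have [p /set_mem pA pM] := compact_EVT_max A0 closed_disc_compact Psc.
set z := Complex p.1 p.2 in pA.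
have zM w : cmod w <= 1 -> Phi w + eta / 2 * cmod w ^+ 2 <= Phi z + eta / 2 * cmod z ^+ 2.
  move=> w1; have := pM (complex.Re w, complex.Im w); rewrite /Psi /=.
  by case: w w1 => x y /= w1; apply; rewrite inE.
have zD : cmod z < 1.
  rewrite lt_neqAle pA andbT; apply/eqP => z1'.
  have := zM _ (ltW z1D); rewrite z1' expr1n -/eta.
  have := Pb _ z1'; have := sqr_ge0 (cmod z1); nra.
have [K [d [d0 Hd]]] := Ps _ zD.
(* Small enough for the sub-mean inequality to apply, for the four points to stay in the closed
   disc, and for the cubic error to be at most [eta * t ^+ 2]. *)
pose t := Num.min (d / 2) (Num.min ((1 - cmod z) / 2) (eta / (`|K| + 1))).
have K0 : 0 < `|K| + 1 by rewrite ltr_wpDl.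
have t0 : 0 < t by rewrite !lt_min !divr_gt0 ?subr_gt0.
have td : t < d by rewrite !gt_min; apply/orP; left; lra.
have tz : t < 1 - cmod z by rewrite !gt_min; apply/orP; right; apply/orP; left; lra.
have tK : t * (`|K| + 1) <= eta.
  by rewrite -ler_pdivlMr // !ge_min lexx !orbT.
have inD (h : C) : cmod h = t -> cmod (z + h) <= 1.
  by move=> ht; apply: le_trans (cmodD _ _) _; rewrite ht; lra.
have ct : cmod (real_complex R t) = t by rewrite cmod_real gtr0_norm.
have cI : cmod I = 1 by rewrite /cmod /= expr0n expr1n add0r sqrtr1.
have := Hd _ t0 td; have := sqr_cmodD_four z t; rewrite /four_sum.
have := zM _ (inD _ ct).
have := zM _ (inD (- real_complex R t) (ltac:(by rewrite cmodN))).
have := zM _ (inD (I * real_complex R t) (ltac:(by rewrite cmodM cI mul1r))).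
have := zM _ (inD (- (I * real_complex R t)) (ltac:(by rewrite cmodN cmodM cI mul1r))).
set P1 := Phi _; set P2 := Phi (z + I * _); set P3 := Phi (z - real_complex R t).
set P4 := Phi (z + real_complex R t); set P0 := Phi z.
set c1 := cmod _ ^+ 2; set c2 := cmod (z + I * _) ^+ 2; set c3 := cmod (z - real_complex R t) ^+ 2.
set c4 := cmod (z + real_complex R t) ^+ 2; set c0 := cmod z ^+ 2.
move=> h1 h2 h3 h4 h5 h6.
have h7 : 2 * eta * t ^+ 2 <= K * t ^+ 3.
  have E : eta / 2 * (c4 + c3 + (c2 + c1)) = eta / 2 * (4 * c0 + 4 * t ^+ 2) by rewrite h5.
  clear - h1 h2 h3 h4 h6 E; lra.
have t20 : 0 < t ^+ 2 by rewrite exprn_gt0.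
have h8 : K * t ^+ 3 <= eta * t ^+ 2.
  rewrite exprSr [t ^+ 2 * t]mulrC mulrA ler_wpM2r ?(ltW t20) //.
  apply: le_trans tK; rewrite mulrC ler_wpM2l ?(ltW t0) //.
  by apply: le_trans (ler_norm _) _; rewrite lerDl.
have := mulr_gt0 eta0 t20; clear - h7 h8; lra.
Qed.

End MaximumPrinciple.

(** * Second order jets in [h] and its conjugate *)

Section Jets.
Variable R : realType.
Local Notation C := R[i].
Local Notation I := (Complex (0 : R) 1).
Implicit Types (f g r : C -> C) (h z a b c m e : C).

(** The bound [d <= 1] lets a higher order be weakened to a lower one with the same constants. *)
Definition bigOh (k : nat) r : Prop := exists K d : R,
  [/\ 0 <= K, 0 < d, d <= 1 & forall h, cmod h < d -> cmod (r h) <= K * cmod h ^+ k].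

Lemma bigOh_ext k r s : (forall h, r h = s h) -> bigOh k r -> bigOh k s.
Proof. by move=> rs [K [d [K0 d0 d1 H]]]; exists K, d; split=> // h /H; rewrite rs. Qed.

Lemma bigOhD k r s : bigOh k r -> bigOh k s -> bigOh k (fun h => r h + s h).
Proof.
move=> [K [d [K0 d0 d1 H]]] [K' [d' [K0' d0' d1' H']]].
exists (K + K'), (Num.min d d'); split; first exact: addr_ge0.
- by rewrite lt_min d0.
- by rewrite ge_min d1.
- move=> h; rewrite lt_min => /andP[/H h1 /H' h2].
  by rewrite mulrDl (le_trans (cmodD _ _)) // lerD.
Qed.

Lemma bigOhM j k r s : bigOh j r -> bigOh k s -> bigOh (j + k) (fun h => r h * s h).
Proof.
move=> [K [d [K0 d0 d1 H]]] [K' [d' [K0' d0' d1' H']]].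
exists (K * K'), (Num.min d d'); split; first exact: mulr_ge0.
- by rewrite lt_min d0.
- by rewrite ge_min d1.
- move=> h; rewrite lt_min => /andP[/H h1 /H' h2].
  by rewrite cmodM exprD mulrACA; apply: ler_pM; rewrite ?cmod_ge0.
Qed.

Lemma bigOhW j k r : (k <= j)%N -> bigOh j r -> bigOh k r.
Proof.
move=> kj [K [d [K0 d0 d1 H]]]; exists K, d; split=> // h hd.
apply: le_trans (H _ hd) _; rewrite ler_wpM2l // ler_wiXn2l ?cmod_ge0 //.
exact: ltW (lt_le_trans hd d1).
Qed.

Lemma bigOh_cst c : bigOh 0 (fun=> c).
Proof. by exists (cmod c), 1; split=> // [|h _]; rewrite ?cmod_ge0 ?expr0 ?mulr1. Qed.

Lemma bigOhZ k c r : bigOh k r -> bigOh k (fun h => c * r h).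
Proof. exact: (@bigOhM 0 k _ _ (bigOh_cst c)). Qed.

Lemma bigOh_id : bigOh 1 (fun h => h).
Proof. by exists 1, 1; split=> // h _; rewrite expr1 mul1r. Qed.

Lemma bigOh_conjc : bigOh 1 (fun h => conjc h).
Proof. by exists 1, 1; split=> // h _; rewrite expr1 mul1r cmod_conj. Qed.

Lemma bigOh_conj k r : bigOh k r -> bigOh k (fun h => conjc (r h)).
Proof. by move=> [K [d [K0 d0 d1 H]]]; exists K, d; split=> // h /H; rewrite cmod_conj. Qed.

Lemma bigOh0 k : bigOh k (fun=> 0).
Proof. by exists 0, 1; split=> // h _; rewrite cmod0 mul0r. Qed.

Definition lin a b h : C := a * h + b * conjc h.
Definition quad e m e' h : C := e * (h * h) + m * (h * conjc h) + e' * (conjc h * conjc h).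

Lemma bigOh_lin a b : bigOh 1 (lin a b).
Proof. exact: bigOhD (bigOhZ _ bigOh_id) (bigOhZ _ bigOh_conjc). Qed.

Lemma bigOh_quad e m e' : bigOh 2 (quad e m e').
Proof.
apply: bigOhD; last exact: bigOhZ (bigOhM bigOh_conjc bigOh_conjc).
exact: bigOhD (bigOhZ _ (bigOhM bigOh_id bigOh_id)) (bigOhZ _ (bigOhM bigOh_id bigOh_conjc)).
Qed.

(* The second order part of [f] at [z] in the variables [h] and [conjc h]; only
   the mixed coefficient [m] is tracked, since [4 * m] is the Laplacian. *)
Definition jet f z c a b m : Prop := exists e e',
  bigOh 3 (fun h => f (z + h) - (c + lin a b h + quad e m e' h)).

Lemma jet_ext f g z c a b m : (forall w, f w = g w) -> jet f z c a b m -> jet g z c a b m.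
Proof.
move=> fg [e [e' H]]; exists e, e'; apply: bigOh_ext H => h.
by rewrite fg.
Qed.

Lemma jet_cst k z : jet (fun=> k) z k 0 0 0.
Proof.
exists 0, 0; apply: bigOh_ext (bigOh0 3) => h.
by rewrite /lin /quad; ring.
Qed.

Lemma jet_id z : jet (fun w => w) z z 1 0 0.
Proof.
exists 0, 0; apply: bigOh_ext (bigOh0 3) => h.
by rewrite /lin /quad; ring.
Qed.

Lemma jetD f g z c a b m c' a' b' m' : jet f z c a b m -> jet g z c' a' b' m' ->
  jet (fun w => f w + g w) z (c + c') (a + a') (b + b') (m + m').
Proof.
move=> [e1 [e2 H]] [e3 [e4 H']]; exists (e1 + e3), (e2 + e4).
by apply: bigOh_ext (bigOhD H H') => h; rewrite /lin /quad; ring.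
Qed.

Lemma jet_conj f z c a b m : jet f z c a b m ->
  jet (fun w => conjc (f w)) z (conjc c) (conjc b) (conjc a) (conjc m).
Proof.
move=> [e1 [e2 H]]; exists (conjc e2), (conjc e1).
apply: bigOh_ext (bigOh_conj H) => h.
by rewrite /lin /quad !(rmorphB, rmorphD, rmorphM) /= !conjcK; ring.
Qed.

Lemma jetM f g z c a b m c' a' b' m' : jet f z c a b m -> jet g z c' a' b' m' ->
  jet (fun w => f w * g w) z (c * c') (c * a' + a * c') (c * b' + b * c')
    (c * m' + m * c' + a * b' + b * a').
Proof.
move=> [e1 [e2 H]] [e3 [e4 H']].
exists (c * e3 + e1 * c' + a * a'), (c * e4 + e2 * c' + b * b').
pose l1 := lin a b; pose q1 := quad e1 m e2; pose l2 := lin a' b'; pose q2 := quad e3 m' e4.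
pose r1 h := f (z + h) - (c + l1 h + q1 h).
pose r2 h := g (z + h) - (c' + l2 h + q2 h).
have L1 : bigOh 1 l1 := bigOh_lin a b; have L2 : bigOh 1 l2 := bigOh_lin a' b'.
have Q1 : bigOh 2 q1 := bigOh_quad _ _ _; have Q2 : bigOh 2 q2 := bigOh_quad _ _ _.
have J1 : bigOh 0 (fun h => c + l1 h + q1 h).
  by apply: bigOhD; [apply: bigOhD; [exact: bigOh_cst|exact: bigOhW L1]|exact: bigOhW Q1].
have J2 : bigOh 0 (fun h => c' + l2 h + q2 h).
  by apply: bigOhD; [apply: bigOhD; [exact: bigOh_cst|exact: bigOhW L2]|exact: bigOhW Q2].
have T1 : bigOh 3 (fun h => r1 h * (c' + l2 h + q2 h)) := bigOhM H J2.
have T2 : bigOh 3 (fun h => (c + l1 h + q1 h) * r2 h) := bigOhM J1 H'.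
have T3 : bigOh 3 (fun h => r1 h * r2 h) by exact: bigOhW (bigOhM H H').
have T4 : bigOh 3 (fun h => l1 h * q2 h) := bigOhM L1 Q2.
have T5 : bigOh 3 (fun h => q1 h * l2 h) := bigOhM Q1 L2.
have T6 : bigOh 3 (fun h => q1 h * q2 h) by exact: bigOhW (bigOhM Q1 Q2).
apply: bigOh_ext (bigOhD (bigOhD (bigOhD T1 T2) T3) (bigOhD (bigOhD T4 T5) T6)) => h.
by rewrite /r1 /r2 /l1 /l2 /q1 /q2 /lin /quad; ring.
Qed.

Lemma jet_sum (T : Type) (s : seq T) (f : T -> C -> C) z (c a b m : T -> C) :
  (forall i, jet (f i) z (c i) (a i) (b i) (m i)) ->
  jet (fun w => \sum_(i <- s) f i w) z (\sum_(i <- s) c i) (\sum_(i <- s) a i)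
    (\sum_(i <- s) b i) (\sum_(i <- s) m i).
Proof.
move=> H; elim: s => [|i s IH].
  rewrite !big_nil; apply: jet_ext (jet_cst 0 z) => w; by rewrite big_nil.
rewrite !big_cons; apply: jet_ext (jetD (H i) IH) => w; by rewrite big_cons.
Qed.

Lemma jet_horner (p : {poly C}) z : jet (horner p) z p.[z] p^`().[z] 0 0.
Proof.
elim/poly_ind: p => [|p k IH].
  by rewrite deriv0 !horner0; apply: jet_ext (jet_cst 0 z) => w; rewrite horner0.
have := jetD (jetM IH (jet_id z)) (jet_cst k z).
rewrite derivD derivM derivX derivC !hornerE.
rewrite [p.[z] + _]addrC.
by apply: jet_ext => w; rewrite !hornerE.
Qed.

(** The proposed jet is the second order expansion of [1 / (c + l1 + q1)]. Its product with [f] is 1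
    up to order 3, and dividing by [f], which is bounded away from 0 near [z], keeps the order. *)
Lemma jet_inv f z c a b m : c != 0 -> jet f z c a b m ->
  jet (fun w => (f w)^-1) z c^-1 (- a / c ^+ 2) (- b / c ^+ 2)
    (- m / c ^+ 2 + 2 * (a * b) / c ^+ 3).
Proof.
move=> c0 [e1 [e2 H]].
exists (- e1 / c ^+ 2 + a * a / c ^+ 3), (- e2 / c ^+ 2 + b * b / c ^+ 3).
set l1 := lin a b; set q1 := quad e1 m e2 in H *.
set l2 := lin _ _; set q2 := quad _ _ _.
have L1 : bigOh 1 l1 := bigOh_lin a b; have Q1 : bigOh 2 q1 := bigOh_quad _ _ _.
have L2 : bigOh 1 l2 := bigOh_lin _ _; have Q2 : bigOh 2 q2 := bigOh_quad _ _ _.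
pose r1 h := f (z + h) - (c + l1 h + q1 h).
have J2 : bigOh 0 (fun h => c^-1 + l2 h + q2 h).
  by apply: bigOhD; [apply: bigOhD; [exact: bigOh_cst|exact: bigOhW L2]|exact: bigOhW Q2].
have P1 : bigOh 1 (fun h => l1 h + q1 h + r1 h).
  by apply: bigOhD; [apply: bigOhD; [exact: L1|exact: bigOhW Q1]|exact: bigOhW H].
have D : bigOh 3 (fun h => 1 - f (z + h) * (c^-1 + l2 h + q2 h)).
  have T1 : bigOh 3 (fun h => -1 * (r1 h * (c^-1 + l2 h + q2 h))) := bigOhZ _ (bigOhM H J2).
  have T4 : bigOh 3 (fun h => -1 * (l1 h * q2 h)) := bigOhZ _ (bigOhM L1 Q2).
  have T5 : bigOh 3 (fun h => -1 * (q1 h * l2 h)) := bigOhZ _ (bigOhM Q1 L2).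
  have T6 : bigOh 3 (fun h => -1 * (q1 h * q2 h)) by apply: bigOhZ; exact: bigOhW (bigOhM Q1 Q2).
  apply: bigOh_ext (bigOhD (bigOhD T1 T4) (bigOhD T5 T6)) => h.
  rewrite /r1 /l1 /l2 /q1 /q2 /lin /quad; field; exact: c0.
have [K [d [K0 d0 d1 HK]]] := P1; have [K' [d' [K0' d0' d1' HK']]] := D.
have cp : 0 < cmod c by rewrite cmod_gt0.
exists (K' * (2 / cmod c)), (Num.min d' (Num.min d (cmod c / (2 * (K + 1))))).
have K1 : 0 < K + 1 by rewrite ltr_wpDl.
split.
- by rewrite mulr_ge0 // divr_ge0 // cmod_ge0.
- by rewrite !lt_min d0' d0 divr_gt0 // mulr_gt0.
- by rewrite ge_min d1'.
move=> h; rewrite !lt_min => /and3P[hd' hd hc].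
have f1 : cmod c / 2 <= cmod (f (z + h)).
  have h1 : cmod (f (z + h) - c) <= cmod c / 2.
    have -> : f (z + h) - c = l1 h + q1 h + r1 h by rewrite /r1; ring.
    apply: le_trans (HK _ hd) _; rewrite expr1.
    apply: (@le_trans _ _ ((K + 1) * cmod h)); first by rewrite ler_wpM2r ?cmod_ge0 // lerDl.
    move: hc; rewrite ltr_pdivlMr ?mulr_gt0 // => hc.
    rewrite ler_pdivlMr // ltW // (le_lt_trans _ hc) // le_eqVlt; apply/orP; left.
    by apply/eqP; ring.
  have := ler_cmodB c (c - f (z + h)); rewrite subKr cmodC in h1 *; lra.
have fn0 : f (z + h) != 0 by rewrite -cmod_gt0; lra.
have -> : (f (z + h))^-1 - (c^-1 + l2 h + q2 h) =
  (1 - f (z + h) * (c^-1 + l2 h + q2 h)) / f (z + h).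
  by rewrite mulrBl mul1r mulrAC divff // mul1r.
rewrite cmod_div mulrAC; apply: ler_pM; rewrite ?cmod_ge0 ?invr_ge0 ?cmod_ge0 //.
  exact: HK'.
rewrite -(invrK (2 / cmod c)) lef_pV2 ?posrE ?cmod_gt0 //.
  by rewrite invfM invrK mulrC.
by rewrite invr_gt0 divr_gt0.
Qed.

(** Over the increments [t], [-t], [i t], [-i t] the linear terms cancel, and so do the squares of
    [h] and of [conjc h], because [i ^+ 2 = -1]; the mixed term survives. *)
Lemma jet_four_sum f z c a b m : jet f z c a b m -> exists K d : R, 0 < d /\
  forall t, 0 < t -> t < d ->
    cmod (four_sum f z t - 4 * c - 4 * m * real_complex R t ^+ 2) <= K * t ^+ 3.
Proof.
move=> [e [e' [K [d [K0 d0 d1 H]]]]]; exists (4 * K), d; split=> // t t0 td.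
have ct : cmod (real_complex R t) = t by rewrite cmod_real gtr0_norm.
have cI : cmod I = 1 by rewrite /cmod /= expr0n expr1n add0r sqrtr1.
have II : I * I = -1 by apply: complex_ext; rewrite ?Re_mul ?Im_mul /=; ring.
have H1 := H (real_complex R t); have H2 := H (- real_complex R t).
have H3 := H (I * real_complex R t); have H4 := H (- (I * real_complex R t)).
rewrite !cmodN !cmodM cI mul1r ct in H1 H2 H3 H4.
move: {H1 H2 H3 H4} (H1 td) (H2 td) (H3 td) (H4 td).
set r1 := (X in cmod X <= _); set r2 := (X in _ -> cmod X <= _ -> _).
set r3 := (X in _ -> _ -> cmod X <= _ -> _); set r4 := (X in _ -> _ -> _ -> cmod X <= _ -> _).
move=> h1 h2 h3 h4.
have -> : four_sum f z t - 4 * c - 4 * m * real_complex R t ^+ 2 = (r1 + r2) + (r3 + r4).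
  rewrite /r1 /r2 /r3 /r4 /four_sum /lin /quad; set T := real_complex R t.
  have C1 : conjc T = T by apply: complex_ext; rewrite /= ?oppr0.
  have C2 : conjc (- T) = - T by apply: complex_ext; rewrite /= ?oppr0.
  have C3 : conjc (I * T) = - (I * T) by apply: complex_ext; rewrite /=; ring.
  have C4 : conjc (- (I * T)) = I * T by apply: complex_ext; rewrite /=; ring.
  rewrite C1 C2 C3 C4.
  have E1 : I * T * (I * T) = - (T * T) by rewrite mulrACA II mulN1r.
  rewrite !(mulrN, mulNr, opprK) !E1; ring.
have := cmodD (r1 + r2) (r3 + r4); have := cmodD r1 r2; have := cmodD r3 r4.
clear - h1 h2 h3 h4; lra.
Qed.

Lemma jet_sub_mean f z c a b m : jet f z c a b m -> 0 <= complex.Re m ->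
  sub_mean (fun w => complex.Re (f w)) z.
Proof.
move=> J m0; have [K [d [d0 H]]] := jet_four_sum J.
have fz : f z = c.
  move: J => [e [e' [K' [d' [_ d0' _ /(_ 0)]]]]].
  rewrite cmod0 expr0n /= mulr0 => /(_ d0').
  rewrite /lin /quad conjc0 !mulr0 !addr0 => h.
  by apply/eqP; rewrite -subr_eq0 -cmod_eq0 eq_le h cmod_ge0.
exists K, d; split=> // t t0 td.
have := H _ t0 td; have := cmod_Re (four_sum f z t - 4 * c - 4 * m * real_complex R t ^+ 2).
rewrite fz ler_norml => /andP[h1 _] h2.
have : complex.Re (four_sum f z t - 4 * c - 4 * m * real_complex R t ^+ 2) =
  four_sum (fun w => complex.Re (f w)) z t - 4 * complex.Re c - 4 * complex.Re m * t ^+ 2.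
  rewrite /four_sum !(Re_add, Re_opp); congr (_ - _ - _).
    by rewrite Re_mul /=; ring.
  by rewrite !expr2 !Re_mul !Im_mul /=; ring.
have := mulr_ge0 m0 (sqr_ge0 t); lra.
Qed.

End Jets.

(** * Lower bound for adjoints of analytic Toeplitz operators *)

Section TripleSums.
Variables (K : comPzRingType) (n : nat).
Implicit Types (u v x y w : 'I_n -> K).

Definition dot u v : K := \sum_(i < n) u i * v i.

Lemma sum_triple x y w :
  \sum_(t : 'I_n * 'I_n * 'I_n) x t.1.1 * y t.1.2 * w t.2 =
  (\sum_i x i) * (\sum_i y i) * (\sum_i w i).
Proof.
rewrite big_distrlr /= [RHS]big_distrl /=.
under [RHS]eq_bigr do rewrite big_distrl /=.
rewrite pair_bigA /=.
under [RHS]eq_bigr do rewrite mulr_sumr.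
by rewrite pair_bigA.
Qed.

Lemma dot_triple (cx cy cw x y w : 'I_n -> K) :
  \sum_(t : 'I_n * 'I_n * 'I_n) (cx t.1.1 * cy t.1.2 * cw t.2) * (x t.1.1 * y t.1.2 * w t.2) =
  dot cx x * dot cy y * dot cw w.
Proof. by rewrite -sum_triple; apply: eq_bigr => t _; ring. Qed.

End TripleSums.

(** * The mixed derivative of the nonanalytic term, estimated at a point *)

Section PointwiseEstimate.
Variables (R : realType) (n : nat).
Local Notation C := R[i].
Variables (f g q0 q1 : 'I_n -> C) (k0 k1 : C) (nu : R).

(* [f], [g], [q0], [q1] stand for the values of F, F', q, q' at a point; [dwedge t] is
   the derivative of F_l (F_j q_i - F_i q_j) there. *)
Definition dwedge (t : 'I_n * 'I_n * 'I_n) : C :=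
  let: (l, j, i) := t in
  g l * (f j * q0 i - f i * q0 j) +
  f l * (g j * q0 i + f j * q1 i - g i * q0 j - f i * q1 j).

Definition cj (u : 'I_n -> C) i := conjc (u i).
Definition nrm2 (u : 'I_n -> C) : R := \sum_(i < n) cmod (u i) ^+ 2.

Lemma nrm2_ge0 u : 0 <= nrm2 u.
Proof. by apply: sumr_ge0 => i _; exact: sqr_ge0. Qed.

Lemma dot_cj u : dot u (cj u) = real_complex R (nrm2 u).
Proof.
rewrite /dot /nrm2 rmorph_sum /=; apply: eq_bigr => i _; exact: mul_conjc.
Qed.

Lemma dotC (u v : 'I_n -> C) : dot u v = dot v u.
Proof. by apply: eq_bigr => i _; rewrite mulrC. Qed.

Lemma cmod_dot u v : cmod (dot u v) ^+ 2 <= nrm2 u * nrm2 v.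
Proof. exact: cauchy_schwarz_cmod. Qed.

Lemma nrm2_cj u : nrm2 (cj u) = nrm2 u.
Proof. by apply: eq_bigr => i _; rewrite cmod_conj. Qed.

Lemma dwedge_sum (cx cy cw : 'I_n -> C) :
  \sum_t (cx t.1.1 * cy t.1.2 * cw t.2) * dwedge t =
  dot cx g * dot cy f * dot cw q0 - dot cx g * dot cy q0 * dot cw f
  + dot cx f * dot cy g * dot cw q0 + dot cx f * dot cy f * dot cw q1
  - dot cx f * dot cy q0 * dot cw g - dot cx f * dot cy q1 * dot cw f.
Proof.
rewrite -!dot_triple -!sumrB -!big_split /=.
rewrite -!sumrN -!big_split /=.
by apply: eq_bigr => -[[l j] i] _ /=; ring.
Qed.

Lemma dwedge_sum_le (cx cy cw : 'I_n -> C) :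
  cmod (\sum_t (cx t.1.1 * cy t.1.2 * cw t.2) * dwedge t) ^+ 2 <=
  (nrm2 cx * nrm2 cy * nrm2 cw) * \sum_t cmod (dwedge t) ^+ 2.
Proof.
apply: le_trans (cauchy_schwarz_cmod _ _ _ _) _.
rewrite ler_wpM2r ?sumr_ge0 // => [t _|]; first exact: sqr_ge0.
rewrite /nrm2 -sum_triple le_eqVlt; apply/orP; left; apply/eqP.
by apply: eq_bigr => t _; rewrite !cmodM !exprMn.
Qed.

(** Write [d] and [dbar] for the two complex derivatives. Then [N] is the value of [|F|^2],
    [al = d N] and [be = d dbar N], while [S0] is the sum of the [q_j conj F_j], with [Sa = d S0],
    [Sb = dbar S0] and [Sm = d dbar S0]. Hence [om = N^2 dbar (S0 / N)] and [Om = d (N om)]. *)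
Let N := nrm2 f.
Let Nc : C := real_complex R N.
Let al := dot g (cj f).
Let be := dot g (cj g).
Let S0 := dot (cj f) q0.
Let Sa := dot (cj f) q1.
Let Sb := dot (cj g) q0.
Let Sm := dot (cj g) q1.
Let T2 := \sum_t cmod (dwedge t) ^+ 2.
Let om := Sb * Nc - conjc al * S0.
Let Om := al * om + Nc * (al * Sb + Nc * Sm - be * S0 - conjc al * Sa).

Hypotheses (nu0 : 0 < nu) (nuN : nu <= N) (N1 : N <= 1).

Let Np : 0 < N. Proof. exact: lt_le_trans nuN. Qed.
Let Nn0 : Nc != 0.
Proof. by rewrite -cmod_gt0 cmod_real gtr0_norm. Qed.
Let T20 : 0 <= T2. Proof. by apply: sumr_ge0 => t _; exact: sqr_ge0. Qed.

Let conj_al : conjc al = dot f (cj g).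
Proof.
rewrite /al /dot rmorph_sum /=; apply: eq_bigr => i _.
by rewrite rmorphM /= conjcK mulrC.
Qed.

(** Contracting [dwedge] with the antianalytic vectors [conj F], [conj F], [conj F'] commutes with
    the analytic derivative and gives exactly [d (N om)]. *)
Lemma Om_le : cmod Om ^+ 2 <= N * N * nrm2 g * T2.
Proof.
have -> : Om = \sum_t (cj f t.1.1 * cj f t.1.2 * cj g t.2) * dwedge t.
  rewrite dwedge_sum (dotC _ g) (dotC _ f) dot_cj -/N -/Nc -/al (dotC (cj g) g) -/be.
  rewrite (dotC (cj g) f) -conj_al -/S0 -/Sa -/Sb -/Sm /Om /om; ring.
by apply: le_trans (dwedge_sum_le _ _ _) _; rewrite !nrm2_cj.
Qed.

(** The additional factor [F_l] in the wedge serves here. Contracting with the component [G] of [F']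
    orthogonal to [F] removes all terms in which [F_l] is not differentiated and leaves
    [nrm2 G * om], a bound for [om] itself and not only for its derivative. *)
Lemma om_le : cmod om ^+ 2 <= N * T2.
Proof.
pose G i := g i - al / Nc * f i.
have Gf : dot (cj G) f = 0.
  have -> : dot (cj G) f = conjc (dot G (cj f)).
    rewrite /dot rmorph_sum /=; apply: eq_bigr => i _.
    by rewrite rmorphM /= conjcK.
  suff -> : dot G (cj f) = 0 by rewrite conjc0.
  have -> : dot G (cj f) = al - al / Nc * dot f (cj f).
    rewrite {1}/al [dot f _]/dot mulr_sumr -sumrB; apply: eq_bigr => i _.
    by rewrite /G mulrBl mulrA.
  by rewrite dot_cj -/N -/Nc divfK // subrr.
have Gg : dot (cj G) g = real_complex R (nrm2 G).
  rewrite -dot_cj dotC -[LHS]addr0 -[0 in LHS](mulr0 (- (al / Nc))) -Gf /dot.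
  rewrite mulr_sumr -big_split; apply: eq_bigr => i _ /=.
  have -> : G i = g i - al / Nc * f i by [].
  by ring.
have Gq : om = Nc * dot (cj G) q0.
  have -> : dot (cj G) q0 = Sb - conjc al / Nc * S0.
    rewrite /Sb /S0 /dot mulr_sumr -sumrB; apply: eq_bigr => i _.
    have cq : conjc (al / Nc) = conjc al / Nc.
      have cNi : conjc (Nc^-1) = Nc^-1.
        by rewrite conjc_inv; congr (_^-1); apply: complex_ext; rewrite /= ?oppr0.
      by rewrite rmorphM; congr (_ * _); exact: cNi.
    have -> : cj G i = cj g i - conjc al / Nc * cj f i.
      by rewrite /cj /G rmorphB; congr (_ - _); rewrite rmorphM; congr (_ * _); exact: cq.
    by ring.
  rewrite /om; field; exact: Nn0.
have key : real_complex R (nrm2 G) * om =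
    \sum_t (cj G t.1.1 * cj f t.1.2 * cj G t.2) * dwedge t.
  rewrite dwedge_sum Gf Gg Gq (dotC (cj f) f) dot_cj -/N -/Nc; ring.
have := dwedge_sum_le (cj G) (cj f) (cj G).
rewrite -key cmodM cmod_real ger0_norm ?nrm2_ge0 // !nrm2_cj -/N -/T2 exprMn.
have [G0 _|Gn0] := eqVneq (nrm2 G) 0.
  have -> : om = 0.
    rewrite Gq /dot big1 ?mulr0 // => i _.
    have : cmod (G i) ^+ 2 == 0.
      by move/eqP: G0; rewrite psumr_eq0 => [/allP/(_ i)|j _]; [apply; rewrite mem_index_enum|exact: sqr_ge0].
    by rewrite sqrf_eq0 cmod_eq0 => /eqP; rewrite /cj => ->; rewrite conjc0 mul0r.
  by rewrite cmod0 expr0n /= mulr_ge0 // ltW.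
have Gp : 0 < nrm2 G by rewrite lt_neqAle eq_sym Gn0 nrm2_ge0.
rewrite [X in _ <= X](_ : _ = nrm2 G ^+ 2 * (N * T2)); last by ring.
by rewrite ler_pM2l // exprn_gt0.
Qed.

(** The mixed derivative of [k * S0 / N], in the unsimplified shape that the jet calculus
    produces. *)
Definition mixed_coef : C :=
  k1 * (Sb * Nc^-1 + S0 * (- conjc al / Nc ^+ 2)) +
  k0 * (S0 * (- be / Nc ^+ 2 + 2 * (al * conjc al) / Nc ^+ 3) + Sm * Nc^-1 +
        Sa * (- conjc al / Nc ^+ 2) + Sb * (- al / Nc ^+ 2)).

(** A quarter of the Laplacian of [|k|^2 + sum |k F_j|^2]. *)
Definition weight2 : R := cmod k1 ^+ 2 + \sum_(i < n) cmod (k1 * f i + k0 * g i) ^+ 2.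

(** The three summands of [ME] contribute [1 + 3/2 + 3 * 3/2 = 7] to the factor of [s t / nu^2];
    then [7 s x <= 100 x^2 + s^2 / 8], because [49 / 400 < 1 / 8]. *)
Lemma mixed_coef_le :
  cmod mixed_coef <= 100 / nu ^+ 4 * T2 + 1 / 8 * weight2.
Proof.
have ME : mixed_coef = k1 * (om / Nc ^+ 2) + k0 * (Om / Nc ^+ 3) - 3 * (k0 * (om * al / Nc ^+ 3)).
  by rewrite /mixed_coef /Om /om; field; exact: Nn0.
pose t := Num.sqrt T2; pose b := Num.sqrt (nrm2 g); pose s := Num.sqrt weight2.
have w0 : 0 <= weight2.
  by rewrite addr_ge0 ?sqr_ge0 // sumr_ge0 // => i _; exact: sqr_ge0.
have t2 : t ^+ 2 = T2 by rewrite sqr_sqrtr.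
have b2 : b ^+ 2 = nrm2 g by rewrite sqr_sqrtr // nrm2_ge0.
have s2 : s ^+ 2 = weight2 by rewrite sqr_sqrtr.
have t0 : 0 <= t by exact: sqrtr_ge0.
have b0 : 0 <= b by exact: sqrtr_ge0.
have s0 : 0 <= s by exact: sqrtr_ge0.
pose r := Num.sqrt N; have r2 : r ^+ 2 = N by rewrite sqr_sqrtr // ltW.
have r0 : 0 < r by rewrite sqrtr_gt0.
have omb : cmod om <= r * t.
  rewrite -(ler_pXn2r (n := 2)) ?nnegrE ?cmod_ge0 ?mulr_ge0 ?(ltW r0) //.
  by rewrite exprMn r2 t2 om_le.
have Omb : cmod Om <= N * b * t.
  rewrite -(ler_pXn2r (n := 2)) ?nnegrE ?cmod_ge0 ?mulr_ge0 ?(ltW Np) //.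
  by rewrite !exprMn b2 t2 expr2; exact: Om_le.
have alb : cmod al <= b * r.
  rewrite -(ler_pXn2r (n := 2)) ?nnegrE ?cmod_ge0 ?mulr_ge0 ?(ltW r0) //.
  by rewrite exprMn b2 r2 (le_trans (cmod_dot _ _)) // nrm2_cj.
have k1s : cmod k1 <= s.
  rewrite -(ler_pXn2r (n := 2)) ?nnegrE ?cmod_ge0 // s2 lerDl sumr_ge0 // => i _.
  exact: sqr_ge0.
(* From [k F' = (k F)' - k' F]: this is why [weight2] contains the products [k F_j]. The squared
   constant 2 is rounded up to [9 / 4]. *)
have k0b : cmod k0 * b <= 3 / 2 * s.
  rewrite -(ler_pXn2r (n := 2)) ?nnegrE ?mulr_ge0 ?cmod_ge0 // !exprMn b2 s2.
  apply: (@le_trans _ _ (2 * weight2)); last by move: weight2 w0 => W W0; lra.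
  rewrite /nrm2 mulr_sumr.
  apply: (@le_trans _ _ (\sum_(i < n) (2 * cmod (k1 * f i + k0 * g i) ^+ 2 + 2 * (cmod k1 ^+ 2 * cmod (f i) ^+ 2)))).
    apply: ler_sum => i _; rewrite -exprMn -cmodM.
    rewrite [X in cmod X ^+ 2 <= _](_ : _ = (k1 * f i + k0 * g i) + (- (k1 * f i))); last by ring.
    by apply: le_trans (sqr_cmodD_le _ _) _; rewrite cmodN cmodM exprMn.
  rewrite big_split /= -!mulr_sumr -/(nrm2 f) -/N /weight2 mulrDr addrC lerD2r.
  by rewrite ler_wpM2l // ler_piMr ?sqr_ge0.
have nuN2 : (N ^+ 2)^-1 <= (nu ^+ 2)^-1.
  by rewrite lef_pV2 ?posrE ?exprn_gt0 // lerXn2r ?nnegrE ?(ltW nu0) ?(ltW Np).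
have cN m : cmod (Nc ^+ m) = N ^+ m by rewrite cmodX cmod_real gtr0_norm.
have i2 : 0 <= (N ^+ 2)^-1 by rewrite invr_ge0 exprn_ge0 // ltW.
have i2' : 0 <= (nu ^+ 2)^-1 by rewrite invr_ge0 exprn_ge0 // ltW.
have st0 : 0 <= s * t by exact: mulr_ge0.
have r1 : r <= 1 by rewrite -sqrtr1 ler_wsqrtr.
have p1 : cmod (k1 * (om / Nc ^+ 2)) <= s * t / nu ^+ 2.
  rewrite cmodM cmod_div cN mulrA; apply: ler_pM; rewrite ?mulr_ge0 ?cmod_ge0 //.
  apply: ler_pM; rewrite ?cmod_ge0 //; apply: le_trans omb _.
  by rewrite ler_piMl.
have p2 : cmod (k0 * (Om / Nc ^+ 3)) <= 3 / 2 * (s * t) / nu ^+ 2.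
  rewrite cmodM cmod_div cN.
  apply: (@le_trans _ _ (cmod k0 * (N * b * t / N ^+ 3))).
    by rewrite ler_wpM2l ?cmod_ge0 // ler_wpM2r // invr_ge0 exprn_ge0 // ltW.
  have -> : cmod k0 * (N * b * t / N ^+ 3) = (cmod k0 * b * t) / N ^+ 2.
    by field; exact: lt0r_neq0.
  apply: ler_pM; rewrite ?mulr_ge0 ?cmod_ge0 // mulrA.
  by rewrite ler_wpM2r.
have p3 : cmod (k0 * (om * al / Nc ^+ 3)) <= 3 / 2 * (s * t) / nu ^+ 2.
  rewrite !cmodM cmodV cN.
  apply: (@le_trans _ _ (cmod k0 * ((r * t) * (b * r) / N ^+ 3))).
    rewrite ler_wpM2l ?cmod_ge0 // ler_wpM2r ?invr_ge0 ?exprn_ge0 ?(ltW Np) //.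
    by apply: ler_pM; rewrite ?cmod_ge0.
  have -> : cmod k0 * (r * t * (b * r) / N ^+ 3) = (cmod k0 * b * t) / N ^+ 2.
    by rewrite -r2; field; exact: lt0r_neq0.
  apply: ler_pM; rewrite ?mulr_ge0 ?cmod_ge0 // mulrA.
  by rewrite ler_wpM2r.
have tot : cmod mixed_coef <= 7 * (s * t) / nu ^+ 2.
  rewrite ME; apply: le_trans (cmodB _ _) _.
  rewrite (cmodM 3) cmod_nat.
  have := cmodD (k1 * (om / Nc ^+ 2)) (k0 * (Om / Nc ^+ 3)).
  move: p1 p2 p3; lra.
apply: le_trans tot _.
have -> : 100 / nu ^+ 4 * T2 + 1 / 8 * weight2 = 100 * (t / nu ^+ 2) ^+ 2 + 1 / 8 * s ^+ 2.
  rewrite -t2 s2; field; exact: lt0r_neq0.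
have -> : 7 * (s * t) / nu ^+ 2 = 7 * (s * (t / nu ^+ 2)) by ring.
have := sqr_ge0 (10 * (t / nu ^+ 2) - 7 / 20 * s); have := sqr_ge0 s.
move: (t / nu ^+ 2) => x; nra.
Qed.

End PointwiseEstimate.

(** * Jets of products of polynomials with conjugate polynomials *)

Section JetProducts.
Variable R : realType.
Local Notation C := R[i].
Implicit Types (P Q : {poly C}) (f : C -> C) (z c a b m : C).

Lemma jet_horner_conj P Q z : jet (fun w => P.[w] * conjc Q.[w]) z
  (P.[z] * conjc Q.[z]) (P^`().[z] * conjc Q.[z]) (P.[z] * conjc Q^`().[z])
  (P^`().[z] * conjc Q^`().[z]).
Proof.
have := jetM (jet_horner P z) (jet_conj (jet_horner Q z)).
by rewrite conjc0 !(mulr0, mul0r, addr0, add0r).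
Qed.

Lemma jetZ k f z c a b m : jet f z c a b m ->
  jet (fun w => k * f w) z (k * c) (k * a) (k * b) (k * m).
Proof. by move=> /(jetM (jet_cst k z)); rewrite !(mul0r, addr0). Qed.

Lemma jet_cont f z c a b m : jet f z c a b m -> forall e : R, 0 < e ->
  exists2 d : R, 0 < d & forall w, cmod (w - z) < d -> cmod (f w - f z) < e.
Proof.
move=> [e1 [e2 H]] e e0.
have fz : f z = c.
  move: H => [K' [d' [_ d0' _ /(_ 0)]]].
  rewrite cmod0 expr0n /= mulr0 => /(_ d0').
  rewrite /lin /quad conjc0 !mulr0 !addr0 => h.
  by apply/eqP; rewrite -subr_eq0 -cmod_eq0 eq_le h cmod_ge0.
have : bigOh 1 (fun h => f (z + h) - c).
  have T1 := bigOhD (bigOhW (ltac:(exact: isT) : (1 <= 3)%N) H) (bigOh_lin a b).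
  have T2 := bigOhD T1 (bigOhW (ltac:(exact: isT) : (1 <= 2)%N) (bigOh_quad e1 m e2)).
  by apply: bigOh_ext T2 => h; ring.
move=> [K [d [K0 d0 d1 HK]]].
have K1 : 0 < K + 1 by rewrite ltr_wpDl.
exists (Num.min d (e / (K + 1))); first by rewrite lt_min d0 divr_gt0.
move=> w; rewrite lt_min => /andP[wd we]; have := HK _ wd; rewrite subrKC fz expr1.
move=> h; apply: le_lt_trans h _.
apply: (@le_lt_trans _ _ ((K + 1) * cmod (w - z))); first by rewrite ler_wpM2r ?cmod_ge0 // lerDl.
by rewrite mulrC -ltr_pdivlMr.
Qed.

End JetProducts.

(** * The auxiliary subharmonic function *)

Section ToeplitzBound.
Variables (R : realType) (n : nat).
Local Notation C := R[i].
Variables (F q p : 'I_n -> {poly C}) (k V : {poly C}) (nu : R).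
Hypothesis nu0 : 0 < nu.
Hypothesis FN : forall z : C, cmod z <= 1 -> nu <= \sum_(j < n) cmod (F j).[z] ^+ 2 <= 1.
Hypothesis Fk : forall (z : C) j, cmod z = 1 ->
  (F j).[z] * conjc k.[z] = (q j).[z] + conjc (p j).[z].
Hypothesis q0 : forall j, (q j).[0] = 0.
Hypothesis VT : forall z : C, cmod z = 1 -> complex.Re V.[z] =
  401 / nu ^+ 4 * \sum_(j < n) cmod (p j).[z] ^+ 2 - 1 / 2 * cmod k.[z] ^+ 2.

Let A : R := 100 / nu ^+ 4.
Let B : R := 1 / 8.

Definition wedge (t : 'I_n * 'I_n * 'I_n) : {poly C} :=
  let: (l, j, i) := t in F l * (F j * q i - F i * q j).

Let Nf (w : C) : C := \sum_(j < n) (F j).[w] * conjc (F j).[w].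
Let Sf (w : C) : C := \sum_(j < n) (q j).[w] * conjc (F j).[w].

(** [Sf / Nf] pairs [q] with the smooth solution. [A] and [B] are the constants of [mixed_coef_le],
    so the Laplacians of the two groups of squares dominate that of [k Sf / Nf]; the real part of
    [V] is harmonic, with boundary values that make the total nonpositive on the circle. *)
Definition test_fun (w : C) : C :=
  real_complex R A * (\sum_t (wedge t).[w] * conjc (wedge t).[w]) +
  real_complex R B * (k.[w] * conjc k.[w] + \sum_(j < n) (k * F j).[w] * conjc (k * F j).[w]) +
  (-1) * (k.[w] * (Sf w * (Nf w)^-1)) + (-1) * V.[w].

Let NfE w : Nf w = real_complex R (nrm2 (fun j => (F j).[w])).
Proof. by rewrite -dot_cj. Qed.

Let Nf_neq0 w : cmod w <= 1 -> Nf w != 0.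
Proof.
move=> /FN /andP[nN _]; rewrite NfE -cmod_gt0 cmod_real ger0_norm ?nrm2_ge0 //.
exact: lt_le_trans nN.
Qed.

Lemma wedge_deriv t z : (wedge t)^`().[z] =
  dwedge (fun j => (F j).[z]) (fun j => (F j)^`().[z]) (fun j => (q j).[z])
    (fun j => (q j)^`().[z]) t.
Proof. by case: t => [[l j] i]; rewrite /wedge /dwedge !(derivM, derivB) !hornerE; ring. Qed.

Lemma test_fun_jet z : cmod z <= 1 -> exists c a b m, jet test_fun z c a b m /\ 0 <= complex.Re m.
Proof.
move=> z1.
pose f j := (F j).[z]; pose g j := (F j)^`().[z].
pose x j := (q j).[z]; pose y j := (q j)^`().[z].
have JN := @jet_sum R _ (index_enum 'I_n) (fun j w => (F j).[w] * conjc (F j).[w]) z _ _ _ _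
  (fun j => jet_horner_conj (F j) (F j) z).
have JS := @jet_sum R _ (index_enum 'I_n) (fun j w => (q j).[w] * conjc (F j).[w]) z _ _ _ _
  (fun j => jet_horner_conj (q j) (F j) z).
have JW := @jet_sum R _ (index_enum ('I_n * 'I_n * 'I_n)%type)
  (fun t w => (wedge t).[w] * conjc (wedge t).[w]) z _ _ _ _
  (fun t => jet_horner_conj (wedge t) (wedge t) z).
have JK := @jet_sum R _ (index_enum 'I_n) (fun j w => (k * F j).[w] * conjc (k * F j).[w]) z _ _ _ _
  (fun j => jet_horner_conj (k * F j) (k * F j) z).
have JR := jetM (jet_horner k z) (jetM JS (jet_inv (Nf_neq0 z1) JN)).
have JT := jetD (jetD (jetD (jetZ (real_complex R A) JW)
  (jetZ (real_complex R B) (jetD (jet_horner_conj k k z) JK))) (jetZ (-1) JR))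
  (jetZ (-1) (jet_horner V z)).
do 4 eexists; split; first exact: JT.
have /andP[nN N1] := FN z1.
have := @mixed_coef_le R n f g x y k.[z] k^`().[z] nu nu0 nN N1.
have al_conj : conjc (dot g (cj f)) = \sum_(j < n) (F j).[z] * conjc (F j)^`().[z].
  rewrite /dot rmorph_sum /=; apply: eq_bigr => j _.
  by rewrite rmorphM /= conjcK mulrC.
set W := \sum_t _ in JT *; set M := mixed_coef _ _ _ _ _ _.
move=> Mle; have := le_trans (ler_norm _) (le_trans (cmod_Re M) Mle).
set m := (X in _ -> 0 <= complex.Re X).
have -> : m = real_complex R (A * \sum_t cmod (dwedge f g x y t) ^+ 2 +
    B * weight2 f g k.[z] k^`().[z]) - M.
  rewrite /m !mulN1r oppr0 addr0; congr (_ - _).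
    rewrite rmorphD !rmorphM /=; congr (_ * _ + _ * _).
      rewrite rmorph_sum; apply: eq_bigr => t _.
      by rewrite mul_conjc wedge_deriv.
    rewrite /weight2 rmorphD rmorph_sum /= mul_conjc; congr (_ + _).
    apply: eq_bigr => j _; rewrite mul_conjc; congr (real_complex R (cmod _ ^+ 2)).
    by rewrite derivM !hornerE /f /g; ring.
  rewrite /M /mixed_coef al_conj -/(Nf z) NfE.
  rewrite -[nrm2 f]/(nrm2 (fun j => (F j).[z])).
  have E1 : dot (cj g) x = \sum_(j < n) (q j).[z] * conjc (F j)^`().[z] by rewrite dotC.
  have E2 : dot (cj f) x = \sum_(j < n) (q j).[z] * conjc (F j).[z] by rewrite dotC.
  have E3 : dot (cj f) y = \sum_(j < n) (q j)^`().[z] * conjc (F j).[z] by rewrite dotC.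
  have E4 : dot (cj g) y = \sum_(j < n) (q j)^`().[z] * conjc (F j)^`().[z] by rewrite dotC.
  rewrite E1 E2 E3 E4 -[dot g (cj f)]/(\sum_(j < n) (F j)^`().[z] * conjc (F j).[z]).
  rewrite -[dot g (cj g)]/(\sum_(j < n) (F j)^`().[z] * conjc (F j)^`().[z]).
  by ring.
by move=> h; rewrite Re_add Re_opp /= /A /B; lra.
Qed.

(** On the circle [q_j = F_j conj k - conj p_j]: the terms with [k] cancel in every wedge, leaving
    at most [4 P], and [k Sf / Nf] is [|k|^2] up to [|k|^2 / 4 + P / nu^2]. The balance is
    [400 + 1 = 401] for [P / nu^4] and [1/4 - 3/4 = -1/2] for [|k|^2]. *)
Lemma test_fun_boundary z : cmod z = 1 -> complex.Re (test_fun z) <= 0.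
Proof.
move=> z1; have z1' : cmod z <= 1 by rewrite z1.
have /andP[nN N1] := FN z1'; have Nn0 := Nf_neq0 z1'.
pose f j := (F j).[z]; pose kc := k.[z]; pose P := nrm2 (fun j => (p j).[z]).
have NE : Nf z = real_complex R (nrm2 f) by exact: NfE.
have P0 : 0 <= P by exact: nrm2_ge0.
have Np : 0 < nrm2 f by exact: lt_le_trans nN.
have qE j : (q j).[z] = f j * conjc kc - conjc (p j).[z] by rewrite Fk // addrK.
pose W := \sum_(j < n) conjc (f j) * conjc (p j).[z].
have Wle : cmod W ^+ 2 <= P.
  apply: le_trans (cauchy_schwarz_cmod _ _ _ _) _.
  under eq_bigr do rewrite cmod_conj; under [X in _ * X]eq_bigr do rewrite cmod_conj.
  by rewrite -/(nrm2 f) -[X in _ * X]/P ler_piMl.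
have SE : k.[z] * (Sf z * (Nf z)^-1) = real_complex R (cmod kc ^+ 2) - kc * (W / Nf z).
  have -> : Sf z = Nf z * conjc kc - W.
    rewrite /Sf /Nf /W mulr_suml -sumrB; apply: eq_bigr => j _.
    rewrite qE /f; ring.
  by rewrite -mul_conjc -/kc; field.
have SR : cmod kc ^+ 2 - (cmod kc ^+ 2 / 4 + P / nu ^+ 2) <= complex.Re (k.[z] * (Sf z * (Nf z)^-1)).
  rewrite SE Re_add Re_opp /= lerD2l lerN2.
  apply: le_trans (le_trans (ler_norm _) (cmod_Re _)) _.
  rewrite cmodM cmod_div NE cmod_real gtr0_norm //.
  apply: (@le_trans _ _ (cmod kc * (cmod W / nu))).
    rewrite ler_wpM2l ?cmod_ge0 // ler_wpM2l ?cmod_ge0 //.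
    by rewrite lef_pV2 ?posrE.
  have h : (cmod W / nu) ^+ 2 <= P / nu ^+ 2.
    by rewrite expr_div_n ler_wpM2r // invr_ge0 sqr_ge0.
  have := sqr_ge0 (cmod kc / 2 - cmod W / nu); move: (cmod W / nu) h => y h; nra.
have EW : \sum_t (wedge t).[z] * conjc (wedge t).[z] =
    real_complex R (\sum_t cmod (wedge t).[z] ^+ 2).
  by rewrite rmorph_sum; apply: eq_bigr => t _; exact: mul_conjc.
have Wb : \sum_t cmod (wedge t).[z] ^+ 2 <= 4 * P.
  apply: (@le_trans _ _ (\sum_(t : 'I_n * 'I_n * 'I_n)
     (2 * (cmod (f t.1.1) ^+ 2 * cmod (f t.1.2) ^+ 2 * cmod (p t.2).[z] ^+ 2) +
      2 * (cmod (f t.1.1) ^+ 2 * cmod (p t.1.2).[z] ^+ 2 * cmod (f t.2) ^+ 2)))).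
    apply: ler_sum => -[[l j] i] _ /=; rewrite !(hornerM, hornerD, hornerN) !qE -/(f l) -/(f j) -/(f i).
    have -> : f l * (f j * (f i * conjc kc - conjc (p i).[z]) - f i * (f j * conjc kc - conjc (p j).[z])) =
      f l * f i * conjc (p j).[z] + - (f l * f j * conjc (p i).[z]) by ring.
    apply: le_trans (sqr_cmodD_le _ _) _.
    rewrite cmodN !cmodM !cmod_conj !exprMn [leLHS]addrC; apply: lerD => //.
    by rewrite ler_wpM2l // mulrAC.
  rewrite big_split /= -!mulr_sumr.
  rewrite (sum_triple (fun l => cmod (f l) ^+ 2) (fun l => cmod (f l) ^+ 2) (fun l => cmod (p l).[z] ^+ 2)).
  rewrite (sum_triple (fun l => cmod (f l) ^+ 2) (fun l => cmod (p l).[z] ^+ 2) (fun l => cmod (f l) ^+ 2)).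
  rewrite -/(nrm2 f) -[\sum_(l < n) cmod (p l).[z] ^+ 2]/P.
  rewrite [nrm2 f * P * nrm2 f]mulrAC.
  have NN1 : nrm2 f * nrm2 f <= 1 by rewrite mulr_ile1 // ltW.
  have := ler_wpM2r P0 NN1; lra.
have EK : k.[z] * conjc k.[z] + \sum_(j < n) (k * F j).[z] * conjc (k * F j).[z] =
    real_complex R (cmod kc ^+ 2 + cmod kc ^+ 2 * nrm2 f).
  rewrite rmorphD /= mul_conjc; congr (_ + _).
  rewrite /nrm2 mulr_sumr rmorph_sum /=; apply: eq_bigr => j _.
  by rewrite mul_conjc hornerM cmodM exprMn.
rewrite /test_fun EW EK -!rmorphM !mulN1r !(Re_add, Re_opp) /= (VT z1).
rewrite -[\sum_(j < n) _]/P -/kc.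
have A0 : 0 < A by rewrite divr_gt0 // exprn_gt0.
have h1 := ler_wpM2l (ltW A0) Wb.
have k0 := sqr_ge0 (cmod kc).
have h2 : cmod kc ^+ 2 * nrm2 f <= cmod kc ^+ 2 by rewrite ler_piMr.
have nu1 : nu <= 1 by exact: le_trans nN N1.
have h3 : P / nu ^+ 2 <= P / nu ^+ 4.
  rewrite ler_wpM2l // lef_pV2 ?posrE ?exprn_gt0 //.
  by rewrite ler_wiXn2l // ltW.
have h4 : A * (4 * P) = 400 * (P / nu ^+ 4) by rewrite /A; ring.
have h5 : 401 / nu ^+ 4 * P = 401 * (P / nu ^+ 4) by ring.
rewrite h4 in h1; rewrite h5 /B; lra.
Qed.

(** At 0 the pairing term drops out because every [q j] vanishes there, and the remaining squares
    are nonnegative. *)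
Lemma toeplitz_bound_abstract : 0 <= complex.Re V.[0].
Proof.
have J0 z : cmod z <= 1 -> exists c a b m, jet test_fun z c a b m /\ 0 <= complex.Re m.
  exact: test_fun_jet.
have h : complex.Re (test_fun 0) <= 0.
  apply: (@maximum_principle R (fun w => complex.Re (test_fun w))).
  - move=> z z1 e e0; have [c [a [b [m [J _]]]]] := J0 z z1.
    have [d d0 Hd] := jet_cont J e0; exists d => // w _ wd.
    by rewrite -Re_opp -Re_add (le_lt_trans (cmod_Re _)) // Hd.
  - move=> z z1; have [c [a [b [m [J m0]]]]] := J0 z (ltW z1).
    exact: jet_sub_mean J m0.
  - exact: test_fun_boundary.
  - by rewrite cmod0 ltr01.
move: h; rewrite /test_fun.
have -> : Sf 0 = 0 by rewrite /Sf big1 // => j _; rewrite q0 mul0r.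
rewrite mul0r mulr0 mulr0 addr0 mulN1r !(Re_add, Re_opp).
have E1 : 0 <= complex.Re (real_complex R A * (\sum_t (wedge t).[0] * conjc (wedge t).[0])).
  under eq_bigr do rewrite mul_conjc.
  rewrite -rmorph_sum -rmorphM /= mulr_ge0 ?divr_ge0 ?exprn_ge0 ?(ltW nu0) //.
  by apply: sumr_ge0 => t _; exact: sqr_ge0.
have E2 : 0 <= complex.Re (real_complex R B * (k.[0] * conjc k.[0] +
    \sum_(j < n) (k * F j).[0] * conjc (k * F j).[0])).
  under eq_bigr do rewrite mul_conjc.
  rewrite mul_conjc -rmorph_sum -rmorphD -rmorphM /= mulr_ge0 ?divr_ge0 // addr_ge0 ?sqr_ge0 //.
  by apply: sumr_ge0 => t _; exact: sqr_ge0.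
lra.
Qed.

End ToeplitzBound.

(** * Analytic and antianalytic parts on the circle *)

Section BoundarySplitting.
Variable R : realType.
Local Notation C := R[i].
Implicit Types (X Y : {poly C}) (z : C).
Variable L : nat.

Definition pos_part X Y : {poly C} :=
  \sum_(a < L) \sum_(b < L | (b < a)%N) (X`_a * conjc Y`_b) *: 'X^(a - b).

(** The conjugate of the part of [X * conjc Y] with frequencies at most 0; equivalently, the adjoint
    of the Toeplitz operator with symbol [X], applied to [Y]. *)
Definition neg_part X Y : {poly C} :=
  \sum_(a < L) \sum_(b < L | (a <= b)%N) (conjc X`_a * Y`_b) *: 'X^(b - a).

Lemma mul_conjc_split X Y z : (size X <= L)%N -> (size Y <= L)%N -> cmod z = 1 ->
  X.[z] * conjc Y.[z] = (pos_part X Y).[z] + conjc (neg_part X Y).[z].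
Proof.
move=> sX sY z1; have zz : z * conjc z = 1 by rewrite mul_conjc z1 expr1n.
have zab a b : (b <= a)%N -> z ^+ a * conjc (z ^+ b) = z ^+ (a - b).
  move=> ba; rewrite -{1}(subnK ba) exprD -mulrA rmorphXn /= -exprMn zz expr1n.
  by rewrite mulr1.
rewrite (horner_coef_wide _ sX) (horner_coef_wide _ sY) rmorph_sum /= big_distrlr /=.
rewrite !horner_sum rmorph_sum /= -big_split /=; apply: eq_bigr => a _.
rewrite (bigID (fun b : 'I_L => (b < a)%N)) /= !horner_sum rmorph_sum /=.
congr (_ + _).
  apply: eq_bigr => b ba; rewrite hornerZ hornerXn -zab ?(ltnW ba) // rmorphM /=; ring.
rewrite (eq_bigl (fun b : 'I_L => (a <= b)%N)); last by move=> b; rewrite -leqNgt.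
apply: eq_bigr => b ab; rewrite hornerZ hornerXn -zab //.
rewrite !rmorphM /= !conjcK; ring.
Qed.

Lemma pos_part0 X Y : (pos_part X Y).[0] = 0.
Proof.
rewrite horner_sum big1 // => a _; rewrite horner_sum big1 // => b ba.
by rewrite hornerZ hornerXn expr0n subn_eq0 leqNgt ba mulr0.
Qed.

Lemma coef_neg_part X Y d : (size Y <= L)%N ->
  (neg_part X Y)`_d = \sum_(a < L) conjc X`_a * Y`_(a + d).
Proof.
move=> sY; rewrite coef_sum; apply: eq_bigr => a _; rewrite coef_sum.
under eq_bigr do rewrite coefZ coefXn.
have [adL|Lad] := ltnP (a + d) L.
  rewrite (bigD1 (Ordinal adL)) /= ?leq_addr // addKn eqxx mulr1 big1 ?addr0 //.
  move=> b /andP[ab bd]; case: eqP => [E|]; last by rewrite mulr0.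
  by case/eqP: bd; apply: val_inj; rewrite /= E subnKC.
rewrite big1 => [|b ab]; first by rewrite [Y`__]nth_default ?mulr0 // (leq_trans sY).
case: eqP => [E|]; last by rewrite mulr0.
by move: Lad; rewrite E subnKC // leqNgt ltn_ord.
Qed.

Lemma size_neg_part X Y : (size Y <= L)%N -> (size (neg_part X Y) <= L)%N.
Proof.
move=> sY; apply/leq_sizeP => d Ld; rewrite coef_neg_part // big1 // => a _.
by rewrite [Y`__]nth_default ?mulr0 // (leq_trans sY) // (leq_trans Ld) ?leq_addl.
Qed.

Lemma neg_part0 X : (size X <= L)%N ->
  (neg_part X X).[0] = real_complex R (\sum_(a < L) cmod X`_a ^+ 2).
Proof.
move=> sX; rewrite horner_coef0 coef_neg_part // rmorph_sum /=; apply: eq_bigr => a _.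
by rewrite addn0 mulrC mul_conjc.
Qed.

(* [Re] of this polynomial is the harmonic extension of [|X|^2]. *)
Definition sqr_poly X := pos_part X X + neg_part X X.

Lemma Re_sqr_poly X z : (size X <= L)%N -> cmod z = 1 ->
  complex.Re (sqr_poly X).[z] = cmod X.[z] ^+ 2.
Proof.
move=> sX z1; have := mul_conjc_split sX sX z1; rewrite mul_conjc => /(congr1 (@complex.Re R)).
by rewrite /= hornerD !Re_add Re_conjc.
Qed.

Lemma sqr_poly0 X : (size X <= L)%N ->
  (sqr_poly X).[0] = real_complex R (\sum_(a < L) cmod X`_a ^+ 2).
Proof. by move=> sX; rewrite hornerD pos_part0 add0r neg_part0. Qed.

(** [V] combines the polynomials [sqr_poly], whose values at 0 are sums of squared coefficients, so
    [Re V.[0] >= 0] is the claim divided by 2; hence [802 = 2 * 401]. *)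
Lemma toeplitz_lower_bound n (F : 'I_n -> {poly C}) (nu : R) (k : {poly C}) :
  0 < nu -> (forall z : C, cmod z <= 1 -> nu <= \sum_(j < n) cmod (F j).[z] ^+ 2 <= 1) ->
  (forall j, size (F j) <= L)%N -> (size k <= L)%N ->
  \sum_(a < L) cmod k`_a ^+ 2 <= 802 / nu ^+ 4 *
    \sum_(j < n) \sum_(d < L) cmod (\sum_(a < L) conjc (F j)`_a * k`_(a + d)) ^+ 2.
Proof.
move=> nu0 FN sF sk; pose p j := neg_part (F j) k; pose q j := pos_part (F j) k.
have sp j : (size (p j) <= L)%N by exact: size_neg_part.
pose V : {poly C} := real_complex R (401 / nu ^+ 4) *: (\sum_(j < n) sqr_poly (p j)) +
  real_complex R (- (1 / 2)) *: sqr_poly k.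
have ReV z : complex.Re V.[z] = 401 / nu ^+ 4 * \sum_(j < n) complex.Re (sqr_poly (p j)).[z]
   - 1 / 2 * complex.Re (sqr_poly k).[z].
  rewrite /V hornerD !hornerZ horner_sum Re_add !Re_mul Re_sum /=; ring.
have := @toeplitz_bound_abstract R n F q p k V nu nu0 FN.
have Fk (z : C) j : cmod z = 1 -> (F j).[z] * conjc k.[z] = (q j).[z] + conjc (p j).[z].
  exact: mul_conjc_split.
move=> /(_ Fk (fun j => pos_part0 _ _)); rewrite ReV sqr_poly0 //=.
under eq_bigr do rewrite sqr_poly0 //=.
have -> : \sum_(j < n) \sum_(a < L) cmod (p j)`_a ^+ 2 =
    \sum_(j < n) \sum_(d < L) cmod (\sum_(a < L) conjc (F j)`_a * k`_(a + d)) ^+ 2.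
  by apply: eq_bigr => j _; apply: eq_bigr => d _; rewrite coef_neg_part.
set S := \sum_(j < n) _; set T := \sum_(a < L) _ => H.
have {}H : 0 <= 401 / nu ^+ 4 * S - 1 / 2 * T.
  apply: H => z z1; rewrite ReV Re_sqr_poly //; congr (_ * _ - _).
  by apply: eq_bigr => j _; rewrite Re_sqr_poly.
have -> : 802 / nu ^+ 4 * S = 2 * (401 / nu ^+ 4 * S) by ring.
lra.
Qed.

End BoundarySplitting.

(** * Transfer functions *)

Section Adjoint.
Variable R : realType.
Local Notation C := R[i].

Definition adj m n (A : 'M[C]_(m, n)) : 'M[C]_(n, m) := map_mx conjc A^T.

Lemma adjE m n (A : 'M[C]_(m, n)) i j : adj A i j = conjc (A j i).
Proof. by rewrite !mxE. Qed.

Lemma adj_mul m n p (A : 'M[C]_(m, n)) (B : 'M[C]_(n, p)) :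
  adj (A *m B) = adj B *m adj A.
Proof. by rewrite /adj trmx_mul map_mxM. Qed.

Lemma adjK m n (A : 'M[C]_(m, n)) : adj (adj A) = A.
Proof. by apply/matrixP => i j; rewrite !adjE conjcK. Qed.

Lemma adjD m n (A B : 'M[C]_(m, n)) : adj (A + B) = adj A + adj B.
Proof. by rewrite /adj linearD map_mxD. Qed.

Lemma adjB m n (A B : 'M[C]_(m, n)) : adj (A - B) = adj A - adj B.
Proof. by rewrite /adj linearB map_mxB. Qed.

Lemma adj0 m n : adj (0 : 'M[C]_(m, n)) = 0.
Proof. by rewrite /adj trmx0 map_mx0. Qed.

Lemma adj_sum m n I (r : seq I) (A : I -> 'M[C]_(m, n)) :
  adj (\sum_(i <- r) A i) = \sum_(i <- r) adj (A i).
Proof. exact: (big_morph _ (@adjD m n) (adj0 m n)). Qed.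

Lemma adj_real_scalar n (x : R) :
  adj (real_complex R x)%:M = (real_complex R x)%:M :> 'M[C]_n.
Proof.
by apply/matrixP => i j; rewrite adjE !mxE eq_sym rmorphMn /= oppr0.
Qed.

Lemma adj_row_mx m n p (A : 'M[C]_(m, n)) (B : 'M[C]_(m, p)) :
  adj (row_mx A B) = col_mx (adj A) (adj B).
Proof. by rewrite /adj tr_row_mx map_col_mx. Qed.

Definition rnrm2 n (u : 'rV[C]_n) : R := \sum_(i < n) cmod (u 0 i) ^+ 2.

Lemma rnrm2_ge0 n (u : 'rV[C]_n) : 0 <= rnrm2 u.
Proof. by apply: sumr_ge0 => i _; exact: sqr_ge0. Qed.

Lemma rnrm2E n (u : 'rV[C]_n) : (u *m adj u) 0 0 = real_complex R (rnrm2 u).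
Proof.
rewrite mxE rmorph_sum; apply: eq_bigr => i _.
by rewrite adjE; exact: mul_conjc.
Qed.

Lemma rnrm2_eq0 n (u : 'rV[C]_n) : rnrm2 u = 0 -> u = 0.
Proof.
move/eqP; rewrite psumr_eq0 => [/allP h|i _]; last exact: sqr_ge0.
apply/matrixP => i j; rewrite ord1 mxE.
by have := h j (mem_index_enum _); rewrite sqrf_eq0 cmod_eq0 => /eqP.
Qed.

Lemma rnrm2_row_mx m n (u : 'rV[C]_m) (v : 'rV[C]_n) :
  rnrm2 (row_mx u v) = rnrm2 u + rnrm2 v.
Proof.
rewrite /rnrm2 big_split_ord /=; congr (_ + _); apply: eq_bigr => i _.
  by rewrite row_mxEl.
by rewrite row_mxEr.
Qed.

Lemma rnrm2_mul n m (u : 'rV[C]_n) (A : 'M[C]_(n, m)) :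
  real_complex R (rnrm2 (u *m A)) = (u *m (A *m adj A) *m adj u) 0 0.
Proof. by rewrite -rnrm2E adj_mul !mulmxA. Qed.

(** The square root comes from the spectral theorem; testing positivity on the rows of the
    diagonalising unitary shows that the eigenvalues are nonnegative. *)
Lemma psd_factor n (K : 'M[C]_n) : adj K = K ->
  (forall v : 'rV[C]_n, exists2 r : R, 0 <= r & (v *m K *m adj v) 0 0 = real_complex R r) ->
  exists G : 'M[C]_n, K = G *m adj G.
Proof.
move=> Kh Kp.
have Kn : K \is normalmx.
  by apply/normalmxP; change (K *m adj K = adj K *m K); rewrite Kh.
have KE := elimT (@orthomx_spectralP _ _ K) Kn.
have Pu : spectralmx K \is unitarymx by exact: spectral_unitarymx.
move: KE Pu; move: (spectralmx K) (spectral_diag K) => P d KE Pu.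
have Pi : invmx P = adj P by rewrite invmx_unitary.
have PP : P *m adj P = 1%:M by apply/unitarymxP.
have dp i : exists2 r : R, 0 <= r & d 0 i = real_complex R r.
  have [r r0 rE] := Kp (row i P); exists r => //; rewrite -rE.
  rewrite {1}KE Pi !mulmxA.
  have -> : row i P *m adj P = row i 1%:M by rewrite -row_mul PP.
  have -> : row i 1%:M *m diag_mx d *m P *m adj (row i P) =
    row i 1%:M *m diag_mx d *m adj (row i 1%:M).
    rewrite -mulmxA; congr (_ *m _); apply/matrixP => a b; rewrite !mxE.
    have /matrixP/(_ a i) := PP; rewrite !mxE => E.
    transitivity (\sum_j P a j * conjc (P i j)).
      by apply: eq_bigr => j _; rewrite !mxE.
    rewrite -[RHS]/(conjc (i == a)%:R) conjc_nat eq_sym -E.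
    by apply: eq_bigr => j _; rewrite !mxE.
  rewrite mxE (bigD1 i) //= big1 ?addr0; last first.
    move=> j ji; rewrite adjE !mxE eq_sym (negbTE ji) conjc0 mulr0 //.
  rewrite adjE !mxE eqxx conjc1 mulr1 (bigD1 i) //= big1 ?addr0; last first.
    by move=> j ji; rewrite !mxE eq_sym (negbTE ji) mul0r.
  by rewrite !mxE eqxx mul1r mulr1n.
pose s : 'rV[C]_n := \row_i real_complex R (Num.sqrt (complex.Re (d 0 i))).
exists (adj P *m diag_mx s).
suff E : diag_mx d = diag_mx s *m adj (diag_mx s) by rewrite KE Pi adj_mul adjK E !mulmxA.
apply/matrixP => i j; rewrite !mxE.
rewrite (bigD1 i) //= big1 ?addr0; last first.
  by move=> l li; rewrite !mxE eq_sym (negbTE li) mulr0n mul0r.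
rewrite !mxE eqxx mulr1n; have [r r0 rE] := dp i.
have [<-|ij] := eqVneq i j; last first.
  by rewrite !mulr0n conjc0 mulr0.
have rr : complex.Re (d 0 i) = r by rewrite rE.
by rewrite !mulr1n rr conjc_real rE -rmorphM -expr2 sqr_sqrtr.
Qed.

(** Equal Gram matrices make the map from [v *m Y] to [v *m X] well defined and isometric on the row
    space of [Y]; the orthogonal projection onto that space extends it to a contraction. *)
Lemma lurking_isometry N a b (X : 'M[C]_(N, a)) (Y : 'M[C]_(N, b)) :
  X *m adj X = Y *m adj Y -> exists U : 'M[C]_(b, a),
    Y *m U = X /\ forall w : 'rV[C]_b, rnrm2 (w *m U) <= rnrm2 w.
Proof.
move=> XY.
have nXY (v : 'rV[C]_N) : rnrm2 (v *m X) = rnrm2 (v *m Y).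
  by apply: (@complexI R); rewrite !rnrm2_mul XY.
have YX : (X^T <= Y^T)%MS.
  rewrite submxE; apply/eqP/matrixP => i j.
  pose v : 'rV[C]_N := (col j (cokermx Y^T))^T.
  have vY : v *m Y = 0.
    apply: (can_inj (@trmxK _ _ _)); rewrite trmx_mul trmxK trmx0.
    by rewrite colE mulmxA mulmx_coker mul0mx.
  have vX : v *m X = 0.
    apply: rnrm2_eq0; rewrite nXY vY.
    by rewrite /rnrm2 big1 // => l _; rewrite mxE cmod0 expr0n.
  have := congr1 (fun M : 'rV_a => M 0 i) vX; rewrite !mxE => E.
  rewrite -[RHS]E; apply: eq_bigr => l _; by rewrite !mxE mulrC.
have [Zt ZE] := submxP YX.
pose Z := Zt^T; have YZ : Y *m Z = X by rewrite /Z -[Y]trmxK -trmx_mul -ZE trmxK.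
pose P := proj_ortho Y.
have YP : Y *m P = Y by exact: proj_ortho_id.
exists (P *m Z); split; first by rewrite mulmxA YP.
move=> w; pose u := w *m P; pose w' := w - u.
have [v vE] := submxP (proj_ortho_sub Y w : (u <= Y)%MS).
have w'Y : w' *m adj Y = 0.
  have := proj_ortho_compl_sub Y w; rewrite -/P -/u -/w'.
  by move=> /orthomx1P.
have w'u : w' *m adj u = 0 by rewrite vE adj_mul mulmxA w'Y mul0mx.
have uw' : u *m adj w' = 0.
  by rewrite -[u]adjK -adj_mul w'u /adj trmx0 map_mx0.
have wE : w = u + w' by rewrite /w' subrKC.
have -> : rnrm2 w = rnrm2 u + rnrm2 w'.
  apply: (@complexI R); rewrite rmorphD /= -!rnrm2E {1 2}wE.
  have -> : adj (u + w') = adj u + adj w' by rewrite /adj linearD /= map_mxD.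
  by rewrite mulmxDl !mulmxDr w'u uw' addr0 add0r mxE.
by rewrite mulmxA -/u vE -mulmxA YZ nXY lerDl rnrm2_ge0.
Qed.

End Adjoint.

(** * Bezout's equation modulo a power of [z], by state space realization *)

Section Realization.
Variables (R : realType) (M n : nat).
Local Notation C := R[i].
Local Notation N := M.+1.
Variables (f : 'I_n -> nat -> C) (c : R).

(** On columns this is multiplication by the series [f j] modulo degree [N]; on rows it is the
    transpose, which is what [lower] estimates. *)
Definition ltoep (j : 'I_n) : 'M[C]_N :=
  \matrix_(a, b) if (b <= a)%N then f j (a - b)%N else 0.

Hypothesis lower : forall v : 'rV[C]_N,
  c ^+ 2 * rnrm2 v <= \sum_(j < n) rnrm2 (v *m ltoep j).

Let S : 'M[C]_N := \matrix_(a, b) (a == b.+1 :> nat)%:R.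
Let F0 : 'M[C]_(N, n) := \matrix_(a, j) f j a.
Let e0 : 'cV[C]_N := \col_a (a == 0%N :> nat)%:R.
Let K : 'M[C]_N := \sum_(j < n) ltoep j *m adj (ltoep j) - (real_complex R (c ^+ 2))%:M.

Lemma shift_mulE p (A : 'M[C]_(N, p)) a i :
  (S *m A) a i = if nat_of_ord a is b.+1 then A (inord b) i else 0.
Proof.
rewrite mxE; case E : (nat_of_ord a) => [|b].
  by rewrite big1 // => j _; rewrite mxE E mul0r.
have bN : (b < N)%N by rewrite -ltnS -E ltnW // ltnS ltn_ord.
rewrite (bigD1 (inord b)) //= mxE inordK // E eqxx mul1r big1 ?addr0 // => j jb.
rewrite mxE E eqSS; case: eqP => [Eb|]; last by rewrite mul0r.
by case/eqP: jb; apply: val_inj; rewrite /= inordK.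
Qed.

Lemma shift_powE p (A : 'M[C]_(N, p)) r a i :
  (S ^+ r *m A) a i = if (r <= a)%N then A (inord (a - r)) i else 0.
Proof.
elim: r a => [|r IH] a; first by rewrite expr0 mul1mx subn0 inord_val.
rewrite exprS -mulmxA shift_mulE; case E : (nat_of_ord a) => [|b] //.
have bN : (b < N)%N by rewrite -ltnS -E ltnW // ltnS ltn_ord.
by rewrite IH inordK // subSS.
Qed.

Lemma shift_adj_shift : 1%:M = S *m adj S + e0 *m adj e0.
Proof.
apply/matrixP => a b; rewrite [LHS]mxE [RHS]mxE shift_mulE [X in _ + X]mxE big_ord1 adjE !mxE.
  case Ea : (nat_of_ord a) => [|a']; case Eb : (nat_of_ord b) => [|b'];
    rewrite ?conjc_nat /= ?(mulr0, mul0r, mulr1, addr0, add0r).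
  - by rewrite -val_eqE /= Ea Eb.
  - by rewrite -val_eqE /= Ea Eb.
  - by rewrite adjE mxE -val_eqE /= Ea Eb conjc0.
  have aN : (a' < N)%N by rewrite -ltnS -Ea ltnW // ltnS ltn_ord.
  by rewrite adjE mxE conjc_nat -val_eqE /= Ea Eb inordK // eqSS eq_sym.
Qed.

(** Every [ltoep j] commutes with the shift [S], and the identity is [S *m adj S + e0 *m adj e0];
    the correction term is therefore built from the first columns, which form [F0]. *)
Lemma ltoep_displacement :
  \sum_(j < n) ltoep j *m adj (ltoep j) =
  S *m (\sum_(j < n) ltoep j *m adj (ltoep j)) *m adj S + F0 *m adj F0.
Proof.
have AS j : ltoep j *m S = S *m ltoep j.
  apply/matrixP => a b; rewrite shift_mulE mxE.
  have [bM|bM] := ltnP b.+1 N.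
    rewrite (bigD1 (Ordinal bM)) //= !mxE eqxx mulr1 big1 ?addr0; last first.
      move=> l lb; rewrite !mxE; case: eqP => [E|]; last by rewrite mulr0.
      by case/eqP: lb; apply: val_inj.
    rewrite /=; case E : (nat_of_ord a) => [|a'] //.
    have aN : (a' < N)%N by rewrite -ltnS -E ltnW // ltnS ltn_ord.
    by rewrite mxE inordK // ltnS subSS.
  rewrite big1 => [|l _]; last first.
    rewrite !mxE; case: eqP => [E|]; last by rewrite mulr0.
    by move: (ltn_ord l); rewrite E ltnNge bM.
  case E : (nat_of_ord a) => [|a'] //.
  have aN : (a' < N)%N by rewrite -ltnS -E ltnW // ltnS ltn_ord.
  rewrite mxE inordK //; case: ifP => // ba.
  by move: (ltn_ord a); rewrite E ltnNge (leq_trans bM).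
have Ae j : ltoep j *m e0 = col j F0.
  apply/matrixP => a b; rewrite !mxE (bigD1 ord0) //= !mxE eqxx mulr1 subn0 big1 ?addr0 //.
  by move=> l l0; rewrite !mxE (_ : (l == 0%N :> nat) = false) ?mulr0 //; apply/negbTE.
have FF : F0 *m adj F0 = \sum_(j < n) col j F0 *m adj (col j F0).
  apply/matrixP => a b; rewrite summxE mxE; apply: eq_bigr => j _.
  by rewrite [RHS]mxE big_ord1 !adjE !mxE.
rewrite FF mulmx_sumr mulmx_suml -big_split /=; apply: eq_bigr => j _.
rewrite -{1}[ltoep j]mulmx1 shift_adj_shift mulmxDr mulmxDl -Ae adj_mul !mulmxA; congr (_ + _).
by rewrite AS -!mulmxA -adj_mul AS adj_mul !mulmxA.
Qed.

(** Writing [K = G *m adj G] turns the displacement identity into an equality of Gram matrices for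
    [[G, c e0]] and [[S G, F0]]. The blocks of the resulting contraction [U] are those of a linear
    system whose impulse response is [h]. *)
Lemma realization : exists (h : nat -> 'cV[C]_n),
  (forall m, (m < N)%N -> \sum_(j < n) \sum_(i < m.+1) f j (m - i)%N * h i j 0 =
     if m is 0%N then real_complex R c else 0) /\
  (forall j T (v : nat -> C), \sum_(t < T) cmod (\sum_(i < t.+1) v (t - i)%N * h i j 0) ^+ 2 <=
     \sum_(t < T) cmod (v t) ^+ 2).
Proof.
have Kh : adj K = K.
  rewrite /K adjB adj_sum adj_real_scalar; congr (_ - _); apply: eq_bigr => j _.
  by rewrite adj_mul adjK.
have [G KG] : exists G : 'M[C]_N, K = G *m adj G.
  apply: psd_factor => // v; exists (\sum_(j < n) rnrm2 (v *m ltoep j) - c ^+ 2 * rnrm2 v).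
    by rewrite subr_ge0.
  rewrite /K mulmxBr mulmxBl mulmx_sumr mulmx_suml mul_mx_scalar -scalemxAl.
  rewrite [LHS]mxE summxE [X in _ + X]mxE [X in _ - X]mxE rnrm2E.
  set s1 := \sum_(j < n) rnrm2 _; set s2 := rnrm2 v.
  have -> : real_complex R (s1 - c ^+ 2 * s2) =
    real_complex R s1 - real_complex R (c ^+ 2) * real_complex R s2 by rewrite rmorphB rmorphM.
  have -> : real_complex R s1 = \sum_(j < n) real_complex R (rnrm2 (v *m ltoep j)).
    by rewrite /s1 rmorph_sum.
  congr (_ - _).
  apply: eq_bigr => j _; exact/esym/rnrm2_mul.
pose cc : C := real_complex R c.
have XY : row_mx G (cc *: e0) *m adj (row_mx G (cc *: e0)) =
    row_mx (S *m G) F0 *m adj (row_mx (S *m G) F0).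
  rewrite !adj_row_mx !mul_row_col adj_mul !mulmxA -KG -[S *m G *m _]mulmxA -KG.
  have -> : cc *: e0 *m adj (cc *: e0) = real_complex R (c ^+ 2) *: (e0 *m adj e0).
    have -> : adj (cc *: e0) = cc *: adj e0.
      by apply/matrixP => i j; rewrite !(adjE, mxE) rmorphM /= oppr0.
    by rewrite -scalemxAr -scalemxAl scalerA -rmorphM -expr2.
  have E : e0 *m adj e0 = 1%:M - S *m adj S by rewrite shift_adj_shift addrAC subrr add0r.
  rewrite E /K mulmxBr mulmxBl {1}ltoep_displacement scalerBr scalemx1.
  rewrite mul_mx_scalar -scalemxAl; set s1 := _ *: (S *m adj S).
  set D := S *m _ *m adj S; set E1 := _%:M; set FF := F0 *m _.
  by rewrite addrA subrK addrAC.
have [U [YU Ule]] := lurking_isometry XY.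
pose al : 'M[C]_N := ulsubmx U; pose be : 'M[C]_(N, 1) := ursubmx U.
pose ga : 'M[C]_(n, N) := dlsubmx U; pose d : 'M[C]_(n, 1) := drsubmx U.
have UE : U = block_mx al be ga d by rewrite submxK.
have [G1 G2] : S *m G *m al + F0 *m ga = G /\ S *m G *m be + F0 *m d = cc *: e0.
  by move: YU; rewrite UE mul_row_block => /eq_row_mx[].
pose h i : 'cV[C]_n := if i is m.+1 then ga *m al ^+ m *m be else d.
exists h; split.
  (* The remainder of the telescoping sum carries [S ^+ r.+1], which has zero row [r]; row [m] of
     the identity for [r = m] is thus the coefficient of degree [m]. *)
  have tele r : \sum_(i < r.+1) S ^+ i *m (F0 *m h i) = cc *: e0 - S ^+ r.+1 *m (G *m al ^+ r *m be).
    elim: r => [|r IH].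
      have S0 : S ^+ 0 = 1%:M by []; have S1 : S ^+ 1 = S by [].
      have al0 : al ^+ 0 = 1%:M by [].
      by rewrite big_ord1 S0 S1 al0 mul1mx mulmx1 -G2 mulmxA addrAC subrr add0r.
    rewrite big_ord_recr /= IH.
    have -> : F0 *m (ga *m al ^+ r *m be) = (G - S *m G *m al) *m al ^+ r *m be.
      by rewrite -{1}G1 addrAC subrr add0r !mulmxA.
    rewrite mulmxBl mulmxBl mulmxBr addrA subrK; congr (_ - _).
    by rewrite [al ^+ r.+1]exprS [S ^+ r.+2]exprSr !mulmxA.
  move=> m mN; pose a : 'I_N := inord m.
  have am : a = m :> nat by rewrite /a inordK.
  have /matrixP/(_ a 0) := tele m; rewrite summxE [RHS]mxE [X in _ = _ + X]mxE shift_powE.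
  rewrite am ltnn subr0 [RHS]mxE mxE am => E.
  rewrite exchange_big /= (_ : (if m is 0%N then _ else _) = cc * (m == 0%N)%:R); last first.
    by case: (m) => [|m'] /=; rewrite ?mulr1 ?mulr0.
  rewrite -E; apply: eq_bigr => i _; rewrite shift_powE am -ltnS ltn_ord mxE.
  apply: eq_bigr => j _; rewrite mxE inordK // (leq_ltn_trans (leq_subr _ _)) //.
move=> j T v.
pose E : 'rV[C]_n := delta_mx 0 j.
(* The system started at state 0 with scalar input [v] on channel [j]: [s] is the state, [y] the
   output, and contractivity of [U] says that no energy is created. *)
pose s := fix s t : 'rV[C]_N := if t is t'.+1 then s t' *m al + v t' *: (E *m ga) else 0.
pose y t : 'rV[C]_1 := s t *m be + v t *: (E *m d).
have step t : row_mx (s t) (v t *: E) *m U = row_mx (s t.+1) (y t).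
  by rewrite UE mul_row_block /= -!scalemxAl.
have nE t : rnrm2 (v t *: E) = cmod (v t) ^+ 2.
  rewrite /rnrm2 (bigD1 j) //= big1 ?addr0.
    by rewrite !mxE !eqxx mulr1.
  by move=> i ij; rewrite !mxE (negbTE ij) andbF mulr0 cmod0 expr0n.
have energy T' : rnrm2 (s T') + \sum_(t < T') rnrm2 (y t) <= \sum_(t < T') cmod (v t) ^+ 2.
  elim: T' => [|t IH].
    by rewrite !big_ord0 addr0 /rnrm2 big1 // => i _; rewrite mxE cmod0 expr0n.
  rewrite !big_ord_recr /=.
  have := Ule (row_mx (s t) (v t *: E)); rewrite step !rnrm2_row_mx nE /= => h1.
  by move: IH h1; lra.
have sE t : s t = \sum_(i < t) v (t - i.+1)%N *: (E *m ga *m al ^+ i).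
  elim: t => [|t IH]; first by rewrite big_ord0.
  rewrite big_ord_recl /= IH subSS subn0 expr0 mulmx1 addrC; congr (_ + _).
  rewrite mulmx_suml; apply: eq_bigr => i _.
  by rewrite -scalemxAl subSS /bump /= add1n exprSr !mulmxA.
have yE t : y t 0 0 = \sum_(i < t.+1) v (t - i)%N * h i j 0.
  rewrite /y sE mulmx_suml mxE summxE big_ord_recl /= subn0 addrC; congr (_ + _).
    by rewrite mxE -rowE mxE.
  apply: eq_bigr => i _; rewrite -scalemxAl mxE /bump /= add1n; congr (_ * _).
  by rewrite -!mulmxA -rowE mxE.
apply: le_trans (energy T).
apply: (@le_trans _ _ (\sum_(t < T) rnrm2 (y t))); last by rewrite lerDr rnrm2_ge0.
by apply: ler_sum => t _; rewrite /rnrm2 big_ord1 yE.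
Qed.

End Realization.

(** * Uniform convergence of power series on smaller discs *)

Section UniformTail.
Variable R : realType.
Local Notation C := R[i].
Implicit Types (a : nat -> C) (f : C -> C).

Lemma expands_uniform a f (r e : R) : expands a f -> 0 <= r -> r < 1 -> 0 < e ->
  exists N, forall L, (N <= L)%N -> forall z, cmod z <= r -> cmod (f z - psum a z L) <= e.
Proof.
move=> af r0 r1 e0; set s := (r + 1) / 2.
have s0 : 0 < s by rewrite /s; lra.
have s1 : s < 1 by rewrite /s; lra.
have [K aK] := expands_subgeom af (ltW s0) s1.
set q := r / s; have q0 : 0 <= q by rewrite divr_ge0 // ltW.
have q1 : q < 1 by rewrite /q ltr_pdivrMr // mul1r /s; lra.
have [N NP] := geom_small (K / (1 - q)) q0 q1 e0.
exists N => L NL z zr; apply: (ccvg_dist_le (N := L)); last exact: af (le_lt_trans zr r1).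
move=> n Ln; apply: le_trans (ltW (NP _ NL)).
rewrite /psum -(subnK Ln) addnC big_split_ord /= addrAC subrr add0r.
apply: (le_trans (cmod_sum _ _ _)).
have K0 : 0 <= K by apply: le_trans (aK 0%N); rewrite expr0 mulr1 cmod_ge0.
apply: (@le_trans _ _ (\sum_(i < n - L) K * q ^+ L * q ^+ i)).
  apply: ler_sum => i _; rewrite cmodM cmodX -mulrA -exprD.
  have -> : K * q ^+ (L + i) = K * r ^+ (L + i) / s ^+ (L + i) by rewrite expr_div_n mulrA.
  rewrite ler_pdivlMr ?exprn_gt0 // mulrAC.
  apply: (@le_trans _ _ (K * cmod z ^+ (L + i))).
    by rewrite ler_wpM2r ?exprn_ge0 ?cmod_ge0.
  by rewrite ler_wpM2l // lerXn2r ?nnegrE ?cmod_ge0.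
rewrite -mulr_sumr [leRHS]mulrAC; apply: ler_wpM2l; last exact: geometric_sum_le.
by rewrite mulr_ge0 ?exprn_ge0.
Qed.

End UniformTail.

(** * Limits of complex sequences along a filter *)

Section FilterLimits.
Variable R : realType.
Local Notation C := R[i].
Variable U : set_system nat.
Context {UF : ProperFilter U}.
Implicit Types (u v : nat -> C) (l m : C).

Definition fcvg u l : Prop := forall e : R, 0 < e -> U [set N | cmod (u N - l) < e].

Lemma fcvg_cst l : fcvg (fun=> l) l.
Proof. by move=> e e0; apply: filterS filterT => N _; rewrite /= subrr cmod0. Qed.

Lemma fcvgD u v l m : fcvg u l -> fcvg v m -> fcvg (fun n => u n + v n) (l + m).
Proof.
move=> ul vm e e0; have e20 : 0 < e / 2 by rewrite divr_gt0.
apply: filterS (filterI (ul _ e20) (vm _ e20)) => N /= [h1 h2].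
rewrite opprD addrACA (le_lt_trans (cmodD _ _)) // [e]splitr ltrD //.
Qed.

Lemma fcvgZ c u l : fcvg u l -> fcvg (fun n => c * u n) (c * l).
Proof.
move=> ul e e0; have c0 : 0 < cmod c + 1 by rewrite ltr_wpDl ?cmod_ge0.
apply: filterS (ul _ (divr_gt0 e0 c0)) => N /=.
rewrite -mulrBr cmodM ltr_pdivlMr // => h; apply: le_lt_trans h.
by rewrite mulrC ler_wpM2l ?cmod_ge0 // lerDl.
Qed.

Lemma fcvg_conj u l : fcvg u l -> fcvg (fun n => conjc (u n)) (conjc l).
Proof.
by move=> ul e /ul; apply: filterS => N /=; rewrite -rmorphB cmod_conj.
Qed.

Lemma fcvgM u v l m : fcvg u l -> fcvg v m -> fcvg (fun n => u n * v n) (l * m).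
Proof.
move=> ul vm e e0.
set K := cmod l + 1 + cmod m.
have K0 : 0 < K by rewrite /K; have := cmod_ge0 l; have := cmod_ge0 m; lra.
have d0 : 0 < Num.min 1 (e / (2 * K)) by rewrite lt_min ltr01 divr_gt0 // mulr_gt0.
apply: filterS (filterI (ul _ d0) (vm _ d0)) => N /= [].
rewrite !lt_min !ltr_pdivlMr ?mulr_gt0 // => /andP[a1 a2] /andP[b1 b2].
have -> : u N * v N - l * m = u N * (v N - m) + (u N - l) * m by ring.
apply: (le_lt_trans (cmodD _ _)); rewrite !cmodM.
have uN : cmod (u N) <= K.
  have : cmod (u N) <= cmod (u N - l) + cmod l by rewrite -{1}[u N](subrK l) cmodD.
  by move: (cmod_ge0 m) a1; rewrite /K; lra.
have mK : cmod m <= K by rewrite /K; have := cmod_ge0 l; lra.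
have := ler_wpM2r (cmod_ge0 (v N - m)) uN.
have := ler_wpM2l (cmod_ge0 (u N - l)) mK.
by move: a2 b2; lra.
Qed.

Lemma fcvg_sum n (u : 'I_n -> nat -> C) (l : 'I_n -> C) :
  (forall i, fcvg (u i) (l i)) -> fcvg (fun N => \sum_(i < n) u i N) (\sum_(i < n) l i).
Proof.
elim: n u l => [|n IH] u l ul.
  by rewrite (_ : (fun N => _) = fun=> 0) ?big_ord0; [exact: fcvg_cst|apply/funext => N; rewrite big_ord0].
rewrite big_ord_recr (_ : (fun N => _) = fun N =>
    \sum_(i < n) u (widen_ord (leqnSn n) i) N + u ord_max N); last first.
  by apply/funext => N; rewrite big_ord_recr.
by apply: fcvgD => //; apply: IH.
Qed.

Lemma fcvg_Re_le u l (S : R) : (forall N, complex.Re (u N) <= S) -> fcvg u l ->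
  complex.Re l <= S.
Proof.
move=> uS ul; apply/ler_addgt0Pl => e e0.
have [N /= h] := filter_ex (ul _ e0).
have := cmod_Re (u N - l); rewrite Re_add Re_opp ler_norml => /andP[h1 h2].
by have := uS N; move: h; lra.
Qed.

Lemma fcvg_unique u l m : fcvg u l -> fcvg u m -> l = m.
Proof.
move=> ul um; apply/eqP; rewrite -subr_eq0 -cmod_eq0; apply/eqP.
apply/le_anti; rewrite cmod_ge0 andbT; apply/ler_addgt0Pl => e e0; rewrite addr0.
have e20 : 0 < e / 2 by rewrite divr_gt0.
have [N /= [h1 h2]] := filter_ex (filterI (ul _ e20) (um _ e20)).
rewrite (le_trans (cmod_triangle (u N) l m)) // [e]splitr ltW // ltrD // cmodC; exact: h1.
Qed.

Lemma fcvg_near u l : U [set N | u N = l] -> fcvg u l.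
Proof. by move=> h e e0; apply: filterS h => N /= ->; rewrite subrr cmod0. Qed.

End FilterLimits.

(** * Bounded sequences converge along an ultrafilter *)

Section UltraLimits.
Variable R : realType.
Local Notation C := R[i].
Variable U : set_system nat.
Context {UU : UltraFilter U}.

(** The image ultrafilter clusters in a compact segment and converges to each of its cluster points.
    One ultrafilter serves all coefficient sequences at once, in place of a diagonal extraction. *)
Lemma ultra_limit_real (u : nat -> R) (K : R) : (forall N, `|u N| <= K) ->
  exists l : R, forall e : R, 0 < e -> U [set N | `|u N - l| < e].
Proof.
move=> uK.
have FU : ProperFilter (u @ U) by exact: fmap_proper_filter.
have [] := @segment_compact R (- K) K (u @ U) FU.
  change (U [set N | `[- K, K]%classic (u N)]).
  by apply: filterS filterT => N _; rewrite /= in_itv /= -ler_norml.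
move=> l [_ cl]; exists l => e e0.
have [//|H] := in_ultra_setVsetC [set N | `|u N - l| < e] UU.
have UA : (u @ U) [set x | ~ `|x - l| < e] by exact: H.
have [x [/= h1 h2]] := cl _ _ UA (nbhsx_ballx l e e0).
by case: h1; move: h2; rewrite /ball /= distrC.
Qed.

Lemma ultra_limit (u : nat -> C) (K : R) : (forall N, cmod (u N) <= K) ->
  exists l : C, fcvg U u l.
Proof.
move=> uK.
have [a ua] := @ultra_limit_real (fun N => complex.Re (u N)) K
  (fun N => le_trans (cmod_Re _) (uK N)).
have [b ub] := @ultra_limit_real (fun N => complex.Im (u N)) K
  (fun N => le_trans (cmod_Im _) (uK N)).
exists (Complex a b) => e e0; have e20 : 0 < e / 2 by rewrite divr_gt0.
apply: filterS (filterI (ua _ e20) (ub _ e20)) => N /= [h1 h2].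
apply: (le_lt_trans (cmod_le_ReIm _)); rewrite Re_add Im_add Re_opp Im_opp /=.
by rewrite [e]splitr ltrD.
Qed.

End UltraLimits.

(** * Contractive convolution operators have symbols bounded by 1 *)

Section ContractiveMultiplier.
Variable R : realType.
Local Notation C := R[i].
Variables (b : nat -> C) (h : C -> C).
Hypothesis contr : forall T (v : nat -> C),
  \sum_(t < T) cmod (\sum_(i < t.+1) v (t - i)%N * b i) ^+ 2 <= \sum_(t < T) cmod (v t) ^+ 2.

Lemma contractive_coef i : cmod (b i) <= 1.
Proof.
have := contr i.+1 (fun t => (t == 0%N)%:R).
have -> : \sum_(t < i.+1) cmod ((nat_of_ord t == 0%N)%:R : C) ^+ 2 = 1.
  by rewrite big_ord_recl big1 ?addr0 /= ?cmod1 ?expr1n // => j _; rewrite cmod0 expr0n.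
rewrite big_ord_recr /= => H.
have {H} : cmod (\sum_(j < i.+1) (i - j == 0)%N%:R * b j) ^+ 2 <= 1.
  by apply: le_trans H; rewrite lerDr sumr_ge0 // => j _; rewrite sqr_ge0.
rewrite big_ord_recr /= subnn mul1r big1 ?add0r => [|j _]; last first.
  by rewrite subn_eq0 leqNgt ltn_ord mul0r.
by rewrite -[X in _ <= X -> _](expr1n _ 2) ler_pXn2r ?nnegrE ?cmod_ge0.
Qed.

(** For the input [(z ^+ t)^-1] the output is the input times a partial sum of the series of [h z].
    If [cmod (h z) > 1], every late time step gains at least [e] in energy, the weights [x ^+ t]
    being at least 1, while the first [N] steps lose a bounded amount. *)
Lemma contractive_bound : expands b h -> forall z, in_disc z -> cmod (h z) <= 1.
Proof.
move=> bh z zD; have [->|zn0] := eqVneq z 0.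
  apply: (ccvg_cmod_le (N := 1%N)) (bh 0 (in_disc0 R)) => -[//|n] _.
  by rewrite psum_shift mul0r addr0 contractive_coef.
have z0 : 0 < cmod z by rewrite cmod_gt0.
rewrite leNgt; apply/negP => h1; set e := (cmod (h z) - 1) / 2.
have e0 : 0 < e by rewrite /e; lra.
have [N pN] := bh z zD _ e0.
set x := (cmod z ^+ 2)^-1.
have x1 : 1 <= x by rewrite invf_ge1 ?exprn_gt0 // exprn_ile1 ?cmod_ge0 // ltW.
have x0 : 0 <= x by lra.
have key T : \sum_(t < T) x ^+ t * (cmod (psum b z t.+1) ^+ 2 - 1) <= 0.
  have := contr T (fun t => (z ^+ t)^-1); rewrite -subr_le0 -sumrB.
  apply: le_trans; rewrite le_eqVlt; apply/orP; left; apply/eqP; apply: eq_bigr => t _.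
  have -> : \sum_(i < t.+1) (z ^+ (t - i))^-1 * b i = (z ^+ t)^-1 * psum b z t.+1.
    rewrite /psum mulr_sumr; apply: eq_bigr => i _.
    have it : (i <= t)%N by rewrite -ltnS.
    have := expf_neq0 (t - i)%N zn0; have := expf_neq0 i zn0.
    have -> : z ^+ t = z ^+ (t - i) * z ^+ i by rewrite -exprD subnK.
    by move=> u0 v0; field; apply/andP.
  by rewrite cmodM cmodV cmodX exprMn exprVn -exprM mulnC exprM -exprVn -/x mulrBr mulr1.
have tail T : e * T%:R - \sum_(t < N) x ^+ t <= 0.
  apply: le_trans (key (N + T)%N); rewrite big_split_ord /= addrC; apply: lerD; last first.
    rewrite -sumrN; apply: ler_sum => t _.
    rewrite -[X in X <= _]mulrN1 ler_wpM2l ?exprn_ge0 // lerDr sqr_ge0 //.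
  rewrite -[X in _ * X%:R](card_ord T) -sumr_const mulr_sumr.
  apply: ler_sum => t _; rewrite mulr1.
  have := pN (N + t).+1 (leq_trans (leq_addr _ _) (leqnSn _)).
  set p := psum _ _ _ => pe.
  have p1 : 1 + e <= cmod p.
    have := ler_cmodB (h z) p; rewrite cmodC; move: pe; rewrite /e; lra.
  have p2 : e <= cmod p ^+ 2 - 1 by clear - e0 p1; nra.
  rewrite -[X in X <= _]mul1r; apply: ler_pM => //; first exact: ltW.
  exact: exprn_ege1.
set S := \sum_(t < N) x ^+ t in tail.
have S0 : 0 <= S by apply: sumr_ge0 => t _; rewrite exprn_ge0.
have [T /andP[_ HT]] : exists T, (0 <= T)%N && (S / e < T%:R).
  by exists (Num.bound (S / e)); rewrite archi_boundP // divr_ge0 // ltW.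
move: HT; rewrite ltr_pdivrMr // => HT; have := tail T; lra.
Qed.

End ContractiveMultiplier.

(** * The corona theorem *)

Section FiniteSums.
Variable R : realType.
Local Notation C := R[i].

Lemma expands_sum I (r : seq I) (a : I -> nat -> C) (f : I -> C -> C) :
  (forall j, expands (a j) (f j)) ->
  expands (fun i => \sum_(j <- r) a j i) (fun z => \sum_(j <- r) f j z).
Proof.
move=> af; elim: r => [|j r IH] z zD.
  rewrite big_nil; apply: ccvg_ext (ccvg_cst 0) => N.
  by rewrite /psum big1 // => i _; rewrite big_nil mul0r.
rewrite big_cons; apply: ccvg_ext (expandsD (af j) IH zD) => N.
by apply: eq_bigr => i _; rewrite big_cons.
Qed.

End FiniteSums.

(** * From matrices to bounded analytic functions *)

Section HinfCorona.
Variable R : realType.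
Local Notation C := R[i].
Variable n : nat.
Implicit Types (f : 'I_n -> C -> C) (a : 'I_n -> nat -> C).

Lemma sum_ord_vanish (V : nmodType) (g : nat -> V) m L : (m <= L)%N ->
  (forall b, (m <= b)%N -> g b = 0) -> \sum_(b < L) g b = \sum_(b < m) g b.
Proof.
move=> mL g0; rewrite -(subnKC mL) big_split_ord /= [X in _ + X]big1 ?addr0 // => i _.
by rewrite g0 // leq_addr.
Qed.

Lemma sum_sqr_perturb (x y : 'I_n -> C) (eta : R) : (forall j, cmod (x j - y j) <= eta) ->
  \sum_(j < n) cmod (x j) ^+ 2 <= 2 * \sum_(j < n) cmod (y j) ^+ 2 + 2 * (n%:R * eta ^+ 2).
Proof.
move=> xy.
have -> : 2 * (n%:R * eta ^+ 2) = \sum_(j < n) 2 * eta ^+ 2.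
  by rewrite sumr_const card_ord -[RHS]mulr_natl mulrCA.
rewrite mulr_sumr -big_split; apply: ler_sum => j _ /=.
have := sqr_cmodD_le (y j) (x j - y j); rewrite (addrC (y j)) subrK => /le_trans; apply.
by rewrite lerD2l ler_wpM2l // lerXn2r ?nnegrE ?cmod_ge0 // (le_trans _ (xy j)) ?cmod_ge0.
Qed.

(** The polynomials are truncations of the dilations [f (r z)], divided by [sqrt (3 B)]. An error
    [eta] with [n eta^2 <= nu / 4] changes the bounds [nu] and [B] into [nu / 4] and
    [2 B + nu / 2 <= 3 B]. *)
Lemma poly_truncation f a (nu B r : R) M : 0 < nu -> (forall j, expands (a j) (f j)) ->
  (forall z, in_disc z -> nu <= \sum_(j < n) cmod (f j z) ^+ 2 <= B) -> 0 <= r -> r < 1 ->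
  exists2 L, (M <= L)%N & forall z, cmod z <= 1 ->
    nu / (12 * B) <= \sum_(j < n) cmod (\poly_(i < L) (real_complex R ((Num.sqrt (3 * B))^-1) *
      a j i * real_complex R (r ^+ i))).[z] ^+ 2 <= 1.
Proof.
move=> nu0 af fB r0 r1.
have B0 : nu <= B by have /andP[h1 h2] := fB 0 (in_disc0 R); exact: le_trans h1 h2.
set eta := Num.sqrt (nu / (4 * n.+1%:R)).
have eta2 : eta ^+ 2 = nu / (4 * n.+1%:R) by rewrite sqr_sqrtr // divr_ge0 ?mulr_ge0 // ltW.
have eta0 : 0 < eta by rewrite sqrtr_gt0 divr_gt0 // mulr_gt0.
have neta : n%:R * eta ^+ 2 <= nu / 4.
  rewrite eta2 mulrA ler_pdivrMr ?mulr_gt0 // (_ : nu / 4 * _ = n.+1%:R * nu); last by field.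
  by rewrite ler_wpM2r ?ler_nat // ltW.
have /choice[N NP] j : exists N, forall L, (N <= L)%N ->
  forall z, cmod z <= r -> cmod (f j z - psum (a j) z L) <= eta by exact: expands_uniform.
exists (M + \sum_(j < n) N j)%N; first exact: leq_addr.
set L := (_ + _)%N => z z1.
have NL j : (N j <= L)%N by rewrite (leq_trans _ (leq_addl _ _)) // (bigD1 j) //= leq_addr.
set w := real_complex R r * z.
have wr : cmod w <= r by rewrite cmodM cmod_real ger0_norm // ler_piMr.
set s := (Num.sqrt (3 * B))^-1.
have s2 : s ^+ 2 = (3 * B)^-1 by rewrite exprVn sqr_sqrtr //; lra.
have E j : cmod (\poly_(i < L) (real_complex R s * a j i * real_complex R (r ^+ i))).[z] ^+ 2 =
    s ^+ 2 * cmod (psum (a j) w L) ^+ 2.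
  rewrite horner_poly -exprMn; congr (_ ^+ 2).
  have sE : s = cmod (real_complex R s).
    by rewrite cmod_real ger0_norm // invr_ge0 sqrtr_ge0.
  rewrite [X in X * cmod _]sE -cmodM /psum mulr_sumr; congr cmod; apply: eq_bigr => i _.
  by rewrite exprMn rmorphXn !mulrA //.
rewrite (eq_bigr _ (fun j _ => E j)) -mulr_sumr s2.
have h1 := @sum_sqr_perturb (fun j => f j w) (fun j => psum (a j) w L) eta
  (fun j => NP j L (NL j) w wr).
have h2 := @sum_sqr_perturb (fun j => psum (a j) w L) (fun j => f j w) eta
  (fun j => ltac:(rewrite cmodC; exact: NP j L (NL j) w wr)).
have /andP[h3 h4] := fB w (le_lt_trans wr r1).
apply/andP; split.
  have -> : nu / (12 * B) = (3 * B)^-1 * (nu / 4) by field; lra.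
  by rewrite ler_wpM2l ?invr_ge0; lra.
rewrite mulrC ler_pdivrMr; lra.
Qed.

(** Truncation is exact here: for [k] of degree at most [M], the adjoint Toeplitz operators meet the
    coefficients of [a j] up to degree [M] only. The product [v *m ltoep] involves no conjugation,
    hence the [conjc] in the coefficients of [k]. *)
Lemma ltoep_lower_bound (a : 'I_n -> nat -> C) (nu : R) M L : 0 < nu -> (M < L)%N ->
  (forall z, cmod z <= 1 -> nu <= \sum_(j < n) cmod (\poly_(i < L) a j i).[z] ^+ 2 <= 1) ->
  forall v : 'rV[C]_M.+1, Num.sqrt (nu ^+ 4 / 802) ^+ 2 * rnrm2 v <=
    \sum_(j < n) rnrm2 (v *m ltoep M a j).
Proof.
move=> nu0 ML aB v; have nu4 : 0 < nu ^+ 4 by exact: exprn_gt0.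
have c802 : (0 : R) < 802 by exact: ltr0n.
rewrite sqr_sqrtr; last exact: divr_ge0 (ltW nu4) (ltW c802).
pose vv b := if (b <= M)%N then v 0 (inord b) else 0.
have vvE b : vv (nat_of_ord b) = v 0 b by rewrite /vv -ltnS ltn_ord inord_val.
pose k : {poly C} := \poly_(b < L) conjc (vv b).
have kE b : k`_b = conjc (vv b).
  rewrite coef_poly; case: ltnP => // Lb; rewrite /vv ifF ?rmorph0 //.
  by apply/negbTE; rewrite -ltnNge (leq_trans ML Lb).
pose F j : {poly C} := \poly_(i < L) a j i.
have := toeplitz_lower_bound (F := F) nu0 aB (fun j => size_poly L _) (size_poly L _ : (size k <= L)%N).
rewrite (sum_ord_vanish (g := fun b => cmod k`_b ^+ 2) ML); last by move=> b Mb; rewrite kE /vv leqNgt Mb rmorph0 cmod0 expr0n.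
rewrite (eq_bigr (fun b : 'I_M.+1 => cmod (v 0 b) ^+ 2)); last by move=> b _; rewrite kE cmod_conj vvE.
rewrite -/(rnrm2 v).
have -> : \sum_(j < n) \sum_(d < L) cmod (\sum_(a0 < L) conjc (F j)`_a0 *
    k`_(a0 + d)) ^+ 2 = \sum_(j < n) rnrm2 (v *m ltoep M a j).
  apply: eq_bigr => j _.
  rewrite (sum_ord_vanish (g := fun d => cmod (\sum_(a0 < L) conjc (F j)`_a0 * k`_(a0 + d)) ^+ 2) ML).
    apply: eq_bigr => d _; rewrite mxE; congr (_ ^+ 2).
    have -> : \sum_(b < M.+1) v 0 b * ltoep M a j b d =
        \sum_(b < M.+1) vv b * (if (d <= b)%N then a j (b - d)%N else 0).
      by apply: eq_bigr => b _; rewrite vvE mxE.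
    rewrite -[RHS]cmod_conj rmorph_sum /=; congr cmod.
    have dM : (d <= M.+1)%N by exact: ltnW (ltn_ord d).
    move: (nat_of_ord d) dM => {}d dM.
    rewrite -(subnKC dM) [RHS]big_split_ord /= [X in _ = X + _]big1 ?add0r => [|b _]; last first.
      by rewrite leqNgt ltn_ord mulr0 rmorph0.
    have dL : (M.+1 - d <= L)%N by rewrite (leq_trans (leq_subr _ _)).
    rewrite (sum_ord_vanish (g := fun b => conjc (F j)`_b * k`_(b + d)) dL); last first.
      move=> b Mb; have Mbd : (M < b + d)%N by lia.
      by rewrite kE /vv leqNgt Mbd rmorph0 mulr0.
    apply: eq_bigr => b _; rewrite kE leq_addr addKn rmorphM mulrC addnC; congr (_ * _).
    by rewrite /F coef_poly (leq_trans (ltn_ord b) dL).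
  move=> d Md; rewrite big1 ?cmod0 ?expr0n // => b _.
  by rewrite kE /vv leqNgt (leq_trans Md (leq_addl _ _)) rmorph0 mulr0.
have E : (nu ^+ 4 / 802)^-1 = 802 / nu ^+ 4 by exact: invf_div.
by rewrite -E mulrC ler_pdivlMr ?divr_gt0 // mulrC.
Qed.

(** The problem of size [M.+1] is solved for the dilation by [rad M]. All coefficients of the
    solutions are at most 1, so they have limits along an ultrafilter, and both the contraction
    inequality and each coefficient of Bezout's equation involve finitely many of them. *)
Theorem hinf_corona f a (nu B : R) : 0 < nu -> (forall j, expands (a j) (f j)) ->
  (forall z, in_disc z -> nu <= \sum_(j < n) cmod (f j z) ^+ 2 <= B) ->
  exists (h : 'I_n -> C -> C) (b : 'I_n -> nat -> C) (K : R),
    [/\ forall j, expands (b j) (h j), forall j z, in_disc z -> cmod (h j z) <= K &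
        forall z, in_disc z -> \sum_(j < n) f j z * h j z = 1].
Proof.
move=> nu0 af fB.
have B0 : nu <= B by have /andP[h1 h2] := fB 0 (in_disc0 R); exact: le_trans h1 h2.
set s := (Num.sqrt (3 * B))^-1.
have s0 : 0 < s by rewrite invr_gt0 sqrtr_gt0; lra.
set nu' := nu / (12 * B); have nu'0 : 0 < nu' by rewrite divr_gt0 //; lra.
set c := Num.sqrt (nu' ^+ 4 / 802).
have c0 : 0 < c by rewrite sqrtr_gt0; apply: divr_gt0; [exact: exprn_gt0|exact: ltr0n].
pose rad M : R := 1 - M.+2%:R^-1.
have rad0 M : 0 <= rad M by rewrite subr_ge0 invf_le1 // ler1n.
have rad1 M : rad M < 1 by rewrite ltrBlDr ltrDl invr_gt0.
pose aM M j i := real_complex R s * a j i * real_complex R (rad M ^+ i).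
have /choice[h hP] M : exists h : nat -> 'cV[C]_n,
  (forall m, (m < M.+1)%N -> \sum_(j < n) \sum_(i < m.+1) aM M j (m - i)%N * h i j 0 =
     if m is 0%N then real_complex R c else 0) /\
  (forall j T (v : nat -> C), \sum_(t < T) cmod (\sum_(i < t.+1) v (t - i)%N * h i j 0) ^+ 2 <=
     \sum_(t < T) cmod (v t) ^+ 2).
  have [L ML LB] := poly_truncation M.+1 nu0 af fB (rad0 M) (rad1 M).
  exact: realization (ltoep_lower_bound nu'0 ML LB).
have [U [UU Uoo]] := ultraFilterLemma (@eventually_filter).
have near N0 : U [set N | (N0 <= N)%N] by apply: Uoo; exists N0.
have /choice[H0 HP0] (ji : 'I_n * nat) : exists l, fcvg U (fun M => h M ji.2 ji.1 0) l.
  apply: (@ultra_limit _ _ UU _ 1) => M.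
  apply: (@contractive_coef _ (fun i => h M i ji.1 0)) => T v; exact: (hP M).2.
pose H j i := H0 (j, i); have HP j i : fcvg U (fun M => h M i j 0) (H j i) := HP0 (j, i).
have radP i : fcvg U (fun M => real_complex R (rad M ^+ i)) 1.
  elim: i => [|i IH]; first by rewrite (_ : (fun M => _) = fun=> 1) //; exact: fcvg_cst.
  rewrite -[1]mulr1 (_ : (fun M => _) = fun M => real_complex R (rad M) * real_complex R (rad M ^+ i)).
    apply: fcvgM IH => e e0.
    apply: filterS (near (Num.bound e^-1)) => N /= NP.
    rewrite -[1](rmorph1 (real_complex R)) -rmorphB cmod_real /rad addrAC subrr add0r normrN.
    rewrite ger0_norm ?invr_ge0 // invf_plt ?posrE // (lt_le_trans (archi_boundP _)) ?invr_ge0 ?ltW //.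
    by rewrite ltr_nat ltnS (leq_trans NP).
  by apply/funext => M; rewrite exprS rmorphM.
have HE m : \sum_(j < n) cauchy_prod (H j) (fun i => real_complex R s * a j i) m =
    if m is 0%N then real_complex R c else 0.
  apply: (@fcvg_unique _ U _ (fun M => \sum_(j < n) \sum_(i < m.+1) aM M j (m - i)%N * h M i j 0)).
    apply: fcvg_sum => j; apply: fcvg_sum => i.
    rewrite [X in fcvg _ _ X]mulrC -[_ * a j _]mulr1.
    apply: fcvgM (HP j i); rewrite /aM; exact: fcvgZ.
  by apply: fcvg_near; apply: filterS (near m) => M /= mM; apply: (hP M).1.
have HC j T (v : nat -> C) : \sum_(t < T) cmod (\sum_(i < t.+1) v (t - i)%N * H j i) ^+ 2 <=
     \sum_(t < T) cmod (v t) ^+ 2.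
  pose X (h : nat -> C) := \sum_(t < T) (\sum_(i < t.+1) v (t - i)%N * h i) *
    conjc (\sum_(i < t.+1) v (t - i)%N * h i).
  have XE g : complex.Re (X g) = \sum_(t < T) cmod (\sum_(i < t.+1) v (t - i)%N * g i) ^+ 2.
    by rewrite Re_sum; apply: eq_bigr => t _; rewrite mul_conjc.
  rewrite -XE; apply: (@fcvg_Re_le _ U _ (fun M => X (fun i => h M i j 0))).
    by move=> M; rewrite XE; apply: (hP M).2.
  have Y (t : 'I_T) : fcvg U (fun M => \sum_(i < t.+1) v (t - i)%N * h M i j 0)
     (\sum_(i < t.+1) v (t - i)%N * H j i).
    by apply: fcvg_sum => i; exact: fcvgZ.
  by apply: fcvg_sum => t; apply: fcvgM => //; exact: fcvg_conj.
have /choice[g gP] j : exists g, expands (H j) g.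
  by apply: subgeom_expands; apply: (@bounded_subgeom _ _ 1) => i; exact: contractive_coef (HC j) i.
(* The limit solves [sum g_j (s f_j) = c], whence the factor [s / c]. *)
exists (fun j z => real_complex R (s / c) * g j z), (fun j i => real_complex R (s / c) * H j i), (s / c).
split=> [j|j z zD|z zD].
- exact: expandsZ.
- have sc : 0 < s / c by exact: divr_gt0.
  rewrite cmodM cmod_real (gtr0_norm sc) ler_piMr ?(ltW sc) //.
  exact: contractive_bound (HC j) (gP j) z zD.
have E : \sum_(j < n) g j z * (real_complex R s * f j z) = real_complex R c.
  have := @expands_sum _ _ (index_enum 'I_n) (fun j => cauchy_prod (H j) (fun i => real_complex R s * a j i))
    (fun j z => g j z * (real_complex R s * f j z))
    (fun j => expands_cauchy_prod (gP j) (expandsZ _ (af j))).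
  move=> /(_ z zD) /ccvg_unique; apply.
  apply: ccvg_ext (expands_cst (real_complex R c) zD) => N.
  by apply: eq_bigr => i _; rewrite HE.
have cn0 : real_complex R c != 0 by rewrite -cmod_eq0 cmod_real normr_eq0 gt_eqF.
apply: (mulfI cn0); rewrite mulr1; apply: etrans E; rewrite mulr_sumr; apply: eq_bigr => j _.
have sc : real_complex R c * real_complex R (s / c) = real_complex R s.
  by rewrite -rmorphM mulrCA divff ?mulr1 // gt_eqF.
by rewrite -sc; ring.
Qed.

End HinfCorona.

(** * Hardy space and square summable coefficients *)

Section Hardy.
Variable R : realType.
Local Notation C := R[i].
Local Notation mu := (@lebesgue_measure R).
Implicit Types (a b c : nat -> C) (f g u : C -> C).

Definition l2 c : Prop := exists M : R, forall n, \sum_(i < n) cmod (c i) ^+ 2 <= M.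

Definition hardy u : Prop := exists2 c, expands c u & l2 c.

Lemma polar0 t : polar 0 t = 0 :> C.
Proof. by apply: complex_ext; rewrite /= mul0r. Qed.

Lemma ccont_monomial r i j : ccont (fun t => (polar r t : C) ^+ i * conjc (polar r t ^+ j)).
Proof.
apply: (@ccont_polar _ (fun z => z ^+ i * conjc (z ^+ j))) => z _ e e0.
have c1 := @continuous_pow R i z; have c2 := @continuous_pow R j z.
set A := cmod (z ^+ i) + 1 + cmod (z ^+ j).
have A0 : 0 < A by rewrite /A; have := cmod_ge0 (z ^+ i); have := cmod_ge0 (z ^+ j); lra.
have m0 : 0 < Num.min 1 (e / (2 * A)) by rewrite lt_min ltr01 divr_gt0 // mulr_gt0.
have [d d0 Hd] := c1 _ m0; have [d' d'0 Hd'] := c2 _ m0.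
exists (Num.min d d'); first by rewrite lt_min d0.
move=> w; rewrite lt_min => /andP[/Hd h1 /Hd' h2]; move: h1 h2.
rewrite !lt_min !ltr_pdivlMr ?mulr_gt0 // => /andP[a1 a2] /andP[b1 b2].
have -> : w ^+ i * conjc (w ^+ j) - z ^+ i * conjc (z ^+ j) =
   w ^+ i * conjc (w ^+ j - z ^+ j) + (w ^+ i - z ^+ i) * conjc (z ^+ j).
  by rewrite rmorphB; ring.
apply: (le_lt_trans (cmodD _ _)); rewrite !cmodM !cmod_conj.
have uN : cmod (w ^+ i) <= A.
  have : cmod (w ^+ i) <= cmod (w ^+ i - z ^+ i) + cmod (z ^+ i) by rewrite -{1}[w ^+ i](subrK (z ^+ i)) cmodD.
  by move: (cmod_ge0 (z ^+ j)) a1; rewrite /A; lra.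
have mK : cmod (z ^+ j) <= A by rewrite /A; have := cmod_ge0 (z ^+ i); lra.
have := ler_wpM2r (cmod_ge0 (w ^+ j - z ^+ j)) uN.
have := ler_wpM2l (cmod_ge0 (w ^+ i - z ^+ i)) mK.
by move: a2 b2; lra.
Qed.

Lemma cint_monomial r i j : 0 <= r -> r < 1 ->
  cint 0 (2 * pi) (fun t => (polar r t : C) ^+ i * conjc (polar r t ^+ j)) =
  real_complex R (if i == j then 2 * pi * r ^+ (2 * i) else 0).
Proof.
move=> r0 r1; have pi0 : (0 : R) <= 2 * pi by rewrite mulr_ge0 ?pi_ge0.
case: eqP => [<-|ij].
  under [X in cint _ _ X]funext do rewrite mul_conjc cmodX cmod_polar (ger0_norm r0) -exprM.
  by rewrite cint_cst // subr0 -rmorphM mulnC.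
rewrite le_eqVlt in r0; case/orP: r0 => [/eqP <-|r0].
  under [X in cint _ _ X]funext => t.
    rewrite polar0 (_ : _ * _ = 0); first by over.
    case: i ij => [|i] ij; last by rewrite exprS !mul0r.
    by case: j ij => [//|j] _; rewrite [0 ^+ j.+1]exprS mul0r rmorph0 mulr0.
  by rewrite cint_cst // mulr0.
have cp k : ccont (fun t => (polar r t : C) ^+ k).
  by apply: (@ccont_polar _ (fun z => z ^+ k)) => z _; exact: continuous_pow.
wlog ji : i j ij / (j < i)%N.
  move=> H; case: (ltngtP i j) => [lt_ij|lt_ji|//]; last exact: H.
  under [X in cint _ _ X]funext => t.
    rewrite (_ : _ * _ = conjc (polar r t ^+ j * conjc (polar r t ^+ i))); first by over.
    by rewrite rmorphM /= conjcK mulrC.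
  rewrite cint_conj; last exact: ccont_monomial.
  by rewrite H ?rmorph0 // => /esym.
have -> : i = (j + (i - j).-1.+1)%N by lia.
set k := (_ - _).-1.
under [X in cint _ _ X]funext => t.
  rewrite exprD mulrAC mul_conjc cmodX cmod_polar (gtr0_norm r0); over.
by rewrite cintZ // -/(circle_int (fun z => z ^+ k.+1) r) circle_int_pow ?mulr0.
Qed.

Lemma cint_parseval a r n : 0 <= r -> r < 1 ->
  cint 0 (2 * pi) (fun t => psum a (polar r t) n * conjc (psum a (polar r t) n)) =
  real_complex R (2 * pi * \sum_(i < n) cmod (a i) ^+ 2 * r ^+ (2 * i)).
Proof.
move=> r0 r1; have pi0 : (0 : R) <= 2 * pi by rewrite mulr_ge0 ?pi_ge0.
under [X in cint _ _ X]funext => t.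
  rewrite /psum rmorph_sum mulr_suml.
  under eq_bigr => i _ do rewrite mulr_sumr.
  under eq_bigr => i _ do under eq_bigr => j _ do rewrite rmorphM mulrACA.
  over.
have cm i j : ccont (fun t => a i * conjc (a j) * ((polar r t : C) ^+ i * conjc (polar r t ^+ j))).
  by apply: ccontZ; exact: ccont_monomial.
rewrite (@cint_sum _ _ _ n (fun i t => \sum_(j < n) a i * conjc (a j) * (polar r t ^+ i * conjc (polar r t ^+ j)))) //; last first.
  by move=> i; apply: (@ccont_sum _ n (fun j t => a i * conjc (a j) * (polar r t ^+ i * conjc (polar r t ^+ j)))).
rewrite mulr_sumr rmorph_sum; apply: eq_bigr => i _.
rewrite (@cint_sum _ _ _ n (fun j t => a i * conjc (a j) * (polar r t ^+ i * conjc (polar r t ^+ j)))) //.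
rewrite (bigD1 i) //= big1 ?addr0 => [|j ji]; rewrite cintZ; try exact: ccont_monomial; rewrite cint_monomial //.
  by rewrite eqxx mul_conjc -rmorphM mulrCA.
by rewrite eq_sym (negbTE (ji : nat_of_ord j != i)) mulr0.
Qed.

Lemma Rintegral_parseval a r n : 0 <= r -> r < 1 ->
  (\int[mu]_(t in `[0%R, (2 * pi)%R]) (cmod (psum a (polar r t) n) ^+ 2))%R =
  2 * pi * \sum_(i < n) cmod (a i) ^+ 2 * r ^+ (2 * i).
Proof.
move=> r0 r1; have /(congr1 (@complex.Re R)) := cint_parseval a n r0 r1.
by move=> /= <-; apply: eq_Rintegral => t _; rewrite mul_conjc.
Qed.

Lemma continuous_sqr_circle f r : disc_cont f -> 0 <= r -> r < 1 ->
  continuous (fun t => cmod (f (polar r t)) ^+ 2 : R).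
Proof.
move=> fc r0 r1 t.
have gc : ccont (fun t => f (polar r t)).
  by apply: (@ccont_polar _ f) => z zr; exact: disc_cont_circle fc r0 r1 z zr.
have hc : {for t, continuous (fun t => cmod (f (polar r t)) : R)}.
  apply/cvgrPdist_lt => e e0; have [d d0 H] := gc t _ e0.
  exists d => //= y yd; rewrite distrC (le_lt_trans (ler_dist_cmod _ _)) // H // distrC.
  exact: yd.
exact: (cvgM hc hc).
Qed.

Lemma disc_cont_psum a n : disc_cont (fun z => psum a z n).
Proof.
elim: n => [|n IH] z zD e e0.
  by exists 1 => // w _; rewrite /psum !big_ord0 subrr cmod0.
have e20 : 0 < e / 2 by rewrite divr_gt0.
have a0 : 0 < cmod (a n) + 1 by rewrite ltr_wpDl ?cmod_ge0.
have [d d0 Hd] := IH z zD _ e20; have [d' d'0 Hd'] := @continuous_pow R n z _ (divr_gt0 e20 a0).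
exists (Num.min d d'); first by rewrite lt_min d0.
move=> w; rewrite lt_min => /andP[/Hd h1 /Hd' h2].
rewrite !psumS opprD addrACA -mulrBr (le_lt_trans (cmodD _ _)) // [e]splitr ltrD // cmodM.
rewrite (le_lt_trans (y := (cmod (a n) + 1) * cmod (w ^+ n - z ^+ n))) //.
  by rewrite ler_wpM2r ?cmod_ge0 // lerDl.
by rewrite mulrC -ltr_pdivlMr.
Qed.

Lemma circle_mean_le f g r (A B : R) : disc_cont f -> disc_cont g -> 0 <= r -> r < 1 -> 0 <= A ->
  (forall z, cmod z = r -> cmod (f z) ^+ 2 <= A * cmod (g z) ^+ 2 + B) ->
  (\int[mu]_(t in `[0%R, (2 * pi)%R]) (cmod (f (polar r t)) ^+ 2))%R <=
  A * (\int[mu]_(t in `[0%R, (2 * pi)%R]) (cmod (g (polar r t)) ^+ 2))%R + B * (2 * pi).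
Proof.
move=> fc gc r0 r1 A0 fg; have pi0 : (0 : R) <= 2 * pi by rewrite mulr_ge0 ?pi_ge0.
have If := continuous_integrable 0 (2 * pi) (continuous_sqr_circle fc r0 r1).
have Ig := continuous_integrable 0 (2 * pi) (continuous_sqr_circle gc r0 r1).
have IB : mu.-integrable `[0, 2 * pi] (EFin \o (fun=> B)).
  by apply: continuous_integrable => x; exact: cvg_cst.
have -> : B * (2 * pi) = (\int[mu]_(t in `[0%R, (2 * pi)%R]) B)%R.
  rewrite Rintegral_cst //= lebesgue_measure_itv /= lte_fin.
  by case: ltgtP pi0 => //= [_|<-] _; rewrite ?subr0.
rewrite -RintegralZl // -RintegralD //; last exact: (integrableZl _ _ Ig).
apply: le_Rintegral => //.
  apply: continuous_integrable => t; apply: cvgD; last exact: cvg_cst.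
  apply: cvgM; [exact: cvg_cst|exact: continuous_sqr_circle].
by move=> t _; apply: fg; rewrite cmod_polar ger0_norm.
Qed.

Lemma circle_sqr_EFin f r : disc_cont f -> 0 <= r -> r < 1 ->
  (\int[mu]_(t in `[0%R, (2 * pi)%R]) ((cmod (f (polar r t))) ^+ 2)%:E)%E =
  ((\int[mu]_(t in `[0%R, (2 * pi)%R]) (cmod (f (polar r t)) ^+ 2))%R)%:E.
Proof.
move=> fc r0 r1; rewrite /Rintegral fineK //.
apply: integrable_fin_num => //.
exact: continuous_integrable (continuous_sqr_circle fc r0 r1).
Qed.

Lemma expands_disc_cont c f : expands c f -> disc_cont f.
Proof. by move=> cf; have [g _ /disc_cont_derivative] := expands_analytic cf. Qed.

Lemma bernoulli_sub (d : R) i : 0 <= d -> d <= 1 -> 1 - i%:R * d <= (1 - d) ^+ i.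
Proof.
move=> d0 d1; elim: i => [|i IH]; first by rewrite expr0 mul0r subr0.
rewrite exprS; apply: (@le_trans _ _ ((1 - d) * (1 - i%:R * d))).
  have : 0 <= i%:R * d ^+ 2 by rewrite mulr_ge0 ?sqr_ge0.
  by rewrite -natr1; lra.
by apply: ler_wpM2l => //; lra.
Qed.

(** The limit [r -> 1] in a finite sum, made explicit by Bernoulli's inequality. *)
Lemma sum_geom_limit (x : nat -> R) n (K : R) : (forall i, 0 <= x i) ->
  (forall r, 0 <= r -> r < 1 -> \sum_(i < n) x i * r ^+ i <= K) -> \sum_(i < n) x i <= K.
Proof.
move=> x0 H; apply/ler_addgt0Pl => e e0.
set S := \sum_(i < n) x i.
have S0 : 0 <= S by exact: sumr_ge0.
set d := Num.min (1 / 2) (e / (n%:R * S + 1)).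
have nS0 : 0 < n%:R * S + 1 by rewrite ltr_wpDl // mulr_ge0.
have d0 : 0 < d by rewrite lt_min !divr_gt0.
have dh : d <= 1 / 2 by rewrite ge_min lexx.
have de : d * (n%:R * S + 1) <= e by rewrite -ler_pdivlMr // ge_min lexx orbT.
have d1 : d <= 1 by lra.
have r0 : 0 <= 1 - d by lra.
have r1 : 1 - d < 1 by lra.
apply: (@le_trans _ _ (n%:R * d * S + \sum_(i < n) x i * (1 - d) ^+ i)).
  rewrite mulr_sumr -big_split; apply: ler_sum => i _ /=.
  have := ler_wpM2l (x0 i) (bernoulli_sub i (ltW d0) d1).
  have : i%:R * d <= n%:R * d.
    by apply: ler_wpM2r; [exact: ltW|rewrite ler_nat; exact/ltnW/ltn_ord].
  by move=> /(ler_wpM2l (x0 i)); lra.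
by rewrite lerD ?H //; apply: le_trans de; lra.
Qed.

(** On each circle [f] is within 1 of a partial sum, so the squared moduli agree up to a factor 2
    and an additive 2. This is enough for finiteness, and Parseval's identity is applied to
    polynomials only. *)
Lemma in_H2P c f : expands c f -> in_H2 f <-> l2 c.
Proof.
move=> cf; have fc := expands_disc_cont cf; have pi0 := @pi_gt0 R.
split=> [[M HM]|[M HM]].
  exists ((2 * M + 2 * (2 * pi)) / (2 * pi)) => n.
  apply: (@sum_geom_limit (fun i => cmod (c i) ^+ 2)); first by move=> i; exact: sqr_ge0.
  move=> s s0 s1.
  have [r [r0 r1 rs]] : exists r, [/\ 0 <= r, r < 1 & s = r ^+ 2].
    exists (Num.sqrt s); rewrite sqrtr_ge0 sqr_sqrtr //; split => //.
    by rewrite -(ltr_pXn2r (n := 2)) ?nnegrE ?sqrtr_ge0 // sqr_sqrtr // expr1n.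
  have [N NP] := expands_uniform cf r0 r1 ltr01.
  have nL := leq_addr N n; set L := (n + N)%N in nL.
  have HL z : cmod z = r -> cmod (psum c z L) ^+ 2 <= 2 * cmod (f z) ^+ 2 + 2.
    move=> zr; have h : cmod (f z - psum c z L) <= 1 by apply: NP; rewrite ?leq_addl // zr.
    have := sqr_cmodD_le (f z) (psum c z L - f z).
    rewrite (addrC (f z)) subrK => /le_trans; apply; rewrite lerD2l cmodC.
    by have := cmod_ge0 (f z - psum c z L); clear - h; nra.
  have := circle_mean_le (@disc_cont_psum c L) fc r0 r1 (ler0n _ 2) HL.
  rewrite Rintegral_parseval //.
  have := HM r r0 r1; rewrite circle_sqr_EFin // lee_fin => hM h.
  rewrite ler_pdivlMr ?mulr_gt0 // mulrC.
  apply: (@le_trans _ _ (2 * pi * \sum_(i < L) cmod (c i) ^+ 2 * r ^+ (2 * i))); last first.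
    by move: h hM; lra.
  apply: ler_wpM2l; first by rewrite mulr_ge0 // ltW.
  rewrite /L big_split_ord /= rs -[X in X <= _]addr0 lerD //.
    by apply: ler_sum => i _; rewrite exprM.
  by apply: sumr_ge0 => i _; rewrite mulr_ge0 ?sqr_ge0 ?exprn_ge0.
exists (2 * (2 * pi * M) + 2 * (2 * pi)) => r r0 r1.
have [N NP] := expands_uniform cf r0 r1 ltr01.
rewrite circle_sqr_EFin // lee_fin.
have HL z : cmod z = r -> cmod (f z) ^+ 2 <= 2 * cmod (psum c z N) ^+ 2 + 2.
  move=> zr; have h : cmod (f z - psum c z N) <= 1 by apply: NP; rewrite ?leqnn // zr.
  have := sqr_cmodD_le (psum c z N) (f z - psum c z N).
  rewrite (addrC (psum c z N)) subrK => /le_trans; apply; rewrite lerD2l.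
  by have := cmod_ge0 (f z - psum c z N); clear - h; nra.
apply: (le_trans (circle_mean_le fc (@disc_cont_psum c N) r0 r1 (ler0n _ 2) HL)).
rewrite lerD2r Rintegral_parseval //; apply: ler_wpM2l => //; apply: ler_wpM2l.
  by rewrite mulr_ge0 // ltW.
apply: le_trans (HM N); apply: ler_sum => i _.
by rewrite ler_piMr ?sqr_ge0 // exprn_ile1 // ltW.
Qed.

Lemma hardy_expands u : hardy u -> exists c, expands c u.
Proof. by move=> [c cu _]; exists c. Qed.

Lemma hardy_ext u g : (forall z, in_disc z -> u z = g z) -> hardy u -> hardy g.
Proof. by move=> ug [c cu cl]; exists c => //; exact: expands_ext cu. Qed.

Lemma l2D a b : l2 a -> l2 b -> l2 (fun i => a i + b i).
Proof.
move=> [M aM] [N bN]; exists (2 * M + 2 * N) => n.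
apply: (@le_trans _ _ (\sum_(i < n) (2 * cmod (a i) ^+ 2 + 2 * cmod (b i) ^+ 2))).
  by apply: ler_sum => i _; exact: sqr_cmodD_le.
by rewrite big_split /=; apply: lerD; rewrite -mulr_sumr ler_wpM2l ?aM ?bN.
Qed.

Lemma l2Z k a : l2 a -> l2 (fun i => k * a i).
Proof.
move=> [M aM]; exists (cmod k ^+ 2 * M) => n.
under eq_bigr do rewrite cmodM exprMn.
by rewrite -mulr_sumr ler_wpM2l ?sqr_ge0.
Qed.

Lemma l2_le a b : (forall i, cmod (b i) <= cmod (a i)) -> l2 a -> l2 b.
Proof.
move=> ba [M aM]; exists M => n; apply: le_trans (aM n); apply: ler_sum => i _.
by rewrite lerXn2r ?nnegrE ?cmod_ge0.
Qed.

Lemma l2_mulX a : l2 a -> l2 (mulX a).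
Proof.
move=> [M aM]; exists M => -[|n]; first by have := aM 0%N; rewrite !big_ord0.
by rewrite big_ord_recl /= cmod0 expr0n add0r; exact: aM.
Qed.

Lemma l2_cst k : l2 (fun i => if i is 0%N then k else 0).
Proof.
exists (cmod k ^+ 2) => -[|n]; first by rewrite big_ord0 sqr_ge0.
by rewrite big_ord_recl big1 ?addr0 //= => i _; rewrite cmod0 expr0n.
Qed.

Lemma hardyD u g : hardy u -> hardy g -> hardy (fun z => u z + g z).
Proof.
by move=> [a au al] [b bg bl]; exists (fun i => a i + b i); [exact: expandsD|exact: l2D].
Qed.

Lemma hardyZ k u : hardy u -> hardy (fun z => k * u z).
Proof.
by move=> [a au al]; exists (fun i => k * a i); [exact: expandsZ|exact: l2Z].
Qed.

Lemma hardyX u : hardy u -> hardy (fun z => z * u z).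
Proof. by move=> [a au al]; exists (mulX a); [exact: expandsX|exact: l2_mulX]. Qed.

Lemma hardy_cst k : hardy (fun=> k).
Proof. by eexists; [exact: expands_cst|exact: l2_cst]. Qed.

Lemma hardy_mul_bounded b u g (K : R) : expands b g -> (forall z, in_disc z -> cmod (g z) <= K) ->
  hardy u -> hardy (fun z => g z * u z).
Proof.
move=> bg gK [c cu cl]; have bcgu := expands_cauchy_prod bg cu.
exists (cauchy_prod b c) => //; apply/(in_H2P bcgu).
have [M HM] := (in_H2P cu).2 cl; exists (K ^+ 2 * M + 0 * (2 * pi)) => r r0 r1.
have gc := expands_disc_cont bcgu; have uc := expands_disc_cont cu.
rewrite (circle_sqr_EFin (f := fun z => g z * u z)) // lee_fin.
have K0 : 0 <= K ^+ 2 by exact: sqr_ge0.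
apply: (le_trans (circle_mean_le gc uc r0 r1 K0 _ (B := 0))).
  move=> z zr; rewrite addr0 cmodM exprMn ler_wpM2r ?sqr_ge0 //.
  rewrite lerXn2r ?nnegrE ?cmod_ge0 //; last by apply: gK; rewrite /in_disc zr.
  by apply: le_trans (gK 0 (in_disc0 R)); exact: cmod_ge0.
rewrite lerD2r ler_wpM2l //.
by have := HM r r0 r1; rewrite circle_sqr_EFin // lee_fin.
Qed.

(** Cauchy-Schwarz against the Szego kernel, whose squared norm is [1 / (1 - |z|^2)]. *)
Lemma expands_pointwise c u (M : R) : expands c u ->
  (forall n, \sum_(i < n) cmod (c i) ^+ 2 <= M) ->
  forall z, in_disc z -> cmod (u z) ^+ 2 * (1 - cmod z ^+ 2) <= M.
Proof.
move=> cu cM z zD; have z21 : cmod z ^+ 2 < 1 by rewrite expr_lt1 ?cmod_ge0.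
have M0 : 0 <= M by have := cM 0%N; rewrite big_ord0.
have d0 : 0 < 1 - cmod z ^+ 2 by rewrite subr_gt0.
rewrite -ler_pdivlMr // -[leRHS]sqr_sqrtr ?divr_ge0 ?(ltW d0) //.
rewrite lerXn2r ?nnegrE ?cmod_ge0 ?sqrtr_ge0 //.
apply: (ccvg_cmod_le (N := 0%N)) (cu z zD) => n _.
rewrite -(ler_pXn2r (n := 2)) ?nnegrE ?cmod_ge0 ?sqrtr_ge0 // [leRHS]sqr_sqrtr ?divr_ge0 ?(ltW d0) //.
apply: (le_trans (cauchy_schwarz_cmod _ _ _ _)); apply: ler_pM => //; try by apply: sumr_ge0 => i _; exact: sqr_ge0.
under eq_bigr do rewrite cmodX exprAC.
exact: geometric_sum_le (sqr_ge0 _) z21.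
Qed.

End Hardy.

(** * Area integrals of analytic functions *)

Section LinearChange.
Variable R : realType.
Local Notation C := R[i].
Local Notation mu := (@lebesgue_measure R).
Local Notation T := (measurableTypeR R).
Local Notation lam2 := (mu \x mu)%E.

Definition affine (c d : R) : T -> T := fun y => c * y + d.

Lemma measurable_affine c d : measurable_fun [set: T] (affine c d).
Proof. by apply: measurable_funD => //; apply: measurable_funM. Qed.

Lemma lebesgue_affine c d A : 0 < c -> measurable A ->
  mu A = (c%:E * mu (affine c d @^-1` A))%E.
Proof.
move=> c0 mA; pose k : {nonneg R} := NngNum (ltW c0).
pose H := isMeasurableFun.Build _ _ _ _ (affine c d) (measurable_affine c d).
pose F : {mfun T >-> T} := HB.pack (affine c d) H.
rewrite -[LHS]/(lebesgue_measure A).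
rewrite (@lebesgue_measure_unique R (mscale k (pushforward mu F))) //.
move=> _ [[a b] _ <-].
change (mu `]a, b]%classic = (c%:E * mu (affine c d @^-1` `]a, b]%classic))%E).
have -> : affine c d @^-1` `]a, b]%classic = `](a - d) / c, (b - d) / c]%classic.
  apply/seteqP; split => y /=; rewrite !in_itv /= /affine ltr_pdivrMr // ler_pdivlMr //;
   by rewrite ltrBlDr lerBrDr mulrC.
rewrite !lebesgue_measure_itv /= !lte_fin ltr_pM2r ?invr_gt0 // ltrD2r.
case: ifP => _; last by rewrite mule0.
by rewrite -!EFinB -EFinM; congr EFin; field; rewrite gt_eqF.
Qed.

Lemma lam2_swap A : measurable A -> lam2 A = (mu \x^ mu)%E A.
Proof.
move=> mA; rewrite (@product_measure_unique _ _ _ _ _ mu mu (mu \x^ mu)%E) //.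
by move=> X Y mX mY; exact: product_measure2E.
Qed.

Definition shear1 (c e : R) (p : T * T) : T * T := (p.1, c * p.2 + e * p.1).
Definition shear2 (c e : R) (p : T * T) : T * T := (c * p.1 + e * p.2, p.2).

Lemma measurable_shear1 c e : measurable_fun setT (shear1 c e).
Proof.
apply: measurable_fun_pair; first exact: measurable_fst.
by apply: measurable_funD; apply: measurable_funM.
Qed.

Lemma measurable_shear2 c e : measurable_fun setT (shear2 c e).
Proof.
apply: measurable_fun_pair; last exact: measurable_snd.
by apply: measurable_funD; apply: measurable_funM.
Qed.

Lemma lam2_shear1 c e A : 0 < c -> measurable A ->
  lam2 A = (c%:E * lam2 (shear1 c e @^-1` A))%E.
Proof.
move=> c0 mA; rewrite /product_measure1.
have mB : measurable (shear1 c e @^-1` A).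
  by rewrite -[X in measurable X]setTI; exact: measurable_shear1.
rewrite -ge0_integralZl //=; last 2 first.
- exact: measurable_fun_xsection.
- by rewrite lee_fin ltW.
apply: eq_integral => x _ /=; rewrite (lebesgue_affine (e * x) c0); last exact: measurable_xsection.
congr (_ * mu _)%E; apply/seteqP; split => y /=; rewrite /affine /xsection /= !inE //=.
Qed.

Lemma lam2_shear2 c e A : 0 < c -> measurable A ->
  lam2 A = (c%:E * lam2 (shear2 c e @^-1` A))%E.
Proof.
move=> c0 mA.
have mB : measurable (shear2 c e @^-1` A).
  by rewrite -[X in measurable X]setTI; exact: measurable_shear2.
rewrite !lam2_swap // /product_measure2 -ge0_integralZl //=; last 2 first.
- exact: measurable_fun_ysection.
- by rewrite lee_fin ltW.
apply: eq_integral => y _ /=; rewrite (lebesgue_affine (e * y) c0); last exact: measurable_ysection.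
congr (_ * mu _)%E; apply/seteqP; split => x /=; rewrite /affine /ysection /= !inE //=.
Qed.

Definition cpair (p : T * T) : C := Complex p.1 p.2.

Definition mul_plane (w : C) (p : T * T) : T * T :=
  (complex.Re w * p.1 - complex.Im w * p.2, complex.Im w * p.1 + complex.Re w * p.2).

Lemma cpair_mul_plane w p : cpair (mul_plane w p) = w * cpair p.
Proof. by apply: complex_ext; rewrite ?Re_mul ?Im_mul /=; ring. Qed.

Lemma measurable_mul_plane w : measurable_fun setT (mul_plane w).
Proof.
apply: measurable_fun_pair.
  by apply: measurable_funB; apply: measurable_funM.
by apply: measurable_funD; apply: measurable_funM.
Qed.

(** Multiplication by [w] is a composition of two shears, each changing a single coordinate
    affinely, so that Fubini reduces the claim to the line; the factorisation divides by [Re w]. *)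
Lemma lam2_mul_plane w A : 0 < complex.Re w -> measurable A ->
  lam2 A = ((cmod w ^+ 2)%:E * lam2 (mul_plane w @^-1` A))%E.
Proof.
move=> w0 mA; rewrite sqr_cmod; set p := complex.Re w in w0 *; set q := complex.Im w.
have pn0 : p != 0 by rewrite gt_eqF.
have m0 : 0 < (p ^+ 2 + q ^+ 2) / p by rewrite divr_gt0 // ltr_pwDl ?exprn_gt0 ?sqr_ge0.
rewrite (lam2_shear1 (q / p) m0 mA) (lam2_shear2 (- q) w0); last first.
  by rewrite -[X in measurable X]setTI; exact: measurable_shear1.
rewrite muleA -EFinM (divfK pn0); congr (_ * lam2 _)%E.
apply/seteqP; split => x /=; rewrite /shear1 /shear2 /mul_plane /= -/p -/q.
  rewrite (_ : _ / p * x.2 + _ = q * x.1 + p * x.2) ?mulNr //; by field.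
rewrite (_ : q * x.1 + p * x.2 = (p ^+ 2 + q ^+ 2) / p * x.2 + q / p * (p * x.1 + - q * x.2)) ?mulNr //; by field.
Qed.

Lemma ge0_integral_mul_plane w D (f : _ -> \bar R) : 0 < complex.Re w -> measurable D ->
  measurable_fun D f -> (forall p, D p -> 0 <= f p)%E ->
  (\int[lam2]_(p in D) f p =
   (cmod w ^+ 2)%:E * \int[lam2]_(p in mul_plane w @^-1` D) f (mul_plane w p))%E.
Proof.
move=> w0 mD mf f0; pose k : {nonneg R} := NngNum (sqr_ge0 (cmod w)).
pose H := isMeasurableFun.Build _ _ _ _ (mul_plane w) (measurable_mul_plane w).
pose F : {mfun (T * T)%type >-> (T * T)%type} := HB.pack (mul_plane w) H.
rewrite -(ge0_integral_pushforward (measurable_mul_plane w)) //; last by move=> p /set_mem; exact: f0.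
have := @ge0_integral_mscale _ _ R (pushforward lam2 F) D mD k f mf f0.
move=> /(_ (measurable_mul_plane w)) E; apply: etrans E.
apply: eq_measure_integral => A mA AD; exact: lam2_mul_plane.

Qed.

End LinearChange.

(** * Orthogonality of monomials on discs *)

Section AreaIntegrals.
Variable R : realType.
Local Notation C := R[i].
Local Notation mu := (@lebesgue_measure R).
Local Notation T := (measurableTypeR R).
Local Notation lam2 := (mu \x mu)%E.
Local Notation cpair := (@cpair R).
Implicit Types (b : nat -> C) (D : set (T * T)).

Definition cmeas D (g : T * T -> C) : Prop :=
  measurable_fun D (fun p => complex.Re (g p)) /\ measurable_fun D (fun p => complex.Im (g p)).

Lemma cmeas_cst D k : cmeas D (fun=> k).
Proof. by split; exact: measurable_cst. Qed.

Lemma cmeasD D g h : cmeas D g -> cmeas D h -> cmeas D (fun p => g p + h p).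
Proof.
move=> [g1 g2] [h1 h2]; split.
  under [X in measurable_fun _ X]funext do rewrite Re_add; exact: measurable_funD.
under [X in measurable_fun _ X]funext do rewrite Im_add; exact: measurable_funD.
Qed.

Lemma cmeasM D g h : cmeas D g -> cmeas D h -> cmeas D (fun p => g p * h p).
Proof.
move=> [g1 g2] [h1 h2]; split.
  under [X in measurable_fun _ X]funext do rewrite Re_mul.
  by apply: measurable_funB; apply: measurable_funM.
under [X in measurable_fun _ X]funext do rewrite Im_mul.
by apply: measurable_funD; apply: measurable_funM.
Qed.

Lemma cmeas_cpair D : cmeas D cpair.
Proof. by split; apply: measurable_funTS; [exact: measurable_fst|exact: measurable_snd]. Qed.

Lemma cmeas_psum D b n : cmeas D (fun p => psum b (cpair p) n).
Proof.
elim: n => [|n IH].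
  by rewrite (_ : (fun p => _) = fun=> 0) ?funeqE => [|p]; [exact: cmeas_cst|rewrite /psum big_ord0].
rewrite (_ : (fun p => _) = fun p => psum b (cpair p) n + b n * cpair p ^+ n); last first.
  by apply/funext => p; rewrite psumS.
apply: cmeasD => //; apply: cmeasM; first exact: cmeas_cst.
elim: n {IH} => [|n IH]; first exact: cmeas_cst.
rewrite (_ : (fun p => _) = fun p => cpair p * cpair p ^+ n); last by apply/funext => p; rewrite exprS.
by apply: cmeasM => //; exact: cmeas_cpair.
Qed.

Lemma cmeas_sqr_cmod D g : cmeas D g -> measurable_fun D (fun p => cmod (g p) ^+ 2).
Proof.
move=> [g1 g2]; under [X in measurable_fun _ X]funext do rewrite sqr_cmod.
by apply: measurable_funD; exact: measurable_funX.
Qed.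

Definition ddisc (r : R) : set (T * T) := [set p | cmod (cpair p) < r].

Lemma measurable_cmod D : measurable_fun D (fun p => cmod (cpair p)).
Proof.
apply: measurable_funTS.
have H := cmeas_sqr_cmod (@cmeas_cpair setT).
rewrite (_ : (fun p => _) = (@Num.sqrt R) \o (fun p => cmod (cpair p) ^+ 2)); last first.
  by apply/funext => p /=; rewrite sqrtr_sqr ger0_norm // cmod_ge0.
apply: measurableT_comp => //.
apply: continuous_measurable_fun; exact: sqrt_continuous.
Qed.

Lemma measurable_ddisc r : measurable (ddisc r).
Proof.
have := @measurable_cmod setT measurableT `]-oo, r[%classic (measurable_itv _).
by rewrite setTI; congr (measurable _); apply/seteqP; split => p /=; rewrite in_itv.
Qed.

Definition wt (p : T * T) : R := 1 - cmod (cpair p) ^+ 2.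

Lemma measurable_wt D : measurable_fun D wt.
Proof.
by apply: measurable_funB; [exact: measurable_cst|exact: (cmeas_sqr_cmod (@cmeas_cpair D))].
Qed.

Lemma wt_ge0 r p : r <= 1 -> ddisc r p -> 0 <= wt p.
Proof.
rewrite /ddisc /wt /= => r1 pr; rewrite subr_ge0 expr_le1 ?cmod_ge0 //.
exact: ltW (lt_le_trans pr r1).
Qed.

Local Notation "'\area_' r g" := (\int[lam2]_(p in ddisc r) (g p)%:E)%E
  (at level 36, r at level 0, g at level 36).

Lemma ddisc_mul w r : preimage (mul_plane w) (ddisc r) = [set p | cmod w * cmod (cpair p) < r].
Proof. by apply/seteqP; split => p /=; rewrite /ddisc /= cpair_mul_plane cmodM. Qed.

Lemma area_rotate w r (g : T * T -> R) : cmod w = 1 -> 0 < complex.Re w ->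
  measurable_fun (ddisc r) g -> (forall p, ddisc r p -> 0 <= g p) ->
  \area_r g = \area_r (fun p => g (mul_plane w p)).
Proof.
move=> w1 w0 mg g0.
rewrite (@ge0_integral_mul_plane _ w (ddisc r) (fun p => (g p)%:E)) //.
- rewrite w1 expr1n mul1e ddisc_mul w1; congr (integral _ _ _).
  by apply/seteqP; split => p /=; rewrite mul1r.
- exact: measurable_ddisc.
- exact/measurable_EFinP.
Qed.

Lemma root1_order N d : (0 < d < N)%N -> polar (1 : R) (2 * pi / N%:R * d%:R) != 1.
Proof.
move=> /andP[d0 dN]; apply/eqP => /(congr1 (@complex.Re R)) /=; rewrite mul1r.
set t := 2 * pi / N%:R * d%:R => ct.
have : cos t < 1.
  have -> : t = (t / 2) *+ 2 by rewrite -mulr_natr divfK.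
  rewrite cos_mulr2n cos2sin2.
  have : 0 < sin (t / 2).
    have Nn : (0 < N)%N by exact: leq_trans dN.
    have N0 : (0 : R) < N%:R by rewrite ltr0n.
    have -> : t / 2 = pi * (d%:R / N%:R) by rewrite /t; field; rewrite gt_eqF.
    apply: sin_gt0_pi; rewrite mulr_gt0 ?pi_gt0 ?divr_gt0 ?ltr0n //=.
    by rewrite gtr_pMr ?pi_gt0 // ltr_pdivrMr // mul1r ltr_nat.
  move=> s0; have := mulr_gt0 s0 s0; rewrite expr2; lra.
by rewrite ct ltxx.
Qed.

Lemma discrete_parseval N b L (w : C) z : (L <= N)%N -> cmod w = 1 -> w ^+ N = 1 ->
  (forall d, (0 < d < N)%N -> w ^+ d != 1) ->
  \sum_(k < N) cmod (psum b (w ^+ k * z) L) ^+ 2 =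
  N%:R * \sum_(i < L) cmod (b i) ^+ 2 * cmod z ^+ (2 * i).
Proof.
move=> LN w1 wN wd; apply: (@complexI R); rewrite rmorph_sum.
have cw : w * conjc w = 1 by rewrite mul_conjc w1 expr1n.
have inner i j : (i < L)%N -> (j < L)%N ->
    \sum_(k < N) (w ^+ k) ^+ i * conjc ((w ^+ k) ^+ j) = if i == j then N%:R else 0.
  wlog ij : i j / (j <= i)%N.
    move=> H iL jL; case: (leqP j i) => [h|h]; first exact: H.
    rewrite -[LHS]conjcK rmorph_sum /=.
    under eq_bigr do rewrite rmorphM /= conjcK mulrC.
    by rewrite H ?(ltnW h) // eq_sym; case: eqP => _; rewrite ?rmorph0 // rmorph_nat.
  move=> iL jL.
  have E k : (w ^+ k) ^+ i * conjc ((w ^+ k) ^+ j) = (w ^+ (i - j)) ^+ k.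
    rewrite -{1}(subnK ij) exprD -mulrA mul_conjc !cmodX w1 !expr1n mulr1.
    by rewrite -!exprM mulnC.
  under eq_bigr do rewrite E.
  case: eqP => [->|/eqP nij].
    by rewrite subnn; under eq_bigr do rewrite expr0 expr1n; rewrite sumr_const card_ord.
  have d0 : (0 < i - j < N)%N.
    by rewrite subn_gt0 ltn_neqAle eq_sym nij ij (leq_ltn_trans (leq_subr _ _)) // (leq_trans iL).
  have := wd _ d0; rewrite -subr_eq0 => x1; apply: (mulfI x1).
  by rewrite -subrX1 mulr0 -exprM mulnC exprM wN expr1n subrr.
transitivity (\sum_(k < N) \sum_(i < L) \sum_(j < L) b i * z ^+ i * conjc (b j * z ^+ j) *
    ((w ^+ k) ^+ i * conjc ((w ^+ k) ^+ j))).
  apply: eq_bigr => k _.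
  rewrite [LHS](_ : _ = psum b (w ^+ k * z) L * conjc (psum b (w ^+ k * z) L)); last by rewrite mul_conjc.
  rewrite /psum rmorph_sum mulr_suml; apply: eq_bigr => i _.
  rewrite mulr_sumr; apply: eq_bigr => j _; rewrite !exprMn !rmorphM /=; ring.
rewrite exchange_big rmorphM rmorph_nat rmorph_sum mulr_sumr; apply: eq_bigr => i _.
rewrite exchange_big (bigD1 i) //= [X in _ + X]big1 ?addr0 => [|j ji].
  rewrite -mulr_sumr inner // eqxx mul_conjc cmodM cmodX exprMn -exprM [(i * 2)%N]mulnC.
  by rewrite [RHS]mulrC.
by rewrite -mulr_sumr inner // eq_sym (negbTE (ji : nat_of_ord j != i)) mulr0.
Qed.

Lemma sume_const_ord N (x : \bar R) : (\sum_(k < N) x = N%:R%:E * x)%E.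
Proof.
elim: N => [|N IH]; first by rewrite big_ord0 mul0e.
by rewrite big_ord_recr /= IH -natr1 EFinD ge0_muleDl ?lee_fin ?mul1e.
Qed.

(** Averaging over rotations by [N]-th roots of unity replaces polar coordinates. With [N = L + 5],
    the root [w] has positive real part, as the change of variables demands, and [N >= L] makes the
    cross terms of distinct exponents cancel. *)
Lemma area_psum b L r : r <= 1 ->
  (\area_r (fun p => cmod (psum b (cpair p) L) ^+ 2 * wt p) =
  \sum_(i < L) (cmod (b i) ^+ 2)%:E * \area_r (fun p => cmod (cpair p) ^+ (2 * i) * wt p))%E.
Proof.
move=> r1; pose N := (L + 5)%N; have LN : (L <= N)%N by exact: leq_addr.
have N0 : (0 : R) < N%:R by rewrite ltr0n /N addnS.
pose w : C := polar 1 (2 * pi / N%:R).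
have w1 : cmod w = 1 by rewrite cmod_polar normr1.
have wX d : w ^+ d = polar 1 (2 * pi / N%:R * d%:R) by rewrite polarX expr1n mulr_natr.
have wN : w ^+ N = 1.
  by rewrite wX divfK ?gt_eqF //; apply: complex_ext; rewrite /= mulr_natl ?cos2pi ?sin2pi ?mul1r ?mulr0.
have wd d : (0 < d < N)%N -> w ^+ d != 1 by rewrite wX; exact: root1_order.
have w0 : 0 < complex.Re w.
  rewrite /= mul1r; apply: cos_gt0_pihalf; have := pi_gt0 R => pi0.
  have h : 2 * pi / N%:R < pi / 2 :> R.
    rewrite ltr_pdivrMr // (_ : pi / 2 * _ = pi * (N%:R / 2)); last by ring.
    have : (4 : R) < N%:R by rewrite ltr_nat /N addnS ltnS leq_addl.
    by move=> h; nra.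
  by rewrite h (lt_trans _ (_ : 0 < _)) ?divr_gt0 ?mulr_gt0 // oppr_lt0 divr_gt0.
have mp b' : measurable_fun (ddisc r) (fun p => cmod (psum b' (cpair p) L) ^+ 2 * wt p).
  apply: measurable_funM; last exact: measurable_wt.
  by apply: (@cmeas_sqr_cmod _ (fun p => psum b' (cpair p) L)); exact: cmeas_psum.
have p0 b' p : ddisc r p -> 0 <= cmod (psum b' (cpair p) L) ^+ 2 * wt p.
  by move=> pr; rewrite mulr_ge0 ?sqr_ge0 // (wt_ge0 r1 pr).
have bw k p : psum (fun i => b i * (w ^+ k) ^+ i) (cpair p) L = psum b (w ^+ k * cpair p) L.
  by apply: eq_bigr => i _; rewrite exprMn mulrA.
pose g k p := cmod (psum (fun i => b i * (w ^+ k) ^+ i) (cpair p) L) ^+ 2 * wt p.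
have gE k p : g k p = cmod (psum b (w ^+ k * cpair p) L) ^+ 2 * wt p by rewrite /g bw.
have gS k : (fun p => g k (mul_plane w p)) = g k.+1.
  apply/funext => p; rewrite !gE cpair_mul_plane mulrA -exprSr; congr (_ * _).
  by rewrite /wt cpair_mul_plane cmodM w1 mul1r.
have rot k : \area_r (g k) = \area_r (g 0%N).
  elim: k => [//|k <-]; rewrite -gS.
  by apply/esym/area_rotate => //; [exact: mp|exact: p0].
rewrite [LHS](_ : _ = \area_r (g 0%N)); last by apply: eq_integral => p _; rewrite gE expr0 mul1r.
have sumE : (\sum_(k < N) \area_r (g k) =
    N%:R%:E * \sum_(i < L) (cmod (b i) ^+ 2)%:E * \area_r (fun p => cmod (cpair p) ^+ (2 * i) * wt p))%E.
  rewrite -ge0_integral_sum; last first.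
  - by move=> k p pr; rewrite lee_fin; exact: p0.
  - by move=> k; apply/measurable_EFinP; exact: mp.
  - exact: measurable_ddisc.
  have mi i : measurable_fun (ddisc r) (fun p => cmod (cpair p) ^+ (2 * i) * wt p).
    by apply: measurable_funM; [apply: measurable_funX; exact: measurable_cmod|exact: measurable_wt].
  have i0 i p : ddisc r p -> 0 <= cmod (cpair p) ^+ (2 * i) * wt p.
    by move=> pr; rewrite mulr_ge0 ?exprn_ge0 ?cmod_ge0 // (wt_ge0 r1 pr).
  under [in RHS]eq_bigr => i _.
    rewrite -ge0_integralZl_EFin ?sqr_ge0 //; last 3 first.
    - exact: measurable_ddisc.
    - by move=> p pr; rewrite lee_fin i0.
    - exact/measurable_EFinP.
    over.
  rewrite -ge0_integral_sum; last first.
  - by move=> i p pr; rewrite mule_ge0 // lee_fin ?sqr_ge0 ?i0.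
  - by move=> i; apply: measurable_funeM; exact/measurable_EFinP.
  - exact: measurable_ddisc.
  rewrite -ge0_integralZl_EFin ?ler0n //; last 3 first.
  - exact: measurable_ddisc.
  - by move=> p pr; apply: sume_ge0 => i _; rewrite mule_ge0 // lee_fin ?sqr_ge0 ?i0.
  - by apply: emeasurable_sum => i; apply: measurable_funeM; exact/measurable_EFinP.
  apply: eq_integral => p _; rewrite sumEFin.
  under [in RHS]eq_bigr do rewrite -EFinM.
  have -> : \sum_(k < N) g k p = (\sum_(k < N) cmod (psum b (w ^+ k * cpair p) L) ^+ 2) * wt p.
    by rewrite mulr_suml; apply: eq_bigr => k _; rewrite gE.
  rewrite sumEFin -EFinM (discrete_parseval b (cpair p) LN w1 wN wd).
  by congr EFin; rewrite -mulrA mulr_suml; congr (_ * _); apply: eq_bigr => i _; rewrite mulrA.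
move: sumE; under eq_bigr do rewrite rot.
rewrite sume_const_ord => /(congr1 (fun x => (N%:R^-1)%:E * x)%E).
by rewrite !muleA -EFinM mulVf ?gt_eqF // !mul1e.
Qed.

End AreaIntegrals.

(** * Moments of the area measure on the disc *)

Section DiscMoments.
Variable R : realType.
Local Notation C := R[i].
Local Notation mu := (@lebesgue_measure R).
Local Notation T := (measurableTypeR R).
Local Notation lam2 := (mu \x mu)%E.
Local Notation cpair := (@cpair R).
Local Notation wt := (@wt R).
Local Notation ddisc := (@ddisc R).
Implicit Types (b : nat -> C) (D : set (T * T)).
Local Notation "'\area_' r g" := (\int[lam2]_(p in ddisc r) (g p)%:E)%E
  (at level 36, r at level 0, g at level 36).

Lemma ddisc_sub r s : r <= s -> ddisc r `<=` ddisc s.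
Proof. by move=> rs p; rewrite /ddisc /= => h; exact: lt_le_trans h rs. Qed.

Lemma measurable_box (a b : R) : measurable ((`[a, b]%classic `*` `[a, b]%classic) : set (T * T)).
Proof. by apply: measurableX; exact: measurable_itv. Qed.

Lemma lam2_box (a b : R) : a <= b ->
  lam2 (`[a, b]%classic `*` `[a, b]%classic) = ((b - a) ^+ 2)%:E.
Proof.
move=> ab; have E : mu `[a, b]%classic = (b - a)%:E.
  rewrite lebesgue_measure_itv /= lte_fin; have [_|ba] := ltP a b; first by rewrite -EFinB.
  have -> : a = b by apply/le_anti; rewrite ab ba.
  by rewrite subrr.
transitivity (mu `[a, b]%classic * mu `[a, b]%classic)%E.
  by apply: product_measure1E; exact: measurable_itv.
by rewrite E -EFinM expr2.
Qed.

Lemma lam2_ddisc1_fin : (lam2 (ddisc 1) < +oo)%E.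
Proof.
have H : (ddisc 1 `<=` `[(-1)%R, 1%R]%classic `*` `[(-1)%R, 1%R]%classic).
  move=> p; rewrite /ddisc /= !in_itv /= -!ler_norml => h.
  by rewrite !(le_trans (cmod_Re (cpair p)), le_trans (cmod_Im (cpair p))) ?ltW.
apply: le_lt_trans (le_measure _ _ _ H) _; rewrite ?inE; first exact: measurable_ddisc.
  exact: measurable_box.
by rewrite [X in (X < _)%E]lam2_box ?ltry //; lra.
Qed.

Lemma lam2_ddisc1_gt0 : (0 < lam2 (ddisc 1))%E.
Proof.
pose B : set (T * T) := `[0%R, (1 / 2)%R]%classic `*` `[0%R, (1 / 2)%R]%classic.
have H : B `<=` ddisc 1.
  move=> p [/=]; rewrite !in_itv /= => /andP[a1 a2] /andP[b1 b2]; rewrite /ddisc /=.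
  rewrite -(ltr_pXn2r (n := 2)) ?nnegrE ?cmod_ge0 // sqr_cmod /= expr1n; nra.
apply: (@lt_le_trans _ _ (lam2 B)).
  by rewrite [X in (_ < X)%E]lam2_box ?lte_fin ?exprn_gt0 //; lra.
by apply: (le_measure _ _ _ H); rewrite inE; [exact: measurable_box|exact: measurable_ddisc].
Qed.

Definition moment i r : \bar R := \area_r (fun p => cmod (cpair p) ^+ (2 * i)).
(** [mom 0] is the area of the unit disc; it is kept as an unevaluated positive factor. *)
Definition mom i : R := fine (moment i 1).

Lemma measurable_cmodX D n : measurable_fun D (fun p => (cmod (cpair p) ^+ n)%:E).
Proof. by apply/measurable_EFinP; apply: measurable_funX; exact: measurable_cmod. Qed.

Lemma cmodX_ge0 n p : (0 <= (cmod (cpair p) ^+ n)%:E)%E.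
Proof. by rewrite lee_fin exprn_ge0 ?cmod_ge0. Qed.

Lemma moment0 r : moment 0 r = lam2 (ddisc r).
Proof.
rewrite /moment; under eq_integral do rewrite muln0 expr0.
by rewrite integral_cst ?mul1e //; exact: measurable_ddisc.
Qed.

Lemma moment_scale i r : 0 < r -> moment i r = ((r ^+ (2 * i + 2))%:E * moment i 1)%E.
Proof.
move=> r0; pose w := real_complex R r.
have cw : cmod w = r by rewrite cmod_real gtr0_norm.
rewrite /moment (@ge0_integral_mul_plane _ w (ddisc r) (fun p => (cmod (cpair p) ^+ (2 * i))%:E)) //.
- rewrite cw ddisc_mul cw.
  have -> : [set p | r * cmod (cpair p) < r] = ddisc 1.
    by apply/seteqP; split => p /=; rewrite /ddisc /= -{2}[r]mulr1 ltr_pM2l.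
  under eq_integral do rewrite cpair_mul_plane cmodM cw exprMn EFinM.
  rewrite ge0_integralZl_EFin ?exprn_ge0 ?(ltW r0) //.
  + by rewrite muleA -EFinM -exprD addnC.
  + exact: measurable_ddisc.
  + by move=> p _; exact: cmodX_ge0.
  + exact: measurable_cmodX.
- exact: measurable_ddisc.
- exact: measurable_cmodX.
- by move=> p _; exact: cmodX_ge0.
Qed.

Lemma moment_le0 i r : r <= 1 -> (moment i r <= lam2 (ddisc r))%E.
Proof.
move=> r1; rewrite -moment0; apply: ge0_le_integral.
- exact: measurable_ddisc.
- by move=> p _; exact: cmodX_ge0.
- exact: measurable_cmodX.
- exact: measurable_cmodX.
- move=> p pr; rewrite lee_fin muln0 expr0 exprn_ile1 ?cmod_ge0 //.
  exact: ltW (lt_le_trans pr r1).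
Qed.

Lemma momP i : moment i 1 = (mom i)%:E.
Proof.
rewrite /mom fineK // ge0_fin_numE; last by apply: integral_ge0 => p _; exact: cmodX_ge0.
exact: le_lt_trans (moment_le0 i (lexx _)) lam2_ddisc1_fin.
Qed.

Lemma mom_ge0 i : 0 <= mom i.
Proof. by apply/fine_ge0/integral_ge0 => p _; exact: cmodX_ge0. Qed.

Lemma mom0_gt0 : 0 < mom 0.
Proof. by rewrite -lte_fin -momP moment0 lam2_ddisc1_gt0. Qed.

Lemma momentE i r : 0 < r -> moment i r = (r ^+ (2 * i + 2) * mom i)%:E.
Proof. by move=> r0; rewrite moment_scale // momP. Qed.

(** Scaling gives the moment of the annulus in terms of [mom i], and on the annulus [|z|^(2 i)] lies
    between [r ^+ (2 * i)] and 1. *)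
Lemma mom_annulus i r : 0 < r -> r < 1 ->
  r ^+ (2 * i) * ((1 - r ^+ 2) * mom 0) <= mom i * (1 - r ^+ (2 * i + 2)) <= (1 - r ^+ 2) * mom 0.
Proof.
move=> r0 r1; pose B := ddisc 1 `\` ddisc r.
have mD s := @measurable_ddisc R s.
have mB : measurable B by exact: measurableD.
pose X j := (\int[lam2]_(p in B) (cmod (cpair p) ^+ (2 * j))%:E)%E.
have X0 j : (0 <= X j)%E by apply: integral_ge0 => p _; exact: cmodX_ge0.
have XE j : (moment j 1 = moment j r + X j)%E.
  rewrite /moment -[in LHS](setDUK (ddisc_sub (ltW r1))) ge0_integral_setU //.
  - exact: measurable_cmodX.
  - by move=> p _; exact: cmodX_ge0.
  - by apply/disj_set2P; rewrite setDIK.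
have XR j : X j = (mom j * (1 - r ^+ (2 * j + 2)))%:E.
  have := XE j; rewrite momP momentE //; case: (X j) (X0 j) => [x _|_|//]; last by [].
  by rewrite -EFinD => -[E]; congr EFin; rewrite mulrBr mulr1 {1}E; ring.
have := XR 0%N; rewrite muln0 add0n => XR0.
rewrite -!lee_fin -XR mulrC [X in (_ <= _ <= X)%E]EFinM EFinM; apply/andP; split.
  rewrite mulrC -XR0 muleC -ge0_integralZl_EFin ?exprn_ge0 ?(ltW r0) //; try exact: measurable_cmodX; try by move=> p _; exact: cmodX_ge0.
  apply: ge0_le_integral => //.
  - by move=> p _; rewrite mule_ge0 ?cmodX_ge0 // lee_fin exprn_ge0 // ltW.
  - by apply: measurable_funeM; exact: measurable_cmodX.
  - exact: measurable_cmodX.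
  - move=> p [_ /= /negP]; rewrite /ddisc /= -leNgt => h.
    rewrite muln0 expr0 mule1 lee_fin lerXn2r ?nnegrE ?cmod_ge0 //; exact: ltW.
rewrite -EFinM mulrC -XR0; apply: ge0_le_integral => //.
- by move=> p _; exact: cmodX_ge0.
- exact: measurable_cmodX.
- exact: measurable_cmodX.
- by move=> p [pr _]; rewrite lee_fin muln0 expr0 exprn_ile1 ?cmod_ge0 // ltW.
Qed.

Lemma le_of_near1 (x y c : R) : 0 <= x -> 0 <= c ->
  (forall d, 0 < d -> d < 1 -> x * (1 - c * d) <= y) -> x <= y.
Proof.
move=> x0 c0 H; apply/ler_addgt0Pl => e e0.
have cx0 : 0 < c * x + 1 by rewrite ltr_wpDl // mulr_ge0.
have d0 : 0 < Num.min (1 / 2) (e / (c * x + 1)) by rewrite lt_min !divr_gt0.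
set d := Num.min _ _ in d0.
have d1 : d <= 1 / 2 by rewrite ge_min lexx.
have d2 : d * (c * x + 1) <= e by rewrite -ler_pdivlMr // ge_min lexx orbT.
have := H d d0 (le_lt_trans d1 _); lra.
Qed.

(** Put [d = 1 - r ^+ 2] and [q = 1 - d]. Dividing the annulus estimate by [d] leaves the sum [S] of
    the first [i.+1] powers of [q], which tends to [i.+1] as [d] tends to 0. *)
Lemma momE i : mom i = mom 0 / i.+1%:R.
Proof.
have i0 : (0 : R) < i.+1%:R by [].
have key d : 0 < d -> d < 1 -> exists S, [/\ (1 - d) ^+ i * mom 0 <= mom i * S,
    mom i * S <= mom 0, i.+1%:R * (1 - i%:R * d) <= S & S <= i.+1%:R].
  move=> d0 d1; pose q := 1 - d; have q0 : 0 < q by rewrite /q; lra.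
  have r0 : 0 < Num.sqrt q by rewrite sqrtr_gt0.
  have r2 : Num.sqrt q ^+ 2 = q by rewrite sqr_sqrtr // ltW.
  have r1 : Num.sqrt q < 1.
    by rewrite -(ltr_pXn2r (n := 2)) ?nnegrE ?(ltW r0) // r2 expr1n /q; lra.
  have := mom_annulus i r0 r1.
  have -> : (2 * i + 2 = 2 * i.+1)%N by rewrite mulnS addnC.
  rewrite !exprM r2 (_ : 1 - q = d); last by rewrite /q; ring.
  exists (\sum_(j < i.+1) q ^+ j).
  have SE : 1 - q ^+ i.+1 = d * \sum_(j < i.+1) q ^+ j.
    by rewrite -[LHS]opprB subrX1 -mulNr /q; congr (_ * _); ring.
  move: H; rewrite SE => /andP[h1 h2]; split.
  - by rewrite -(ler_pM2l d0); move: h1; rewrite -/q; lra.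
  - by rewrite -(ler_pM2l d0); move: h2; lra.
  - rewrite -[X in X%:R * _](card_ord i.+1) -sumr_const mulr_suml; apply: ler_sum => j _; rewrite mul1r.
    apply: le_trans (bernoulli_sub i (ltW d0) (ltW d1)) _.
    by rewrite -/q ler_wiXn2l ?(ltW q0) // ?lerBlDr ?lerDl ?(ltW d0) // -ltnS.
  - rewrite -[X in _ <= X%:R](card_ord i.+1) -sumr_const; apply: ler_sum => j _.
    by rewrite exprn_ile1 ?(ltW q0) // /q lerBlDr lerDl ltW.
apply/eqP; rewrite eq_le ler_pdivlMr // ler_pdivrMr //; apply/andP; split.
  apply: (@le_of_near1 _ _ i%:R) => //; first by rewrite mulr_ge0 ?mom_ge0.
  move=> d d0 d1; have [S [_ h2 h3 _]] := key d d0 d1.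
  by apply: le_trans h2; rewrite -mulrA ler_wpM2l ?mom_ge0.
apply: (@le_of_near1 _ _ i%:R) => //; first exact: mom_ge0.
move=> d d0 d1; have [S [h1 _ _ h4]] := key d d0 d1.
apply: (@le_trans _ _ (mom i * S)); last by rewrite ler_wpM2l ?mom_ge0.
apply: le_trans h1; rewrite mulrC ler_wpM2r ?mom_ge0 //.
exact: bernoulli_sub (ltW d0) (ltW d1).
Qed.

Lemma measurable_momwt D i : measurable_fun D (fun p => (cmod (cpair p) ^+ (2 * i) * wt p)%:E).
Proof.
by apply/measurable_EFinP; apply: measurable_funM;
  [apply: measurable_funX; exact: measurable_cmod|exact: measurable_wt].
Qed.

Lemma area_weighted i r : 0 < r -> r <= 1 ->
  \area_r (fun p => cmod (cpair p) ^+ (2 * i) * wt p) =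
  (mom 0 * (r ^+ (2 * i + 2) / i.+1%:R - r ^+ (2 * i + 4) / i.+2%:R))%:E.
Proof.
move=> r0 r1; set J := (LHS).
have J0 : (0 <= J)%E.
  apply: integral_ge0 => p pr; rewrite lee_fin mulr_ge0 ?exprn_ge0 ?cmod_ge0 //; exact: wt_ge0 r1 pr.
have : (moment i r = J + moment i.+1 r)%E.
  rewrite /J /moment -ge0_integralD.
  - apply: eq_integral => p _; rewrite -EFinD; congr EFin.
    have -> : (2 * i.+1 = 2 * i + 2)%N by rewrite mulnS addnC.
    by rewrite /wt exprD; ring.
  - exact: measurable_ddisc.
  - by move=> p pr; rewrite lee_fin mulr_ge0 ?exprn_ge0 ?cmod_ge0 //; exact: wt_ge0 r1 pr.
  - exact: measurable_momwt.
  - by move=> p _; exact: cmodX_ge0.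
  - exact: measurable_cmodX.
rewrite !momentE // (momE i) (momE i.+1).
have -> : (2 * i.+1 + 2 = 2 * i + 4)%N by lia.
case: J J0 => [x _|_|//]; last by [].
by rewrite -EFinD => -[E]; congr EFin; rewrite mulrBr !mulrA ![mom 0 * _]mulrC -!mulrA E; ring.
Qed.

End DiscMoments.

(** * Area integrals with weight [1 - |z|^2] as coefficient sums *)

Section WeightedArea.
Variable R : realType.
Local Notation C := R[i].
Local Notation mu := (@lebesgue_measure R).
Local Notation T := (measurableTypeR R).
Local Notation lam2 := (mu \x mu)%E.
Local Notation cpair := (@cpair R).
Local Notation wt := (@wt R).
Local Notation ddisc := (@ddisc R).
Implicit Types (b : nat -> C) (D : set (T * T)).
Local Notation "'\area_' r g" := (\int[lam2]_(p in ddisc r) (g p)%:E)%E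
  (at level 36, r at level 0, g at level 36).

Lemma double_succ2 i : (2 * i + 2 = 2 * i.+1)%N.
Proof. by rewrite mulnS addnC. Qed.

Lemma double_succ4 i : (2 * i + 4 = 2 * i.+1 + 2)%N.
Proof. by rewrite -double_succ2 -addnA. Qed.

Lemma inv_mul_succ i : (i.+1%:R * i.+2%:R)^-1 = i.+1%:R^-1 - i.+2%:R^-1 :> R.
Proof.
have i1 : (0 : R) < i.+1%:R by [].
rewrite -[i.+2%:R]natr1; move: i1; set u := i.+1%:R => u0.
have u1 : 0 < u + 1 by rewrite addr_gt0.
by field; rewrite !gt_eqF.
Qed.

Lemma area_psum_weighted b L r : 0 < r -> r <= 1 ->
  \area_r (fun p => cmod (psum b (cpair p) L) ^+ 2 * wt p) =
  (mom R 0 * \sum_(i < L) cmod (b i) ^+ 2 *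
     (r ^+ (2 * i + 2) / i.+1%:R - r ^+ (2 * i + 4) / i.+2%:R))%:E.
Proof.
move=> r0 r1; rewrite area_psum //.
under eq_bigr do rewrite area_weighted // -EFinM.
by rewrite sumEFin mulr_sumr; congr EFin; apply: eq_bigr => i _; rewrite mulrCA.
Qed.

Lemma measurable_expands b (w : C -> C) r : r <= 1 -> expands b w ->
  measurable_fun (ddisc r) (fun p => cmod (w (cpair p)) ^+ 2).
Proof.
move=> r1 bw; apply: (@measurable_fun_cvg _ _ _ _ (fun n p => cmod (psum b (cpair p) n) ^+ 2)).
  by move=> n; apply: (@cmeas_sqr_cmod _ _ (fun p => psum b (cpair p) n)); exact: cmeas_psum.
move=> p pr; have h := ccvg_cmod (bw (cpair p) (lt_le_trans pr r1)).
exact: (cvgM h h).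
Qed.

(** Fatou's lemma along the partial sums, whose integrals are explicit. *)
Lemma area_expands_le b (w : C -> C) (M : R) : expands b w ->
  (forall n, \sum_(i < n) cmod (b i) ^+ 2 / (i.+1%:R * i.+2%:R) <= M) ->
  (\area_1 (fun p => (cmod (w (cpair p)) ^+ 2 * wt p)%R) <= (mom R 0 * M)%:E)%E.
Proof.
move=> bw bM; pose f n p := (cmod (psum b (cpair p) n) ^+ 2 * wt p)%:E.
have mD := @measurable_ddisc R 1.
have f0 n p : ddisc 1 p -> (0 <= f n p)%E.
  by move=> pr; rewrite lee_fin mulr_ge0 ?sqr_ge0 // (wt_ge0 (lexx 1) pr).
have mf n : measurable_fun (ddisc 1) (f n).
  apply/measurable_EFinP; apply: measurable_funM; last exact: measurable_wt.
  by apply: (@cmeas_sqr_cmod _ _ (fun p => psum b (cpair p) n)); exact: cmeas_psum.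
have := fatou (mu \x mu)%E mD mf f0.
have -> : (\int[lam2]_(p in ddisc 1) limn_einf (f ^~ p))%E =
    \area_1 (fun p => (cmod (w (cpair p)) ^+ 2 * wt p)%R).
  apply: eq_integral => p; rewrite inE => pr.
  suff h : f ^~ p @ \oo --> (cmod (w (cpair p)) ^+ 2 * wt p)%:E by have [-> _] := cvg_limn_einf_sup h.
  apply: cvg_EFin; first by near=> n.
  have h := ccvg_cmod (bw (cpair p) pr).
  by apply: cvgM; [exact: (cvgM h h)|exact: cvg_cst].
move=> /le_trans; apply; rewrite limn_einf_lim; apply: lime_le; first exact: is_cvg_einfs.
near=> n; apply: (@le_trans _ _ (\int[lam2]_(p in ddisc 1) f n p)%E).
  by apply: ereal_inf_lbound; exists n => /=.
rewrite [X in (X <= _)%E](area_psum_weighted b n ltr01 (lexx 1)) lee_fin ler_wpM2l //; first exact: mom_ge0.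
apply: le_trans (bM n); apply: ler_sum => i _; apply: ler_wpM2l; first exact: sqr_ge0.
rewrite !expr1n le_eqVlt; apply/orP; left; apply/eqP.
by rewrite !div1r inv_mul_succ.
Unshelve. all: by end_near.
Qed.

(** On the disc of radius [r < 1] some long partial sum is within 1 of [w], so its integral is
    controlled by that of [w]; then [r] tends to 1. *)
Lemma area_expands_ge b (w : C -> C) : expands b w ->
  (\area_1 (fun p => (cmod (w (cpair p)) ^+ 2 * wt p)%R) < +oo)%E ->
  exists M, forall n, \sum_(i < n) cmod (b i) ^+ 2 / (i.+1%:R * i.+2%:R) <= M.
Proof.
move=> bw; set I := (X in (X < _)%E) => Ioo.
have mD r := @measurable_ddisc R r.
have w0 r p : r <= 1 -> ddisc r p -> 0 <= cmod (w (cpair p)) ^+ 2 * wt p.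
  by move=> r1 pr; rewrite mulr_ge0 ?sqr_ge0 // (wt_ge0 r1 pr).
have mw r : r <= 1 -> measurable_fun (ddisc r) (fun p => cmod (w (cpair p)) ^+ 2 * wt p).
  by move=> r1; apply: measurable_funM; [exact: measurable_expands bw|exact: measurable_wt].
have I0 : (0 <= I)%E by apply: integral_ge0 => p pr; rewrite lee_fin (w0 1).
have [J IJ] : exists J, I = J%:E by exists (fine I); rewrite fineK // ge0_fin_numE.
have A0 := @mom0_gt0 R.
exists ((2 * J + 2 * mom R 0) / mom R 0) => n.
(* The index is shifted because the disc of radius [r] provides the power [q ^+ i.+1], where
   [q = r ^+ 2], for the coefficient [b i]. *)
pose x i : R := if i is j.+1 then cmod (b j) ^+ 2 / (j.+1%:R * j.+2%:R) else 0.
have x0 i : 0 <= x i by case: i => [|i] //=; rewrite divr_ge0 ?sqr_ge0 ?mulr_ge0.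
suff H : \sum_(i < n.+1) x i <= (2 * J + 2 * mom R 0) / mom R 0.
  by move: H; rewrite big_ord_recl add0r.
have J0 : 0 <= J by rewrite -lee_fin -IJ.
apply: sum_geom_limit => // q q0 q1; rewrite big_ord_recl mul0r add0r.
have [->|qn0] := eqVneq q 0.
  rewrite big1 ?divr_ge0 ?addr_ge0 ?mulr_ge0 ?(ltW A0) // => i _.
  by rewrite expr0n mulr0.
have {}q0 : 0 < q by rewrite lt_neqAle eq_sym qn0.
set r := Num.sqrt q; have r0 : 0 < r by rewrite sqrtr_gt0.
have r2 : r ^+ 2 = q by rewrite sqr_sqrtr // ltW.
have r1 : r < 1 by rewrite -(ltr_pXn2r (n := 2)) ?nnegrE ?(ltW r0) // r2 expr1n.
have [N NP] := expands_uniform bw (ltW r0) r1 ltr01.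
have nL := leq_addr N n; set L := (n + N)%N in nL.
have HL p : ddisc r p -> cmod (psum b (cpair p) L) ^+ 2 * wt p <= 2 * (cmod (w (cpair p)) ^+ 2 * wt p) + 2.
  move=> pr; have h : cmod (w (cpair p) - psum b (cpair p) L) <= 1 by apply: NP; rewrite ?leq_addl // ltW.
  have h2 : cmod (psum b (cpair p) L) ^+ 2 <= 2 * cmod (w (cpair p)) ^+ 2 + 2.
    have := sqr_cmodD_le (w (cpair p)) (psum b (cpair p) L - w (cpair p)).
    rewrite (addrC (w (cpair p))) subrK => /le_trans; apply; rewrite lerD2l cmodC.
    by have := cmod_ge0 (w (cpair p) - psum b (cpair p) L); clear - h; nra.
  have w1 : wt p <= 1 by rewrite /wt lerBlDr lerDl sqr_ge0.
  have w2 := wt_ge0 (ltW r1) pr.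
  by have := ler_wpM2r w2 h2; lra.
have : (\area_r (fun p => (cmod (psum b (cpair p) L) ^+ 2 * wt p)%R) <= (2 * J + 2 * mom R 0)%:E)%E.
  apply: (@le_trans _ _ (\int[lam2]_(p in ddisc r) (2%:E * (cmod (w (cpair p)) ^+ 2 * wt p)%:E + 2%:E))%E).
    apply: ge0_le_integral => //.
    - by move=> p pr; rewrite lee_fin mulr_ge0 ?sqr_ge0 // (wt_ge0 (ltW r1) pr).
    - apply/measurable_EFinP; apply: measurable_funM; last exact: measurable_wt.
      by apply: (@cmeas_sqr_cmod _ _ (fun p => psum b (cpair p) L)); exact: cmeas_psum.
    - apply: emeasurable_funD; last exact: measurable_cst.
      by apply: measurable_funeM; apply/measurable_EFinP; apply: mw; exact: ltW.
  have p1 p : ddisc r p -> (0 <= 2%:E * (cmod (w (cpair p)) ^+ 2 * wt p)%:E)%E.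
    by move=> pr; rewrite -EFinM lee_fin mulr_ge0 // (w0 r _ (ltW r1)).
  have m1 : measurable_fun (ddisc r) (fun p => 2%:E * (cmod (w (cpair p)) ^+ 2 * wt p)%:E)%E.
    by apply: measurable_funeM; apply/measurable_EFinP; apply: mw; exact: ltW.
  rewrite (ge0_integralD _ (mD r) p1 m1 (fun p _ => ltac:(rewrite lee_fin; exact: ler0n) : (0 <= 2%:E :> \bar R)%E) (measurable_cst _)).
  rewrite [leRHS](_ : _ = (2 * J)%:E + (2 * mom R 0)%:E)%E //; apply: leeD.
    have q1' p : ddisc r p -> (0 <= (cmod (w (cpair p)) ^+ 2 * wt p)%:E)%E.
      by move=> pr; rewrite lee_fin (w0 r _ (ltW r1)).
    have q2 : measurable_fun (ddisc r) (fun p => (cmod (w (cpair p)) ^+ 2 * wt p)%:E).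
      by apply/measurable_EFinP; apply: mw; exact: ltW.
    rewrite (ge0_integralZl_EFin _ (mD r) q1' q2) //.
    rewrite EFinM -IJ lee_wpmul2l // /I.
    apply: ge0_subset_integral => //; last exact/ddisc_sub/ltW.
    - by apply/measurable_EFinP; exact: mw.
    - by move=> p pr; rewrite lee_fin (w0 1).
  rewrite integral_cst // EFinM lee_wpmul2l // -momP moment0.
  apply: le_trans (le_measure _ _ _ (ddisc_sub (ltW r1))) (lexx _); rewrite inE; exact: mD.
rewrite area_psum_weighted ?(ltW r1) // lee_fin => H.
rewrite ler_pdivlMr // mulrC; apply: le_trans H; apply: ler_wpM2l; first exact: ltW.
rewrite /L big_split_ord /= -[X in X <= _]addr0; apply: lerD.
  apply: ler_sum => i _; rewrite -mulrA; apply: ler_wpM2l; first exact: sqr_ge0.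
  rewrite double_succ4 double_succ2.
  rewrite exprD !exprM r2 /bump /= add1n.
  have Q0 : 0 <= q ^+ i.+1 by rewrite exprn_ge0 // ltW.
  set Q := q ^+ i.+1 in Q0 *.
  rewrite inv_mul_succ mulrBl ![_^-1 * Q]mulrC.
  rewrite lerD2l lerN2 ler_wpM2r ?invr_ge0 ?ler0n // ler_piMr // ltW //.
apply: sumr_ge0 => i _; rewrite mulr_ge0 ?sqr_ge0 // subr_ge0.
rewrite -[4%N]/(2 + 2)%N addnA.
rewrite [X in X / _ <= _]exprD; apply: ler_pM; rewrite ?invr_ge0 ?mulr_ge0 ?exprn_ge0 ?(ltW r0) //.
  by rewrite ler_piMr ?exprn_ge0 ?(ltW r0) // r2 ltW.
by rewrite lef_pV2 ?posrE // ler_nat.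
Qed.

End WeightedArea.

(** * Local Dirichlet integrals *)

Section HardyCopson.
Variable R : realType.
Implicit Types (x y : nat -> R).

(** [y n] is the tail sum of the [x m / m.+1]. The induction closes with the boundary term
    [2 * K * y K ^+ 2], which vanishes at [K = N]. *)
Lemma copson_ineq x y N : (forall n, 0 <= x n) -> y N = 0 ->
  (forall n, y n = y n.+1 + x n / n.+1%:R) ->
  \sum_(n < N) y n ^+ 2 <= 4 * \sum_(n < N) x n ^+ 2.
Proof.
move=> x0 yN yS.
have H K : \sum_(n < K) y n ^+ 2 <= 4 * \sum_(n < K) x n ^+ 2 + 2 * (K%:R * y K ^+ 2).
  elim: K => [|K IH]; first by rewrite !big_ord0 mul0r !mulr0 addr0.
  rewrite !big_ord_recr /=.
  have K0 : (0 : R) < K.+1%:R by [].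
  have xE : x K = K.+1%:R * (y K - y K.+1) by rewrite yS addrAC subrr add0r mulrC divfK ?gt_eqF.
  have KE : K.+1%:R = K%:R + 1 :> R by rewrite natr1.
  have k0 : (0 : R) <= K%:R by [].
  move: IH; rewrite xE KE; move: (y K) (y K.+1) (K%:R) k0 => u v k k0 IH.
  set A := \sum_(i < K) _ in IH *; set B := \sum_(i < K) _ in IH *.
  have h : 0 <= (k + 1) * (u - v) ^+ 2 by rewrite mulr_ge0 ?sqr_ge0 //; lra.
  have h2 : 0 <= ((2 * (k + 1) * (u - v)) - u) ^+ 2 by exact: sqr_ge0.
  by move: IH h h2; lra.
by have := H N; rewrite yN expr0n !mulr0 addr0.
Qed.

(** The induction closes once the left side is strengthened by [2 / K] times the square of the
    [K]-th partial sum. *)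
Lemma hardy_ineq x N :
  \sum_(n < N) ((\sum_(m < n.+1) x m) / n.+1%:R) ^+ 2 <= 4 * \sum_(n < N) x n ^+ 2.
Proof.
suff H K : \sum_(n < K) ((\sum_(m < n.+1) x m) / n.+1%:R) ^+ 2 +
    2 * ((\sum_(m < K) x m) ^+ 2 / K%:R) <= 4 * \sum_(n < K) x n ^+ 2.
  apply: le_trans (H N); rewrite lerDl mulr_ge0 // divr_ge0 ?sqr_ge0 //.
elim: K => [|K IH]; first by rewrite !big_ord0 expr0n mul0r !mulr0 addr0.
rewrite [in leLHS]big_ord_recr [in leRHS]big_ord_recr /=.
have [->|K0] := posnP K.
  rewrite !big_ord0 !big_ord1 !add0r -[1%:R]/(1 : R) !divr1.
  by have := sqr_ge0 (x 0%N); lra.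
have k0 : (0 : R) < K%:R by rewrite ltr0n.
rewrite big_ord_recr /= -natr1; move: IH.
set A := \sum_(n < K) (_ / _) ^+ 2; set B := \sum_(n < K) x n ^+ 2; set X := \sum_(m < K) x m.
move: (x K) (K%:R : R) k0 => t k k0 IH.
have k10 : 0 < k + 1 by lra.
have h : 0 <= X ^+ 2 / k - 2 * X * ((X + t) / (k + 1)) + k * ((X + t) / (k + 1)) ^+ 2.
  rewrite (_ : X ^+ 2 / k - _ + _ = k * (X / k - (X + t) / (k + 1)) ^+ 2).
    by rewrite mulr_ge0 ?sqr_ge0 ?ltW.
  by field; rewrite !gt_eqF.
set a := (X + t) / (k + 1) in h *.
have aE : (k + 1) * a = X + t by rewrite /a mulrC divfK ?gt_eqF.
have -> : (X + t) ^+ 2 / (k + 1) = (k + 1) * a ^+ 2.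
  by rewrite /a; field; rewrite gt_eqF.
have h2 : 0 <= (a - 2 * t) ^+ 2 by exact: sqr_ge0.
have tE : t = (k + 1) * a - X by rewrite aE addrC addKr.
have h3 : a * t = (k + 1) * a ^+ 2 - X * a by rewrite tE; ring.
by move: IH h h2 h3; rewrite !expr2; lra.
Qed.

Lemma sum_inv_sqr_le n : \sum_(m < n) (m.+1%:R ^+ 2)^-1 <= 2 :> R.
Proof.
suff H k : \sum_(m < k) (m.+1%:R ^+ 2)^-1 <= 2 - 2 / k.+1%:R :> R.
  by apply: le_trans (H n) _; rewrite gerBl divr_ge0.
elim: k => [|k IH]; first by rewrite big_ord0 divr1 subrr.
rewrite big_ord_recr /=.
have k1 : (0 : R) < k.+1%:R by [].
have k2 : (0 : R) < k.+2%:R by [].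
have h : (k.+1%:R ^+ 2)^-1 <= 2 * (k.+1%:R^-1 - k.+2%:R^-1) :> R.
  rewrite -inv_mul_succ -[leLHS]mul1r -ler_pdivlMr ?invr_gt0 ?exprn_gt0 // invrK.
  have -> : 2 * (k.+1%:R * k.+2%:R)^-1 * k.+1%:R ^+ 2 = 2 * k.+1%:R / k.+2%:R :> R.
    by field; rewrite !gt_eqF.
  by rewrite ler_pdivlMr // mul1r -natrM ler_nat; lia.
move: IH h; set A := \sum_(m < k) _; set p := _ ^- 2; set q := _^-1; set r := _^-1.
by lra.
Qed.

End HardyCopson.

(** * Local Dirichlet integrals in terms of Taylor coefficients *)

Section LocalDirichlet.
Variable R : realType.
Local Notation C := R[i].
Implicit Types (a b c : nat -> C) (f g u w : C -> C) (zeta : C).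

Lemma ccvg_sum_sqr_le n (u : nat -> nat -> C) (l : nat -> C) (B : R) N0 :
  (forall i, ccvg (u i) (l i)) ->
  (forall N, (N0 <= N)%N -> \sum_(i < n) cmod (u i N) ^+ 2 <= B) ->
  \sum_(i < n) cmod (l i) ^+ 2 <= B.
Proof.
move=> ul uB.
have H : (fun N => \sum_(i < n) cmod (u i N) ^+ 2) @ \oo --> \sum_(i < n) cmod (l i) ^+ 2.
  elim: n {uB} => [|n IH].
    rewrite big_ord0 (_ : (fun N => _) = fun=> 0); first exact: cvg_cst.
    by apply/funext => N; rewrite big_ord0.
  rewrite big_ord_recr (_ : (fun N => _) = fun N => \sum_(i < n) cmod (u i N) ^+ 2 + cmod (u n N) ^+ 2).
    by apply: cvgD => //; have h := ccvg_cmod (ul n); exact: (cvgM h h).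
  by apply/funext => N; rewrite big_ord_recr.
rewrite -(cvg_lim _ H) //; apply: limr_le; first by apply/cvg_ex; eexists; exact: H.
by exists N0 => // N /= NN; exact: uB.
Qed.

Lemma disc_sub_neq0 zeta z : cmod zeta = 1 -> in_disc z -> zeta - z != 0.
Proof.
move=> z1 zD; rewrite subr_eq0; apply/eqP => E.
by move: zD; rewrite /in_disc -E z1 ltxx.
Qed.

Lemma one_sub_neq0 (w z : C) : cmod w <= 1 -> in_disc z -> 1 - w * z != 0.
Proof.
move=> w1 zD; rewrite subr_eq0; apply/eqP => E.
have : cmod (w * z) < 1 by rewrite cmodM; apply: le_lt_trans zD; rewrite ler_piMl ?cmod_ge0.
by rewrite -E cmod1 ltxx.
Qed.

Lemma expands_geometric (w : C) : cmod w <= 1 ->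
  expands (fun i => w ^+ i) (fun z => (1 - w * z)^-1).
Proof.
move=> w1.
have [K HK] : exists K, expands (fun i => w ^+ i) K.
  apply: subgeom_expands; apply: (@bounded_subgeom _ _ 1) => i.
  by rewrite cmodX exprn_ile1 ?cmod_ge0.
apply: (expands_ext _ (HK)) => z zD; have := expandsB HK (expandsZ w (expandsX HK)).
move=> /(_ z zD); have -> : K z - w * (z * K z) = (1 - w * z) * K z by ring.
have zz := one_sub_neq0 w1 zD.
have h : ccvg (psum (fun i => w ^+ i - w * mulX (fun i => w ^+ i) i) z) 1.
  apply: ccvg_ext (expands_cst 1 zD) => n; apply: eq_bigr => -[[|i] _] _ /=.
    by rewrite mulr0 subr0.
  by rewrite -exprS subrr.
by move=> /ccvg_unique/(_ h) E; apply: (mulfI zz); rewrite E divff.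
Qed.

Lemma expands_kernel zeta : cmod zeta = 1 ->
  expands (fun i => zeta^-1 * zeta^-1 ^+ i) (fun z => (zeta - z)^-1).
Proof.
move=> z1; have zn0 : zeta != 0 by rewrite -cmod_gt0 z1.
have w1 : cmod zeta^-1 <= 1 by rewrite cmodV z1 invr1.
apply: (expands_ext _ (expandsZ zeta^-1 (expands_geometric w1))) => z zD.
by rewrite -invfM mulrBr mulr1 mulrA divff // mul1r.
Qed.

Lemma expands_div_sub zeta b w : cmod zeta = 1 -> expands b w ->
  exists y, [/\ expands y (fun z => w z / (zeta - z)), 
    (forall n, cmod (y n) <= \sum_(m < n.+1) cmod (b m)),
    zeta * y 0%N = b 0%N & forall n, zeta * y n.+1 - y n = b n.+1].
Proof.
move=> z1 bw; exists (cauchy_prod b (fun i => zeta^-1 * zeta^-1 ^+ i)).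
have zn0 : zeta != 0 by rewrite -cmod_gt0 z1.
have E := expands_cauchy_prod bw (expands_kernel z1).
have U := expandsB (expandsZ zeta E) (expandsX E).
have {}U : expands (fun i => zeta * cauchy_prod b (fun i => zeta^-1 * zeta^-1 ^+ i) i -
    mulX (cauchy_prod b (fun i => zeta^-1 * zeta^-1 ^+ i)) i) w.
  apply: expands_ext U => z zD; have zz := disc_sub_neq0 z1 zD.
  by rewrite -mulrBl mulrCA divff // mulr1.
split => [//|n||n]; last exact: (expands_unique U bw n.+1).
  apply: (le_trans (cmod_sum _ _ _)); apply: ler_sum => i _.
  by rewrite !cmodM cmodX cmodV z1 invr1 expr1n !mulr1.
by have /= := expands_unique U bw 0%N; rewrite subr0.
Qed.

Lemma ccvg_Cauchy_tail a l n : ccvg (fun N => \sum_(i < N) a i) l ->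
  ccvg (fun N => \sum_(i < N) a (n + i)%N) (l - \sum_(i < n) a i).
Proof.
move=> /(ccvg_shift n) al; have := ccvgD al (ccvg_cst (- \sum_(i < n) a i)).
apply: ccvg_ext => N; rewrite addnC big_split_ord /= addrAC subrr add0r //.
Qed.

(** Comparing coefficients in [g' = (zeta - z) w] gives [a i.+1 = zeta * W i.+1 - W i + s i] with
    [W] square summable and [s i = W i / i.+1]. The first two terms already have the form of
    [(z - zeta) u]; the last is [t i - zeta * t i.+1] for weighted tail sums [t], square summable by
    Copson's inequality. *)
Lemma dirichlet_local zeta a g g' b : cmod zeta = 1 -> expands a g -> expands (dcoef a) g' ->
  expands b (fun z => g' z / (zeta - z)) ->
  (exists M, forall n, \sum_(i < n) cmod (b i) ^+ 2 / (i.+1%:R * i.+2%:R) <= M) ->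
  exists (k : C) u, hardy u /\ forall z, in_disc z -> g z = k + (z - zeta) * u z.
Proof.
move=> z1 ag ag' bw [M bM].
have zn0 : zeta != 0 by rewrite -cmod_gt0 z1.
pose W i : C := if i is j.+1 then b j / j.+1%:R else 0.
have W2 : l2 W.
  exists (2 * M) => -[|n]; first by have := bM 0%N; rewrite !big_ord0; lra.
  rewrite big_ord_recl /= cmod0 expr0n add0r; apply: le_trans (ler_wpM2l _ (bM n)) => //.
  rewrite mulr_sumr; apply: ler_sum => i _; rewrite cmod_div cmod_nat /= add0n expr_div_n.
  rewrite mulrCA ler_wpM2l ?sqr_ge0 // expr2 invfM.
  have i1 : (0 : R) < i.+1%:R by [].
  have i2 : (0 : R) < i.+2%:R by [].
  rewrite ler_pdivlMr ?mulr_gt0 // (_ : _ * (_ * _) = i.+2%:R / i.+1%:R); last first.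
    by field; rewrite gt_eqF.
  by rewrite ler_pdivrMr // -natrM ler_nat; lia.
have [K WK] := W2.
pose s i : C := W i / i.+1%:R.
have aW i : a i.+1 = zeta * W i.+1 - W i + s i.
  have [y [Ey _ y0 yS]] := expands_div_sub z1 ag'.
  have yb := expands_unique Ey bw; rewrite /dcoef in y0 yS.
  have N0 j : (j.+1%:R : C) != 0 by rewrite -cmod_eq0 cmod_nat pnatr_eq0.
  case: i => [|i]; rewrite /s /W.
    by rewrite -yb mulrA y0 mul0r subr0 addr0 mul1r divr1.
  have := yS i; rewrite !yb => E; apply: (mulfI (N0 i.+1)); rewrite -E.
  have := N0 i.+1; have := N0 i; rewrite -[in X in _ -> X]natr1 => n1 n2.
  by move: n1 n2; move: (i.+1%:R : C) => q n1 n2; field; rewrite ?n1 ?n2.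
have sK : exists l, ccvg (fun N => \sum_(i < N) s i * zeta ^+ i) l.
  apply: (@abs_summable_ccvg _ (fun i => s i * zeta ^+ i) (K / 2 + 1)) => n.
  apply: (@le_trans _ _ (\sum_(i < n) (cmod (W i) ^+ 2 / 2 + (i.+1%:R ^+ 2)^-1 / 2))).
    apply: ler_sum => i _; rewrite cmodM cmodX z1 expr1n mulr1 cmod_div cmod_nat.
    have := sqr_ge0 (cmod (W i) - i.+1%:R^-1); rewrite -exprVn; set v := i.+1%:R^-1; lra.
  rewrite big_split /= -!mulr_suml; apply: lerD; first by rewrite ler_wpM2r ?WK.
  by have := sum_inv_sqr_le R n; lra.
have [t0 st0] := sK.
(* The tail sum of [s m * zeta ^+ (m - n)] over [m >= n]. *)
pose t n := (zeta ^+ n)^-1 * (t0 - \sum_(i < n) s i * zeta ^+ i).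
have tS n : t n = s n + zeta * t n.+1.
  rewrite /t big_ord_recr /= exprS; have := expf_neq0 n zn0 => zn; field; exact/andP.
have t2 : l2 t.
  exists (4 * K) => n.
  apply: (@ccvg_sum_sqr_le n (fun i N => (zeta ^+ i)^-1 * \sum_(j < N) s (i + j)%N * zeta ^+ (i + j)) t _ 0%N).
    by move=> i; apply: ccvgZ; exact: (ccvg_Cauchy_tail (a := fun i => s i * zeta ^+ i) i st0).
  move=> N _.
  (* Cutting off at [n + N] makes the tail sums finite and the last one zero, as Copson's inequality
     requires; the bound does not depend on [N]. *)
  pose x i := if (i < n + N)%N then cmod (W i) else 0.
  pose y i := \sum_(j < n + N - i) x (i + j)%N / (i + j).+1%:R.
  have x0 i : 0 <= x i by rewrite /x; case: ifP => // _; exact: cmod_ge0.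
  apply: (@le_trans _ _ (\sum_(i < n + N) y i ^+ 2)).
    rewrite big_split_ord /= -[leLHS]addr0; apply: lerD; last by apply: sumr_ge0 => i _; exact: sqr_ge0.
    apply: ler_sum => i _; rewrite lerXn2r ?nnegrE ?cmod_ge0 //.
      by apply: sumr_ge0 => j _; rewrite divr_ge0.
    rewrite cmodM cmodV cmodX z1 expr1n invr1 mul1r.
    rewrite /y; have -> : (n + N - i = N + (n - i))%N by have := ltn_ord i; lia.
    apply: (le_trans (cmod_sum _ _ _)); rewrite big_split_ord /= -[leLHS]addr0; apply: lerD.
      apply: ler_sum => j _; rewrite cmodM cmodX z1 expr1n mulr1 cmod_div cmod_nat /x ifT //.
      by have := ltn_ord i; have := ltn_ord j; lia.
    by apply: sumr_ge0 => j _; rewrite divr_ge0.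
  apply: (@le_trans _ _ (4 * \sum_(i < n + N) x i ^+ 2)).
    apply: copson_ineq => //; first by rewrite /y subnn big_ord0.
    move=> i; rewrite /y; have [iN|iN] := ltnP i (n + N).
      have -> : (n + N - i = (n + N - i.+1).+1)%N by lia.
      rewrite big_ord_recl addn0 addrC; congr (_ + _); apply: eq_bigr => j _.
      by rewrite lift0 addSnnS.
    have -> : (n + N - i = 0)%N by lia.
    have -> : (n + N - i.+1 = 0)%N by lia.
    by rewrite !big_ord0 /x ifF ?mul0r ?addr0 // ltnNge iN.
  rewrite ler_wpM2l //; apply: le_trans (WK (n + N)%N); apply: ler_sum => i _.
  by rewrite /x ltn_ord.
(* Forced by the coefficient of degree 0, since [W 0 = 0]. *)
exists (a 0%N + zeta * t 0%N).
have l2u : l2 (fun i => t i - W i).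
  by have := l2D t2 (l2Z (-1) W2); apply: l2_le => i; rewrite mulN1r.
have [u ut] : exists u, expands (fun i => t i - W i) u.
  apply: subgeom_expands; have [B HB] := l2u; apply: (@bounded_subgeom _ _ (B + 1)) => i.
  have := HB i.+1; rewrite big_ord_recr /= => h.
  have : cmod (t i - W i) ^+ 2 <= B.
    by apply: le_trans h; rewrite lerDr sumr_ge0 // => j _; exact: sqr_ge0.
  by have := cmod_ge0 (t i - W i); set v := cmod _; nra.
exists u; split; first by exists (fun i => t i - W i).
move=> z zD; have := expandsD (expands_cst (a 0%N + zeta * t 0%N)) (expandsB (expandsX ut) (expandsZ zeta ut)).
move=> /(_ z zD); rewrite -mulrBl => h; apply: ccvg_unique h.
apply: ccvg_ext (ag z zD) => n; apply: eq_bigr => -[[|i] _] _ /=; congr (_ * _).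
  by rewrite /W; ring.
by rewrite aW (tS i) -[b i / _]/(W i.+1); ring.
Qed.

(** Here [g' / (zeta - z) = u / (zeta - z) - u']. The coefficients of the first term are bounded by
    partial sums of moduli, to which Hardy's inequality applies; the factor [n.+1] in those of [u']
    is compensated by the weight. *)
Lemma local_dirichlet_coef zeta (k : C) u a g g' : cmod zeta = 1 -> hardy u -> expands a g ->
  (forall z, in_disc z -> g z = k + (z - zeta) * u z) -> expands (dcoef a) g' ->
  exists b, expands b (fun z => g' z / (zeta - z)) /\
  exists M, forall n, \sum_(i < n) cmod (b i) ^+ 2 / (i.+1%:R * i.+2%:R) <= M.
Proof.
move=> z1 [v vu [M vM]] ag gE ag'.
have zn0 : zeta != 0 by rewrite -cmod_gt0 z1.
have [b [bE _ b0 bS]] := expands_div_sub z1 ag'.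
have [y [yE yb y0 yS]] := expands_div_sub z1 vu.
have av := expandsD (expands_cst k) (expandsB (expandsX vu) (expandsZ zeta vu)).
have {}av : expands (fun i => (if i is 0%N then k else 0) + (mulX v i - zeta * v i)) g.
  by apply: (expands_ext _ (av)) => z zD; rewrite gE // -mulrBl.
have aE i : a i.+1 = v i - zeta * v i.+1.
  by rewrite (expands_unique ag av i.+1) /= add0r.
have bE2 n : b n = y n - n.+1%:R * v n.+1.
  elim: n => [|n IH].
    apply: (mulfI zn0); rewrite b0 /dcoef aE [in RHS]mulrBr y0; ring.
  apply: (mulfI zn0); apply: (addIr (- b n)); rewrite bS IH /dcoef aE.
  rewrite [zeta * (y _ - _)]mulrBr (_ : zeta * y n.+1 = v n.+1 + y n); last by rewrite -yS subrK.
  by rewrite -(natr1 n.+1); ring.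
exists b; split => //; exists (2 * (4 * M) + 2 * M) => n.
apply: (@le_trans _ _ (\sum_(i < n) (2 * ((\sum_(m < i.+1) cmod (v m)) / i.+1%:R) ^+ 2 + 2 * cmod (v i.+1) ^+ 2))).
  apply: ler_sum => i _; rewrite bE2.
  have i1 : (0 : R) < i.+1%:R by [].
  have i2 : i.+1%:R <= i.+2%:R :> R by rewrite ler_nat.
  rewrite ler_pdivrMr; last by rewrite mulr_gt0.
  have h := sqr_cmodD_le (y i) (- (i.+1%:R * v i.+1)).
  apply: (le_trans h); rewrite cmodN cmodM cmod_nat exprMn.
  have hy : cmod (y i) ^+ 2 <= (\sum_(m < i.+1) cmod (v m)) ^+ 2.
    by rewrite lerXn2r ?nnegrE ?cmod_ge0 ?sumr_ge0 // => m _; exact: cmod_ge0.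
  have E : ((\sum_(m < i.+1) cmod (v m)) / i.+1%:R) ^+ 2 * i.+1%:R ^+ 2 = (\sum_(m < i.+1) cmod (v m)) ^+ 2.
    by rewrite -exprMn divfK // gt_eqF.
  rewrite -E in hy; move: hy; set A := (_ / _) ^+ 2; set B := cmod (v _) ^+ 2 => hy.
  have A0 : 0 <= A by exact: sqr_ge0.
  have B0 : 0 <= B by exact: sqr_ge0.
  have : i.+1%:R ^+ 2 <= i.+1%:R * i.+2%:R :> R by rewrite expr2 ler_wpM2l // ltW.
  move=> /(ler_wpM2l (addr_ge0 A0 B0)); move: hy; lra.
rewrite big_split /= -!mulr_sumr; apply: lerD; apply: ler_wpM2l => //.
  by apply: le_trans (hardy_ineq (fun i => cmod (v i)) n) _; rewrite ler_wpM2l.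
by apply: le_trans (vM n.+1); rewrite [leRHS]big_ord_recl lerDr sqr_ge0.
Qed.

End LocalDirichlet.

(** * Membership in D(mu) as a decomposition at each point mass *)

Section DirichletSpace.
Variable R : realType.
Local Notation C := R[i].
Local Notation mu := (@lebesgue_measure R).
Local Notation lam2 := (mu \x mu)%E.
Local Notation cpair := (@cpair R).
Local Notation wt := (@wt R).
Local Notation ddisc := (@ddisc R).
Implicit Types (f g u w : C -> C) (zeta : C).
Local Notation "'\area_' r g" := (\int[lam2]_(p in ddisc r) (g p)%:E)%E
  (at level 36, r at level 0, g at level 36).

(** The constant [c] is the radial limit of [g] at [zeta], by [radial0_hardy], and acts as the value
    of [g] there. *)
Definition divisible_at zeta g : Prop :=
  exists (c : C) (u : C -> C), hardy u /\ forall z, in_disc z -> g z = c + (z - zeta) * u z.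

(** The Poisson kernel at [zeta] is [(1 - |z|^2) / |zeta - z|^2]; moving its denominator into the
    analytic function leaves a radial weight, for which monomials are orthogonal. *)
Lemma dirichlet_integral_sum k (a : 'I_k -> R) (zeta : 'I_k -> C) al fp g :
  (forall i, 0 < a i) -> (forall i, cmod (zeta i) = 1) -> expands al g ->
  (forall z, in_disc z -> fp z = g z) ->
  (dirichlet_integral a zeta fp =
  \sum_(i < k) (a i)%:E * \area_1 (fun p => (cmod (g (cpair p) / (zeta i - cpair p)) ^+ 2 * wt p)%R))%E.
Proof.
move=> a0 z1 alg fg; have mD := @measurable_ddisc R 1.
pose F i p := (cmod (g (cpair p) / (zeta i - cpair p)) ^+ 2 * wt p)%:E.
have F0 i p : ddisc 1 p -> (0 <= F i p)%E.
  by move=> pr; rewrite lee_fin mulr_ge0 ?sqr_ge0 // (wt_ge0 (lexx 1) pr).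
have mF i : measurable_fun (ddisc 1) (F i).
  apply/measurable_EFinP; apply: measurable_funM; last exact: measurable_wt.
  have [y [yE _ _ _]] := expands_div_sub (z1 i) alg.
  exact: measurable_expands yE.
rewrite [RHS](_ : _ = \sum_(i < k) \int[lam2]_(p in ddisc 1) ((a i)%:E * F i p))%E; last first.
  by apply: eq_bigr => i _; rewrite (ge0_integralZl_EFin _ mD (F0 i) (mF i) (ltW (a0 i))).
rewrite -ge0_integral_sum //; last 2 first.
- by move=> i; apply: measurable_funeM; exact: mF.
- by move=> i p pr; rewrite mule_ge0 ?F0 // lee_fin ltW.
rewrite /dirichlet_integral; apply: eq_integral => p; rewrite inE => pr.
rewrite sumEFin; congr EFin; rewrite /phi_mu mulr_sumr fg //; apply: eq_bigr => i _.
rewrite cmod_div /F /wt; have := disc_sub_neq0 (z1 i) pr; rewrite -cmod_gt0 => h.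
by rewrite -[Complex p.1 p.2]/(cpair p); field; rewrite gt_eqF.
Qed.

Lemma in_DmuP k (a : 'I_k -> R) (zeta : 'I_k -> C) g : (0 < k)%N ->
  (forall i, 0 < a i) -> (forall i, cmod (zeta i) = 1) ->
  in_Dmu a zeta g <-> (exists al, expands al g) /\ forall i, divisible_at (zeta i) g.
Proof.
move=> k0 a0 z1; split.
  move=> [_ [fp [fpd Doo]]]; have [al alg] := taylor (ex_intro _ fp fpd).
  split; first by exists al.
  have [g' alg' gd] := expands_analytic alg.
  have fg z : in_disc z -> fp z = g' z by move=> zD; exact: is_cderive_unique (fpd z zD) (gd z zD).
  move: Doo; rewrite (dirichlet_integral_sum a0 z1 alg' fg) => Doo i.
  have I0 j : (0 <= \area_1 (fun p => (cmod (g' (cpair p) / (zeta j - cpair p)) ^+ 2 * wt p)%R))%E.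
    by apply: integral_ge0 => p pr; rewrite lee_fin mulr_ge0 ?sqr_ge0 // (wt_ge0 (lexx 1) pr).
  have [b [bE _ _ _]] := expands_div_sub (z1 i) alg'.
  apply: (dirichlet_local (z1 i) alg alg' bE); apply: (area_expands_ge bE).
  have : ((a i)%:E * \area_1 (fun p => (cmod (g' (cpair p) / (zeta i - cpair p)) ^+ 2 * wt p)%R) < +oo)%E.
    apply: le_lt_trans Doo; rewrite (bigD1 i) //= leeDl // sume_ge0 // => j _.
    by rewrite mule_ge0 // lee_fin ltW.
  move: (I0 i); case: (integral _ _ _) => [x _ _|_|//]; first exact: ltry.
  by rewrite gt0_muley ?lte_fin.
move=> [[al alg] gdiv]; split.
  (* The decomposition at a single point already puts [g] in the Hardy space. *)
  have [c [u [uh gE]]] := gdiv (Ordinal k0).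
  have [b bg bl] : hardy g.
    apply: (@hardy_ext _ (fun z => c + (z * u z + - zeta (Ordinal k0) * u z))).
      by move=> z zD; rewrite gE // mulrBl mulNr.
    by apply: hardyD; [exact: hardy_cst|apply: hardyD; [exact: hardyX|exact: hardyZ]].
  by apply/(in_H2P bg).
have [g' alg' gd] := expands_analytic alg.
exists g'; split => //; rewrite (dirichlet_integral_sum a0 z1 alg' (fun _ _ => erefl)).
apply: lte_sum_pinfty => i _; apply: lte_mul_pinfty => //; first by rewrite lee_fin ltW.
have [c [u [uh gE]]] := gdiv i.
have [b [bE [M bM]]] := local_dirichlet_coef (z1 i) uh alg gE alg'.
by apply: le_lt_trans (area_expands_le bE bM) _; rewrite ltry.
Qed.

End DirichletSpace.

(** * Multipliers *)

Section RadialLimits.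
Variable R : realType.
Local Notation C := R[i].
Implicit Types (f g h u v : C -> C) (zeta : C).

(* [h (r * zeta) -> 0] as [r -> 1-] *)
Definition radial0 zeta h : Prop := forall e : R, 0 < e -> exists2 d : R, 0 < d &
  forall r, 0 <= r -> 1 - d < r -> r < 1 -> cmod (h (real_complex R r * zeta)) < e.

Lemma in_disc_radial zeta r : cmod zeta = 1 -> 0 <= r -> r < 1 -> in_disc (real_complex R r * zeta).
Proof. by move=> z1 r0 r1; rewrite /in_disc cmodM cmod_real z1 mulr1 ger0_norm. Qed.

(** The pointwise bound for Hardy functions makes [(1 - r) * cmod (u z)] of order [sqrt (1 - r)]. *)
Lemma radial0_hardy zeta u : cmod zeta = 1 -> hardy u -> radial0 zeta (fun z => (z - zeta) * u z).
Proof.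
move=> z1 [c cu [M cM]] e e0.
have M0 : 0 <= M by have := cM 0%N; rewrite big_ord0.
have M1 : 0 < M + 1 by lra.
exists (e ^+ 2 / (M + 1)); first by rewrite divr_gt0 ?exprn_gt0.
move=> r r0 rd r1; have rD := in_disc_radial z1 r0 r1.
have := expands_pointwise cu cM rD; set w := _ * zeta in rD *.
have -> : cmod w = r by rewrite cmodM cmod_real z1 mulr1 ger0_norm.
rewrite cmodM (_ : w - zeta = real_complex R (r - 1) * zeta); last by rewrite /w rmorphB /=; ring.
rewrite cmodM cmod_real z1 mulr1 ltr0_norm ?subr_lt0 // opprB.
set U := cmod (u w) => h; have U0 : 0 <= U by exact: cmod_ge0.
rewrite -(ltr_pXn2r (n := 2)) ?nnegrE ?mulr_ge0 ?(ltW e0) //; last by lra.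
have h2 : (1 - r) * (M + 1) < e ^+ 2 by rewrite -ltr_pdivlMr //; lra.
rewrite exprMn; apply: le_lt_trans h2.
have h3 : U ^+ 2 * (1 - r) <= M.
  apply: le_trans h; rewrite ler_wpM2l ?sqr_ge0 //.
  have : 0 <= r * (1 - r) by rewrite mulr_ge0 //; lra.
  by lra.
have q0 : 0 <= 1 - r by lra.
have := ler_wpM2l q0 h3; have -> : (1 - r) ^+ 2 * U ^+ 2 = (1 - r) * (U ^+ 2 * (1 - r)) by ring.
by lra.
Qed.

Lemma radial0D zeta g h : radial0 zeta g -> radial0 zeta h -> radial0 zeta (fun z => g z + h z).
Proof.
move=> g0 h0 e e0; have e20 : 0 < e / 2 by rewrite divr_gt0.
have [d d0 H] := g0 _ e20; have [d' d'0 H'] := h0 _ e20.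
exists (Num.min d d'); first by rewrite lt_min d0.
move=> r r0 rd r1; have [h1 h2] : 1 - d < r /\ 1 - d' < r.
  have := ge_min d d d'; have := ge_min d' d d'; rewrite !lexx orbT /= => a1 a2.
  by split; apply: le_lt_trans rd; rewrite lerD2l lerN2.
by rewrite (le_lt_trans (cmodD _ _)) // [e]splitr ltrD ?H ?H'.
Qed.

Lemma radial0Z zeta (k : C) h : radial0 zeta h -> radial0 zeta (fun z => k * h z).
Proof.
move=> h0 e e0; have k0 : 0 < cmod k + 1 by rewrite ltr_wpDl ?cmod_ge0.
have [d d0 H] := h0 _ (divr_gt0 e0 k0); exists d => // r r0 rd r1.
rewrite cmodM (le_lt_trans (y := (cmod k + 1) * cmod (h (real_complex R r * zeta)))) //.
  by rewrite ler_wpM2r ?cmod_ge0 // lerDl.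
by rewrite mulrC -ltr_pdivlMr // H.
Qed.

Lemma radial0M zeta g h : radial0 zeta g -> radial0 zeta h -> radial0 zeta (fun z => g z * h z).
Proof.
move=> g0 h0 e e0; have [d d0 H] := g0 1 ltr01; have [d' d'0 H'] := h0 _ e0.
exists (Num.min d d'); first by rewrite lt_min d0.
move=> r r0 rd r1; have [h1 h2] : 1 - d < r /\ 1 - d' < r.
  have := ge_min d d d'; have := ge_min d' d d'; rewrite !lexx orbT /= => a1 a2.
  by split; apply: le_lt_trans rd; rewrite lerD2l lerN2.
rewrite cmodM; apply: le_lt_trans (H' r r0 h2 r1).
by rewrite ler_piMl ?cmod_ge0 // ltW // H.
Qed.

Lemma radial0_ext zeta g h : cmod zeta = 1 ->
  (forall z, in_disc z -> g z = h z) -> radial0 zeta g -> radial0 zeta h.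
Proof.
move=> z1 gh g0 e /g0[d d0 H]; exists d => // r r0 rd r1.
by rewrite -gh; [exact: H|exact: in_disc_radial].
Qed.

Lemma radial0_cst zeta (k : C) : radial0 zeta (fun=> k) -> k = 0.
Proof.
move=> k0; apply/eqP; rewrite -cmod_eq0; apply/eqP/le_anti; rewrite cmod_ge0 andbT.
apply/ler_addgt0Pl => e /k0[d d0 H]; rewrite addr0.
have m0 : 0 < Num.min d 1 by rewrite lt_min d0 ltr01.
have m1 : Num.min d 1 <= 1 by rewrite ge_min lexx orbT.
have m2 : Num.min d 1 <= d by rewrite ge_min lexx.
by move: m0 m1 m2 => m0 m1 m2; apply/ltW/(H (1 - Num.min d 1 / 2)); lra.
Qed.

End RadialLimits.

(** * Multipliers of D(mu) act on the Hardy space *)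

Section Multipliers.
Variable R : realType.
Local Notation C := R[i].
Implicit Types (f g h u v : C -> C) (zeta : C) (s : seq C).

Lemma hardy_sub_mul zeta u : hardy u -> hardy (fun z => (z - zeta) * u z).
Proof.
move=> uh; have := hardyD (hardyX uh) (hardyZ (- zeta) uh).
by apply: hardy_ext => z _; rewrite mulrBl mulNr.
Qed.

Lemma hardy_prod_mul s u : hardy u -> hardy (fun z => (\prod_(w <- s) (z - w)) * u z).
Proof.
move=> uh; elim: s => [|w s IH].
  by apply: hardy_ext uh => z _; rewrite big_nil mul1r.
by apply: hardy_ext (hardy_sub_mul w IH) => z _; rewrite big_cons mulrA.
Qed.

Lemma prod_rem (s : seq C) w z : w \in s ->
  \prod_(v <- s) (z - v) = (z - w) * \prod_(v <- rem w s) (z - v).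
Proof. by move=> ws; rewrite (perm_big _ (perm_to_rem ws)) big_cons. Qed.

(* Lagrange interpolation: the polynomials [prod_(v in s, v <> w) (z - v)] span the constants. *)
Lemma hardy_of_partial_products s g : uniq s -> s != [::] ->
  (forall w, w \in s -> hardy (fun z => (\prod_(v <- rem w s) (z - v)) * g z)) -> hardy g.
Proof.
elim: s => [//|w1 s IH] /= /andP[w1s us] _ H.
have [E|sn0] := eqVneq s [::].
  have := H w1; rewrite E mem_seq1 eqxx => /(_ isT); apply: hardy_ext => z _.
  by rewrite /= ?eqxx big_nil mul1r.
apply: IH => // v vs.
have vw : w1 != v by apply/eqP => E; move: w1s; rewrite E vs.
have h1 := H w1 (mem_head _ _); have h2 := H v; rewrite inE vs orbT in h2; have {}h2 := h2 isT.
have := hardyZ ((w1 - v)^-1) (hardyD h1 (hardyZ (-1) h2)); apply: hardy_ext => z _.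
rewrite /= eqxx (negbTE vw) big_cons (prod_rem z vs).
have : w1 - v != 0 by rewrite subr_eq0.
set P := \prod_(v <- _) _ => h; field; exact: h.
Qed.

Section Bounded.
Variables (k : nat) (a : 'I_k -> R) (zeta : 'I_k -> C).
Hypotheses (k0 : (0 < k)%N) (a0 : forall i, 0 < a i) (z1 : forall i, cmod (zeta i) = 1).

(** Let [Q] be the product of the [z - w] over the distinct points [w] among the [zeta i]. Then
    [Q u] is in D(mu), so [g Q u = c + (z - zeta i) v], and [c = 0] by radial limits. Dividing by
    [z - zeta i] shows that [g u] times each partial product is a Hardy function, and interpolation
    removes the products. *)
Lemma multiplier_hardy g u : multiplier a zeta g -> hardy u -> hardy (fun z => g z * u z).
Proof.
move=> [gD gM] uh; pose s := undup [seq zeta i | i : 'I_k].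
have zs i : zeta i \in s by rewrite mem_undup; apply/mapP; exists i; rewrite ?mem_enum.
have sz w : w \in s -> exists i, w = zeta i by rewrite mem_undup => /mapP[i _ ->]; exists i.
have QuD : in_Dmu a zeta (fun z => (\prod_(w <- s) (z - w)) * u z).
  apply/(in_DmuP _ k0 a0 z1); split; first exact/hardy_expands/hardy_prod_mul.
  move=> i; exists 0, (fun z => (\prod_(w <- rem (zeta i) s) (z - w)) * u z).
  split; first exact: hardy_prod_mul.
  by move=> z _; rewrite add0r (prod_rem _ (zs i)) mulrA.
have /(in_DmuP _ k0 a0 z1)[_ gQ] := gM _ QuD.
have /(in_DmuP _ k0 a0 z1)[_ gdiv] := gD.
apply: (@hardy_of_partial_products s); first exact: undup_uniq.
  by apply/eqP => E; have := zs (Ordinal k0); rewrite E.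
move=> w /[dup] ws /sz[i wi]; have [c [v [vh gE]]] := gQ i; have [c' [p [ph gE']]] := gdiv i.
have Quh : hardy (fun z => (\prod_(w <- rem (zeta i) s) (z - w)) * u z) by exact: hardy_prod_mul.
(* Boundedness of [g] is not yet available, but its own decomposition [c' + (z - zeta i) p] gives it
   a radial limit, while [Q u] tends to 0. *)
have c0 : c = 0.
  apply: (@radial0_cst _ (zeta i)).
  have r1 := radial0_hardy (z1 i) Quh; have r2 := radial0_hardy (z1 i) ph.
  have r3 := radial0_hardy (z1 i) vh.
  have := radial0D (radial0D (radial0Z c' r1) (radial0M r2 r1)) (radial0Z (-1) r3).
  apply: radial0_ext => // z zD; have := gE z zD; rewrite gE' // (prod_rem _ (zs i)) => E.
  have -> : c = (c' + (z - zeta i) * p z) * ((z - zeta i) * \prod_(v0 <- rem (zeta i) s) (z - v0) * u z)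
    - (z - zeta i) * v z by rewrite E; ring.
  ring.
apply: hardy_ext vh => z zD; have := gE z zD; rewrite c0 add0r (prod_rem _ (zs i)) wi => E.
have zz : z - zeta i != 0 by rewrite -opprB oppr_eq0; exact: disc_sub_neq0 (z1 i) zD.
by apply: (mulfI zz); rewrite -E; ring.
Qed.

(** For [f = c' + (z - zeta i) v] the product is [c' g + (z - zeta i) (g v)], where [g v] is a Hardy
    function because [g] is bounded. *)
Lemma bounded_multiplier g (K : R) : in_Dmu a zeta g -> (forall z, in_disc z -> cmod (g z) <= K) ->
  multiplier a zeta g.
Proof.
move=> gD gK; split => // f /(in_DmuP _ k0 a0 z1)[[b bf] fdiv].
have /(in_DmuP _ k0 a0 z1)[[al alg] gdiv] := gD.
apply/(in_DmuP _ k0 a0 z1); split; first by eexists; exact: expands_cauchy_prod alg bf.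
move=> i; have [c [u [uh gE]]] := gdiv i; have [c' [v [vh fE]]] := fdiv i.
exists (c' * c), (fun z => c' * u z + g z * v z); split.
  by apply: hardyD; [exact: hardyZ|exact: hardy_mul_bounded alg gK vh].
by move=> z zD; rewrite fE // mulrDr {1}(gE z zD); ring.
Qed.

End Bounded.
End Multipliers.

(** * Boundedness of multipliers of the Hardy space *)

Section GlidingHump.
Variable R : realType.
Local Notation C := R[i].
Implicit Types (g u : C -> C) (zs : nat -> C).

Lemma Re_inv (v : C) : complex.Re v^-1 = complex.Re v / cmod v ^+ 2.
Proof.
have [->|v0] := eqVneq v 0; first by rewrite invr0 /= mul0r.
have v1 : 0 < cmod v by rewrite cmod_gt0.
have -> : v^-1 = real_complex R (cmod v ^+ 2)^-1 * conjc v.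
  apply: (mulfI v0); rewrite divff // mulrCA mul_conjc -rmorphM mulVf ?rmorph1 //.
  by rewrite expf_neq0 // gt_eqF.
by rewrite Re_mul Re_conjc Im_conjc /= mul0r subr0 mulrC.
Qed.

(* The sum of the rescaled Szego kernels at the points [zs m] is large at every [zs m], because all
   the kernels have positive real part. *)
Lemma hardy_large_at zs : (forall m, in_disc (zs m)) -> exists2 u, hardy u &
  forall m, (1 / 4) ^+ m <= cmod (u (zs m)) * Num.sqrt (1 - cmod (zs m) ^+ 2).
Proof.
move=> zD; pose q : R := 1 / 4; have q0 : 0 <= q by rewrite /q; lra.
have q1 : q < 1 by rewrite /q; lra.
pose s m := Num.sqrt (1 - cmod (zs m) ^+ 2).
have d0 m : 0 < 1 - cmod (zs m) ^+ 2 by rewrite subr_gt0 expr_lt1 ?cmod_ge0 ?zD.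
have s0 m : 0 < s m by rewrite sqrtr_gt0.
have s2 m : s m ^+ 2 = 1 - cmod (zs m) ^+ 2 by rewrite sqr_sqrtr // ltW.
have s1 m : s m <= 1.
  by rewrite -(ler_pXn2r (n := 2)) ?nnegrE ?(ltW (s0 m)) // s2 expr1n lerBlDr lerDl sqr_ge0.
have geo N : \sum_(m < N) q ^+ m <= 2.
  by apply: le_trans (geometric_sum_le N q0 q1) _; rewrite -[leRHS]invrK lef_pV2 ?posrE /q; lra.
(* Coefficients of the kernel at [zs m], whose norm is [1 / s m], rescaled to norm [q ^+ m]. *)
pose t m i : C := real_complex R (q ^+ m * s m) * conjc (zs m) ^+ i.
have tq m i : cmod (t m i) <= q ^+ m.
  rewrite cmodM cmodX cmod_conj cmod_real ger0_norm ?mulr_ge0 ?exprn_ge0 ?(ltW (s0 m)) //.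
  rewrite -mulrA ler_piMr ?exprn_ge0 // -[leRHS]mulr1 ler_pM ?(ltW (s0 m)) ?exprn_ge0 ?cmod_ge0 //.
  by rewrite exprn_ile1 ?cmod_ge0 // ltW // zD.
have /choice[c cP] i : exists l, ccvg (fun N => \sum_(m < N) t m i) l.
  apply: (@abs_summable_ccvg _ (fun m => t m i) 2) => N; apply: le_trans (geo N).
  exact: ler_sum.
have tail N i : cmod (c i - \sum_(m < N) t m i) <= 2 * q ^+ N.
  apply: (ccvg_dist_le (N := N)) (cP i) => n Nn.
  rewrite -(subnKC Nn) big_split_ord /= addrAC subrr add0r (le_trans (cmod_sum _ _ _)) //.
  apply: (@le_trans _ _ (q ^+ N * \sum_(m < n - N) q ^+ m)).
    by rewrite mulr_sumr; apply: ler_sum => m _; rewrite -exprD.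
  by rewrite mulrC ler_wpM2r ?exprn_ge0.
have cl2 : l2 c.
  exists 4 => n; apply: (@ccvg_sum_sqr_le _ n (fun i N => \sum_(m < N) t m i) c _ 0%N) => // N _.
  (* Since [q = p * p], the weight is shared between the two factors of Cauchy-Schwarz. *)
  pose p : R := 1 / 2; have p2 m : p ^+ m * p ^+ m = q ^+ m.
    by rewrite -exprMn; congr (_ ^+ _); rewrite /p /q; lra.
  apply: (@le_trans _ _ (\sum_(i < n) 2 * \sum_(m < N) q ^+ m * (s m ^+ 2 * (cmod (zs m) ^+ 2) ^+ i))).
    apply: ler_sum => i _.
    have := cauchy_schwarz_cmod (index_enum 'I_N) xpredT (fun m => real_complex R (p ^+ m))
      (fun m => real_complex R (p ^+ m * s m) * conjc (zs m) ^+ i).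
    have -> : \sum_(m < N) real_complex R (p ^+ m) * (real_complex R (p ^+ m * s m) * conjc (zs m) ^+ i) =
        \sum_(m < N) t m i.
      by apply: eq_bigr => m _; rewrite mulrA -rmorphM mulrA p2.
    move=> /le_trans; apply; apply: ler_pM; try by apply: sumr_ge0 => m _; exact: sqr_ge0.
      apply: le_trans (geo N); apply: ler_sum => m _.
      by rewrite cmod_real real_normK ?num_real // expr2 p2.
    apply: ler_sum => m _; rewrite cmodM cmodX cmod_conj cmod_real exprMn real_normK ?num_real //.
    by rewrite exprMn -mulrA [p ^+ m ^+ 2]expr2 p2 exprAC.
  rewrite -mulr_sumr exchange_big /= (_ : 4 = 2 * 2 :> R); last by ring.
  rewrite ler_wpM2l //; apply: le_trans (geo N); apply: ler_sum => m _.
  rewrite -mulr_sumr ler_piMr ?exprn_ge0 // -mulr_sumr s2.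
  have x1 : cmod (zs m) ^+ 2 < 1 by rewrite -subr_gt0.
  apply: le_trans (ler_wpM2l (ltW (d0 m)) (geometric_sum_le n (sqr_ge0 _) x1)) _.
  by rewrite divff // gt_eqF.
have [u cu] : exists u, expands c u.
  apply: subgeom_expands; apply: (@bounded_subgeom _ _ 2) => i.
  by have := tail 0%N i; rewrite big_ord0 subr0 expr0 mulr1.
exists u; first by exists c.
(* The partial sums of the kernels in closed form, where the signs of the real parts can be read
   off. *)
move=> m; pose U N z := \sum_(j < N) real_complex R (q ^+ j * s j) * (1 - conjc (zs j) * z)^-1.
have uE N : expands (fun i => \sum_(j < N) t j i) (U N).
  apply: (expands_sum (index_enum 'I_N) (a := fun j => t j) (f := fun j z => real_complex R (q ^+ j * s j) * (1 - conjc (zs j) * z)^-1)) => j.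
  by apply: expandsZ; apply: expands_geometric; rewrite cmod_conj; exact/ltW/zD.
have r0 := cmod_ge0 (zs m); have r1 : cmod (zs m) < 1 := zD m.
have err N : cmod (u (zs m) - U N (zs m)) <= 2 / (1 - cmod (zs m)) * q ^+ N.
  apply: (expands_psum_le r0 r1 (lexx _) (expandsB cu (uE N))) => n.
  apply: (@le_trans _ _ (2 * q ^+ N * \sum_(i < n) cmod (zs m) ^+ i)).
    rewrite mulr_sumr; apply: ler_sum => i _; apply: ler_wpM2r; first exact: exprn_ge0.
    exact: tail.
  rewrite [leRHS]mulrAC ler_wpM2l ?mulr_ge0 ?exprn_ge0 //; exact: geometric_sum_le.
have low N : (m < N)%N -> q ^+ m / s m <= complex.Re (U N (zs m)).
  move=> mN; rewrite Re_sum (bigD1 (Ordinal mN)) //= -[leLHS]addr0; apply: lerD.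
    rewrite Re_mul /= mul0r subr0 Re_inv (mulrC (conjc (zs m))) mul_conjc.
    have -> : 1 - real_complex R (cmod (zs m) ^+ 2) = real_complex R (s m ^+ 2) by rewrite s2 rmorphB.
    rewrite cmod_real /= real_normK ?num_real // le_eqVlt; apply/orP; left; apply/eqP.
    by have := s0 m => sm; field; rewrite gt_eqF.
  apply: sumr_ge0 => j _; rewrite Re_mul /= mul0r subr0 Re_inv.
  rewrite mulr_ge0 ?divr_ge0 ?sqr_ge0 ?mulr_ge0 ?exprn_ge0 ?(ltW (s0 j)) //.
  have w1 : cmod (conjc (zs j) * zs m) <= 1.
    by rewrite cmodM cmod_conj mulr_ile1 ?cmod_ge0 // ltW // zD.
  rewrite Re_add Re_opp /= subr_ge0; apply: le_trans w1.
  exact: le_trans (ler_norm _) (cmod_Re _).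
rewrite -ler_pdivrMr ?s0 // -/(s m); apply/ler_addgt0Pr => e e0.
have [N0 HN] := geom_small (2 / (1 - cmod (zs m))) q0 q1 e0.
have := HN _ (leq_maxl N0 m.+1); have := low _ (leq_maxr N0 m.+1); have := err (maxn N0 m.+1).
set N := maxn _ _; have := ler_norm (complex.Re (U N (zs m))); have := cmod_Re (U N (zs m)).
have := ler_cmodB (U N (zs m)) (u (zs m)); rewrite (cmodC (U N (zs m))) -/q; lra.
Qed.

(** If [g] were unbounded, points with [cmod (g (zs m)) > m * 4 ^+ m] and the function [u] of
    [hardy_large_at] would make [|g u|^2 (1 - |z|^2)] exceed [m ^+ 2] at [zs m], against the
    pointwise bound for the Hardy function [g u]. *)
Lemma hardy_multiplier_bounded al g : expands al g ->
  (forall u, hardy u -> hardy (fun z => g z * u z)) ->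
  exists K : R, forall z, in_disc z -> cmod (g z) <= K.
Proof.
move=> alg gu; apply: contrapT => nK.
have /choice[zs zP] (m : nat) : exists z, in_disc z /\ m%:R * 4 ^+ m < cmod (g z).
  apply: contrapT => H; apply: nK; exists (m%:R * 4 ^+ m) => z zD.
  by rewrite leNgt; apply/negP => h; apply: H; exists z.
have [u uh uP] := hardy_large_at (fun m => (zP m).1).
have [c cE [M cM]] := gu u uh.
have M0 : 0 <= M by have := cM 0%N; rewrite big_ord0.
pose m := (Num.bound M).+1.
have mM : M < m%:R by apply: lt_trans (archi_boundP M0) _; rewrite ltr_nat.
have := expands_pointwise cE cM (zP m).1; have := uP m; have := (zP m).2.
have d0 : 0 < 1 - cmod (zs m) ^+ 2 by rewrite subr_gt0 expr_lt1 ?cmod_ge0 ?(zP m).1.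
rewrite -[1 - cmod (zs m) ^+ 2]sqr_sqrtr ?(ltW d0) // sqrtr_sqr ger0_norm ?sqrtr_ge0 //.
rewrite cmodM -exprMn; set G := cmod (g _); set V := cmod (u _) * _ => h1 h2.
rewrite -mulrA -/V => h3.
have q40 : 0 < (1 / 4) ^+ m :> R by rewrite exprn_gt0.
have h4 : m%:R < G * (1 / 4) ^+ m.
  by rewrite div1r exprVn ltr_pdivlMr ?exprn_gt0.
have h5 : m%:R < G * V.
  by apply: lt_le_trans h4 _; rewrite ler_wpM2l ?cmod_ge0.
have m1 : (1 : R) <= m%:R by rewrite ler1n.
have : m%:R * m%:R < (G * V) ^+ 2 by rewrite expr2 ltr_pM.
have := ler_wpM2l (ler0n R m) m1; lra.
Qed.

End GlidingHump.

(** * Characters of the multiplier algebra *)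

Section MultiplierAlgebra.
Variable R : realType.
Local Notation C := R[i].
Variables (k : nat) (a : 'I_k -> R) (zeta : 'I_k -> C).
Hypotheses (k0 : (0 < k)%N) (a0 : forall i, 0 < a i) (z1 : forall i, cmod (zeta i) = 1).
Implicit Types (f g h u : C -> C).
Local Notation mult := (multiplier a zeta).

Lemma multiplierP g : mult g <-> [/\ exists al, expands al g,
  exists K : R, forall z, in_disc z -> cmod (g z) <= K & forall i, divisible_at (zeta i) g].
Proof.
split=> [gm|[ge [K gK] gdiv]].
  have /(in_DmuP _ k0 a0 z1)[[al alg] gdiv] := gm.1.
  split => //; first by exists al.
  apply: hardy_multiplier_bounded alg _ => u; exact: (multiplier_hardy k0 a0 z1).
by apply: (bounded_multiplier k0 a0 z1 (K := K)) => //; apply/(in_DmuP _ k0 a0 z1).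
Qed.

Lemma multiplier_ext g h : (forall z, in_disc z -> g z = h z) -> mult g -> mult h.
Proof.
move=> gh /multiplierP[[al alg] [K gK] gdiv]; apply/multiplierP; split.
- by exists al; exact: expands_ext alg.
- by exists K => z zD; rewrite -gh // gK.
- move=> i; have [c [u [uh gE]]] := gdiv i; exists c, u; split => // z zD.
  by rewrite -gh // gE.
Qed.

Lemma multiplier_cst (c : C) : mult (fun=> c).
Proof.
apply/multiplierP; split.
- by eexists; exact: expands_cst.
- by exists (cmod c).
- by move=> i; exists c, (fun=> 0); split=> [|z _]; [exact: hardy_cst|rewrite mulr0 addr0].
Qed.

Lemma multiplierD g h : mult g -> mult h -> mult (fun z => g z + h z).
Proof.
move=> /multiplierP[[al alg] [K gK] gdiv] /multiplierP[[b bh] [L hL] hdiv].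
apply/multiplierP; split.
- by eexists; exact: expandsD alg bh.
- by exists (K + L) => z zD; rewrite (le_trans (cmodD _ _)) // lerD ?gK ?hL.
- move=> i; have [c [u [uh gE]]] := gdiv i; have [d [v [vh hE]]] := hdiv i.
  exists (c + d), (fun z => u z + v z); split; first exact: hardyD.
  by move=> z zD; rewrite gE // hE //; ring.
Qed.

Lemma multiplierM g h : mult g -> mult h -> mult (fun z => g z * h z).
Proof.
move=> gm hm; have /multiplierP[[al alg] [K gK] gdiv] := gm.
have /multiplierP[[b bh] [L hL] hdiv] := hm.
apply/multiplierP; split; last first.
- by have /(in_DmuP _ k0 a0 z1)[] := gm.2 h hm.1.
- exists (K * L) => z zD; rewrite cmodM ler_pM ?cmod_ge0 ?gK ?hL //.
- by eexists; exact: expands_cauchy_prod alg bh.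
Qed.

Lemma multiplierZ (c : C) g : mult g -> mult (fun z => c * g z).
Proof. by move=> gm; exact: multiplierM (multiplier_cst c) gm. Qed.

Section Character.
Variable psi : (C -> C) -> C.
Hypothesis hpsi : character a zeta psi.

Lemma psi_ext f g : (forall z, in_disc z -> f z = g z) -> psi f = psi g.
Proof. by case: hpsi => H _ _ _ _; exact: H. Qed.

Lemma psiD f g : mult f -> mult g -> psi (fun z => f z + g z) = psi f + psi g.
Proof. by case: hpsi => _ H _ _ _; exact: H. Qed.

Lemma psiZ (c : C) f : mult f -> psi (fun z => c * f z) = c * psi f.
Proof. by case: hpsi => _ _ H _ _; exact: H. Qed.

Lemma psiM f g : mult f -> mult g -> psi (fun z => f z * g z) = psi f * psi g.
Proof. by case: hpsi => _ _ _ H _; exact: H. Qed.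

Lemma psi1 : psi (fun=> 1) = 1.
Proof.
case: hpsi => _ _ _ _ [f fm fn0]; apply: (mulIf fn0).
rewrite mul1r -psiM //; last exact: multiplier_cst.
by apply: psi_ext => z _; rewrite mul1r.
Qed.

Lemma psi_cst (c : C) : psi (fun=> c) = c.
Proof.
transitivity (psi (fun=> c * 1)); first by apply: psi_ext => z _; rewrite mulr1.
by rewrite psiZ ?psi1 ?mulr1 //; exact: multiplier_cst.
Qed.

Lemma mult_psi_sum I (r : seq I) (F : I -> C -> C) : (forall i, mult (F i)) ->
  mult (fun z => \sum_(i <- r) F i z) /\
  psi (fun z => \sum_(i <- r) F i z) = \sum_(i <- r) psi (F i).
Proof.
move=> Fm; elim: r => [|i r [IHm IH]].
  split; first by apply: multiplier_ext (multiplier_cst 0) => z _; rewrite big_nil.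
  by rewrite big_nil -[RHS]psi_cst; apply: psi_ext => z _; rewrite big_nil.
have E z : F i z + \sum_(i <- r) F i z = \sum_(i <- i :: r) F i z by rewrite big_cons.
split; first by apply: multiplier_ext (multiplierD (Fm i) IHm) => z _; rewrite -E.
by rewrite big_cons -IH -psiD //; apply: psi_ext => z _; rewrite -E.
Qed.

Lemma mult_psi_prod I (r : seq I) (P : pred I) (F : I -> C -> C) : (forall i, mult (F i)) ->
  mult (fun z => \prod_(i <- r | P i) F i z) /\
  psi (fun z => \prod_(i <- r | P i) F i z) = \prod_(i <- r | P i) psi (F i).
Proof.
move=> Fm; elim: r => [|i r [IHm IH]].
  split; first by apply: multiplier_ext (multiplier_cst 1) => z _; rewrite big_nil.
  by rewrite big_nil -[RHS]psi_cst; apply: psi_ext => z _; rewrite big_nil.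
case Pi : (P i); last first.
  split; first by apply: multiplier_ext IHm => z _; rewrite big_cons Pi.
  by rewrite big_cons Pi -IH; apply: psi_ext => z _; rewrite big_cons Pi.
have E z : F i z * \prod_(i <- r | P i) F i z = \prod_(i <- i :: r | P i) F i z by rewrite big_cons Pi.
split; first by apply: multiplier_ext (multiplierM (Fm i) IHm) => z _; rewrite -E.
by rewrite big_cons Pi -IH -psiM //; apply: psi_ext => z _; rewrite -E.
Qed.

(* If [psi] kills every [g j], then [e i] below is in the ideal they generate and [1 - e i] vanishes
   at [zeta i]; the product of the [1 - e i] carries the bounded solutions of Bezout's equation into
   the multiplier algebra. *)
Lemma kernel_not_bounded_below n (g : 'I_n -> C -> C) (nu : R) : (forall j, mult (g j)) ->
  (forall j, psi (g j) = 0) -> 0 < nu ->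
  ~ (forall z, in_disc z -> nu <= \sum_(j < n) cmod (g j z) ^+ 2).
Proof.
move=> gm g0 nu0 gnu.
have /choice[al alg] j : exists al, expands al (g j) by case/multiplierP: (gm j).
have /choice[K gK] j : exists K : R, forall z, in_disc z -> cmod (g j z) <= K by case/multiplierP: (gm j).
have [h [b [L [bh hL gh]]]] : exists (h : 'I_n -> C -> C) (b : 'I_n -> nat -> C) (K : R),
    [/\ forall j, expands (b j) (h j), forall j z, in_disc z -> cmod (h j z) <= K &
        forall z, in_disc z -> \sum_(j < n) g j z * h j z = 1].
  apply: (hinf_corona (nu := nu) (B := \sum_(j < n) K j ^+ 2) nu0 alg) => z zD; rewrite gnu //=.
  apply: ler_sum => j _; rewrite lerXn2r ?nnegrE ?cmod_ge0 ?gK //.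
  by apply: le_trans (gK j z zD); exact: cmod_ge0.
(* Here [e i] is the factor that vanishes at [zeta i]: it is 1 plus a combination of the [g j],
   which [psi] kills, so [psi (e i) = 1]. *)
have /choice[e eP] i : exists e : C -> C, [/\ mult e, psi e = 1 & exists u, hardy u /\
    forall z, in_disc z -> e z = (z - zeta i) * u z].
  have /choice[cu cuP] j : exists cu : C * (C -> C), hardy cu.2 /\
      forall z, in_disc z -> g j z = cu.1 + (z - zeta i) * cu.2 z.
    by have [_ _ /(_ i)[c [u H]]] := (multiplierP (g j)).1 (gm j); exists (c, u).
  pose c j := (cu j).1; pose u j := (cu j).2.
  pose S := \sum_(j < n) c j * conjc (c j).
  (* [c j] is the value of [g j] at [zeta i]. If all were 0, the [g j] would tend to 0 along the
     radius, and so would the sum of the [g j * h j], which is 1, as the [h j] are bounded. *)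
  have Sn0 : S != 0.
    apply/eqP => S0.
    have c0 j : c j = 0.
      have : \sum_(j < n) cmod (c j) ^+ 2 = 0.
        have := congr1 (@complex.Re R) S0; rewrite Re_sum /= => E; rewrite -[RHS]E.
        by apply: eq_bigr => l _; rewrite mul_conjc.
      move=> /eqP; rewrite psumr_eq0; last by move=> l _; exact: sqr_ge0.
      move=> /allP /(_ j (mem_index_enum j)) /=; rewrite sqrf_eq0 cmod_eq0 => /eqP.
      exact.
    have gr j : radial0 (zeta i) (g j).
      have := radial0_hardy (z1 i) (cuP j).1; apply: radial0_ext => // z zD.
      by rewrite (cuP j).2 // -/(c j) c0 add0r.
    have sr : radial0 (zeta i) (fun z => \sum_(j < n) g j z * h j z).
      have gr' j : radial0 (zeta i) (fun z => g j z * h j z).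
        move=> e e0; have L0 : 0 < `|L| + 1 by rewrite ltr_wpDl.
        have [d d0 H] := gr j _ (divr_gt0 e0 L0); exists d => // r r0 rd r1.
        rewrite cmodM; apply: (@le_lt_trans _ _ (cmod (g j (real_complex R r * zeta i)) * (`|L| + 1))).
          rewrite ler_wpM2l ?cmod_ge0 //; have := hL j _ (in_disc_radial (z1 i) r0 r1).
          by have := ler_norm L; lra.
        by rewrite -ltr_pdivlMr // H.
      elim: (index_enum _) => [|j r IH].
        by move=> e e0; exists 1 => // r _ _ _; rewrite big_nil cmod0.
      by apply: radial0_ext (radial0D (gr' j) IH) => // z _; rewrite big_cons.
    have : radial0 (zeta i) (fun=> 1) by apply: radial0_ext sr => // z zD; exact: gh.
    by move=> /radial0_cst/eqP; rewrite oner_eq0.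
  (* Normalised so that the sum of the [F j] has the value -1 at [zeta i]. *)
  pose F j z := - (conjc (c j) / S) * g j z.
  have Fm j : mult (F j) by exact: multiplierZ.
  have [sm sE] := mult_psi_sum (index_enum 'I_n) Fm.
  exists (fun z => 1 + \sum_(j < n) F j z); split.
  - by apply: multiplierD => //; exact: multiplier_cst.
  - rewrite psiD ?psi1 ?sE //; last exact: multiplier_cst.
    by rewrite big1 ?addr0 // => j _; rewrite psiZ // g0 mulr0.
  - exists (fun z => \sum_(j < n) - (conjc (c j) / S) * u j z); split.
      elim: (index_enum _) => [|j r IH].
        by apply: hardy_ext (hardy_cst 0) => z _; rewrite big_nil.
      apply: hardy_ext (hardyD (hardyZ (- (conjc (c j) / S)) (cuP j).1) IH) => z _.
      by rewrite big_cons.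
    move=> z zD; rewrite mulr_sumr.
    have -> : \sum_(j < n) F j z = \sum_(j < n) - (conjc (c j) / S) * c j +
        \sum_(j < n) (z - zeta i) * (- (conjc (c j) / S) * u j z).
      rewrite -big_split; apply: eq_bigr => j _ /=; rewrite /F (cuP j).2 // -/(c j) -/(u j); ring.
    have -> : \sum_(j < n) - (conjc (c j) / S) * c j = -1.
      transitivity (- (S^-1 * S)); last by rewrite mulVf.
      by rewrite mulr_sumr -sumrN; apply: eq_bigr => j _; ring.
    by rewrite addrA subrr add0r.
have eM i : mult (e i) by case: (eP i).
have [Em EE] := mult_psi_prod (index_enum 'I_k) xpredT eM.
pose E z := \prod_(i < k) e i z.
(* At [zeta i] the factor [e i] supplies [z - zeta i] times a Hardy function, and the other factors
   together with [h j] are bounded; the decomposition holds with constant 0. *)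
have Eh j : mult (fun z => E z * h j z).
  have /multiplierP[[be beE] [M EM] _] := Em.
  apply/multiplierP; split.
  - by eexists; exact: expands_cauchy_prod beE (bh j).
  - exists (M * L) => z zD; rewrite cmodM ler_pM ?cmod_ge0 ?hL //; exact: EM.
  - move=> i; have [_ _ [u [uh eE]]] := eP i.
    have [Pm _] := mult_psi_prod (index_enum 'I_k) (fun l => l != i) eM.
    have /multiplierP[[bp bpE] [M' PM] _] := Pm.
    exists 0, (fun z => ((\prod_(l < k | l != i) e l z) * h j z) * u z); split.
      apply: (@hardy_mul_bounded _ _ _ _ (M' * L) (expands_cauchy_prod bpE (bh j))) => // z zD.
      by rewrite cmodM ler_pM ?cmod_ge0 ?hL //; exact: PM.
    by move=> z zD; rewrite /E (bigD1 i) //= eE //; ring.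
have Gm j : mult (fun z => g j z * (E z * h j z)) by exact: multiplierM.
have [_ GE] := mult_psi_sum (index_enum 'I_n) Gm.
have : psi E = 0.
  rewrite (psi_ext (g := fun z => \sum_(j < n) g j z * (E z * h j z))).
    by rewrite GE big1 // => j _; rewrite psiM // g0 mul0r.
  move=> z zD; rewrite -[LHS]mulr1 -(gh z zD) mulr_sumr; apply: eq_bigr => j _; ring.
rewrite /E EE big1 => [|i _]; last by case: (eP i).
by move/eqP; rewrite oner_eq0.
Qed.

End Character.
End MultiplierAlgebra.

Unset Implicit Arguments.
Local Close Scope classical_set_scope.

(* Point evaluations at points of D are weak-* dense in the maximal ideal
   space of M(D(mu_k)): every weak-* basic neighbourhood
   { chi : |chi(f_j) - psi(f_j)| < eps, j < n } of a character psi contains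
   an evaluation chi = (f |-> f z) with z in D. *)
Theorem theorem1p1 (R : realType) (k : nat) (hk : (0 < k)%N)
    (a : 'I_k -> R) (zeta : 'I_k -> R[i])
    (ha : forall i, 0 < a i) (hzeta : forall i, cmod (zeta i) = 1)
    (psi : (R[i] -> R[i]) -> R[i]) (hpsi : character a zeta psi)
    (n : nat) (f : 'I_n -> R[i] -> R[i])
    (hf : forall j, multiplier a zeta (f j))
    (eps : R) (heps : 0 < eps) :
  exists2 z : R[i], in_disc z &
    forall j : 'I_n, cmod (psi (f j) - f j z) < eps.
Proof.
apply: contrapT => H.
have cm := multiplier_cst hk ha hzeta.
pose g j z := f j z + - psi (f j).
have gm j : multiplier a zeta (g j) by exact: multiplierD.
have g0 j : psi (g j) = 0.
  by rewrite (psiD hpsi) // (psi_cst hk ha hzeta hpsi) subrr.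
(* The bound [nu] is [eps ^+ 2]: where the sum of squares is smaller, every [cmod (g j z)] is below
   [eps], and [z] is the required point. *)
apply: (kernel_not_bounded_below hk ha hzeta hpsi gm g0 (exprn_gt0 2 heps)) => z zD.
rewrite leNgt; apply/negP => S; apply: H; exists z => // j.
rewrite -(ltr_pXn2r (n := 2)) ?nnegrE ?cmod_ge0 ?(ltW heps) //; apply: le_lt_trans S.
by rewrite (bigD1 j) //= cmodC lerDl sumr_ge0 // => i _; exact: sqr_ge0.
Qed.
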